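(* Let $G=([n],E)$ be a natural unit interval graph. Then its chromatic quasisymmetric function satisfies $$X_G(\mathbf x;q)=\sum_{\mathcal F\in\mathrm{FT}(G)}\mathrm{sign}(\mathcal F)\,q^{\mathrm{weight}(\mathcal F)}\,e_{\mathrm{type}(\mathcal F)}=\sum_\mu\Big(\sum_{\mathcal F\in\mathrm{FT}_\mu(G)}\mathrm{sign}(\mathcal F)\,q^{\mathrm{weight}(\mathcal F)}\Big)e_\mu .$$
   Context: A graph $G=([n],E)$ is a natural unit interval graph if for all $1\le i<j<k\le n$, $\{i,k\}\in E$ implies $\{i,j\}\in E$ and $\{j,k\}\in E$. The chromatic quasisymmetric function is $X_G(\mathbf x;q)=\sum_{\kappa}q^{\mathrm{asc}(\kappa)}x_{\kappa(1)}\cdots x_{\kappa(n)}$, summed over proper colourings $\kappa:[n]\to\{1,2,\dots\}$ (i.e. $\kappa(i)\neq\kappa(j)$ whenever $\{i,j\}\in E$), where $\mathrm{asc}(\kappa)$ is the number of pairs $(i,j)$ with $i<j$, $\{i,j\}\in E$ and $\kappa(i)<\kappa(j)$. For natural unit interval graphs it is symmetric in $\mathbf x$. $e_k=\sum_{i_1<\dots<i_k}x_{i_1}\cdots x_{i_k}$ and $e_\mu=e_{\mu_1}e_{\mu_2}\cdots$. A decreasing subtree of $G$ is a subgraph $T$ of $G$ which is a tree (with nonempty vertex set) such that every vertex of $T$ other than the largest vertex of $T$ has exactly one neighbour in $T$ larger than itself. For such $T$, $\mathrm{list}(T)$ is the permutation of $V(T)$ obtained by reading first the smallest vertex of $T$,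 and at each subsequent step reading the smallest unread vertex of $T$ that is adjacent in $T$ to an already read vertex. A tree triple of $G$ is $(T,\alpha,r)$ with $T$ a decreasing subtree of $G$, $\alpha=\alpha_1\cdots\alpha_\ell$ an integer composition with $|\alpha|=|V(T)|$, and $1\le r\le\alpha_1$. A forest triple of $G$ is a sequence $\mathcal F=((T_i,\alpha^{(i)},r_i))_{i=1}^m$ of tree triples such that every vertex of $G$ lies in exactly one $T_i$ and $\min V(T_1)<\min V(T_2)<\dots<\min V(T_m)$. Its type $\mathrm{type}(\mathcal F)$ is the partition obtained by sorting the parts of the concatenation $\alpha^{(1)}\cdots\alpha^{(m)}$ in decreasing order; its sign is $\mathrm{sign}(\mathcal F)=(-1)^{\sum_{i=1}^m(\ell(\alpha^{(i)})-1)}$; its weight is $\mathrm{weight}(\mathcal F)=\mathrm{inv}_G(\sigma)+\sum_{i=1}^m(r_i-1)$, where $\sigma=\mathrm{list}(T_1)\cdots\mathrm{list}(T_m)\in S_n$ is the concatenation and $\mathrm{inv}_G(\sigma)=|\{(i,j):i<j,\ \sigma_i>\sigma_j,\ \{\sigma_j,\sigma_i\}\in E\}|$. $\mathrm{FT}(G)$ is the set of forest triples of $G$ and $\mathrm{FT}_\mu(G)$ those of type $\mu$. *)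

(* Defs.v *)
From HB Require Import structures.
From mathcomp Require Import all_boot all_order all_algebra.
From mathcomp Require Import finmap multiset.
From mathcomp Require Import boolp classical_sets functions cardinality fsbigop.

Set Implicit Arguments.
Unset Strict Implicit.
Unset Printing Implicit Defensive.

Import GRing.Theory.

Local Open Scope classical_set_scope.
Local Open Scope ring_scope.

(* The vertex set [n] is 'I_n = {0, ..., n-1} and the variables x_1, x_2, ...
   are x_0, x_1, ..., i.e. vertices, colours and variables are all numbered
   from 0; only their order matters. *)

(* A monomial in the variables x_i is the finite multiset of their indices. *)
Definition monom : choiceType := {mset nat}%mset.

Definition monom_of_seq (s : seq nat) : monom := seq_mset s.

(* Formal power series in x_0, x_1, ... over Z[q] = {poly int} (q is 'X), given
   by their coefficients. Addition and scaling are pointwise.  The ^o makes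
   {poly int} a module over itself. *)
Definition series : Type := monom -> {poly int}^o.

HB.instance Definition _ := GRing.Lmodule.copy series (monom -> {poly int}^o).

Definition series1 : series := fun m => (m == mset0)%:R.

(* Cauchy product; a monomial has finitely many factorisations. *)
Definition series_mul (f g : series) : series := fun m =>
  \sum_(p \in [set p : monom * monom | msetD p.1 p.2 = m])
    (f p.1 * g p.2 : {poly int}).

(* The infinite sum, over i in D, of w i times the monomial mon i.  It is only
   used when every monomial arises from finitely many i. *)
Definition series_sum (I : choiceType) (D : set I) (w : I -> {poly int})
    (mon : I -> monom) : series :=
  fun m => \sum_(i \in [set i | D i /\ mon i = m]) w i.

Definition elem_sym (k : nat) : series :=
  series_sum [set t : k.-tuple nat | sorted ltn t] (fun=> 1)
    (fun t => monom_of_seq t).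

Definition elem_sym_part (mu : seq nat) : series :=
  \big[series_mul/series1]_(k <- mu) elem_sym k.

Definition is_partition (mu : seq nat) : bool :=
  sorted geq mu && all (ltn 0) mu.

Definition is_composition (al : seq nat) : bool := all (ltn 0) al.

Section Graph.

Variables (n : nat) (E : rel 'I_n).

Definition natural_unit_interval : Prop :=
  forall i j k : 'I_n, (i < j)%N -> (j < k)%N -> E i k -> E i j /\ E j k.

Definition proper_colouring (kappa : {ffun 'I_n -> nat}) : Prop :=
  forall i j, E i j -> kappa i != kappa j.

Definition asc (kappa : {ffun 'I_n -> nat}) : nat :=
  #|[pred p : 'I_n * 'I_n |
      [&& (p.1 < p.2)%N, E p.1 p.2 & (kappa p.1 < kappa p.2)%N]]|.

Definition chromatic_qsf : series :=
  series_sum [set kappa | proper_colouring kappa]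
    (fun kappa => 'X^(asc kappa))
    (fun kappa => monom_of_seq [seq kappa i | i <- enum 'I_n]).

End Graph.

(* The edge {x, y} is [set x; y]. *)
Record subgraph (n : nat) := Subgraph {
  verts : {set 'I_n};
  edges : {set {set 'I_n}} }.

Definition subgraph_pair n (T : subgraph n) := (verts T, edges T).
Definition pair_subgraph n (p : {set 'I_n} * {set {set 'I_n}}) :=
  Subgraph p.1 p.2.
Lemma subgraph_pairK n : cancel (@subgraph_pair n) (@pair_subgraph n).
Proof. by case. Qed.
HB.instance Definition _ n :=
  Choice.copy (subgraph n) (can_type (@subgraph_pairK n)).

Record tree_triple (n : nat) := TreeTriple {
  tt_tree : subgraph n;
  tt_comp : seq nat;
  tt_r : nat }.

Definition tree_triple_tuple n (t : tree_triple n) :=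
  (tt_tree t, tt_comp t, tt_r t).
Definition tuple_tree_triple n (p : subgraph n * seq nat * nat) :=
  TreeTriple p.1.1 p.1.2 p.2.
Lemma tree_triple_tupleK n : cancel (@tree_triple_tuple n) (@tuple_tree_triple n).
Proof. by case. Qed.
HB.instance Definition _ n :=
  Choice.copy (tree_triple n) (can_type (@tree_triple_tupleK n)).

Section Trees.

Variable n : nat.
Implicit Type T : subgraph n.

Definition adj T : rel 'I_n := fun x y => [set x; y]%SET \in edges T.

Definition is_subgraph (E : rel 'I_n) T : Prop :=
  forall e, e \in edges T ->
    exists x y, [/\ x \in verts T, y \in verts T, E x y & e = [set x; y]%SET].

Definition connected_graph T : Prop :=
  forall x y, x \in verts T -> y \in verts T -> connect (adj T) x y.

Definition acyclic_graph T : Prop :=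
  forall c : seq 'I_n, (2 < size c)%N -> ~ ucycle (adj T) c.

Definition is_tree T : Prop :=
  [/\ verts T != finset.set0, connected_graph T & acyclic_graph T].

Definition is_largest T (x : 'I_n) : bool :=
  (x \in verts T) && [forall y in verts T, (y <= x)%N].

Definition decreasing_subtree (E : rel 'I_n) T : Prop :=
  [/\ is_subgraph E T, is_tree T
    & forall x, x \in verts T -> ~~ is_largest T x ->
        #|[pred y in verts T | adj T x y & (x < y)%N]| = 1%N].

(* enum lists the elements of a set of ordinals in increasing order, so heads
   of (filtered) enumerations are minima. *)
Definition list_step T (s : seq 'I_n) : seq 'I_n :=
  if [seq y <- enum (verts T) | (y \notin s) && has (adj T y) s] is y :: _
  then rcons s y else s.

Definition list_tree T : seq 'I_n :=
  iter #|verts T|.-1 (list_step T) (take 1 (enum (verts T))).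

Definition min_vert T : nat := head 0%N [seq val x | x <- enum (verts T)].

Definition is_tree_triple (E : rel 'I_n) (t : tree_triple n) : Prop :=
  [/\ decreasing_subtree E (tt_tree t), is_composition (tt_comp t),
      sumn (tt_comp t) = #|verts (tt_tree t)|
    & (1 <= tt_r t <= head 0 (tt_comp t))%N].

Definition is_forest_triple (E : rel 'I_n) (F : seq (tree_triple n)) : Prop :=
  [/\ forall t, t \in F -> is_tree_triple E t,
      forall v : 'I_n, count (fun t => v \in verts (tt_tree t)) F = 1%N
    & sorted (fun t u => (min_vert (tt_tree t) < min_vert (tt_tree u))%N) F].

Definition FT (E : rel 'I_n) : set (seq (tree_triple n)) :=
  [set F | is_forest_triple E F].

Definition ft_type (F : seq (tree_triple n)) : seq nat :=
  sort geq (flatten [seq tt_comp t | t <- F]).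

Definition FT_mu (E : rel 'I_n) (mu : seq nat) : set (seq (tree_triple n)) :=
  [set F | FT E F /\ ft_type F = mu].

Definition ft_sign (F : seq (tree_triple n)) : {poly int} :=
  (-1) ^+ (\sum_(t <- F) (size (tt_comp t) - 1))%N.

Definition graph_inv (E : rel 'I_n) (s : seq 'I_n) : nat :=
  #|[pred p : 'I_(size s) * 'I_(size s) |
      let si := tnth (in_tuple s) p.1 in
      let sj := tnth (in_tuple s) p.2 in
      [&& (p.1 < p.2)%N, (sj < si)%N & E sj si]]|.

Definition ft_weight (E : rel 'I_n) (F : seq (tree_triple n)) : nat :=
  (graph_inv E (flatten [seq list_tree (tt_tree t) | t <- F])
   + \sum_(t <- F) (tt_r t - 1))%N.

End Trees.

(* Main.v *)
From HB Require Import structures.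
Require Import Defs.
From mathcomp Require Import all_boot all_order all_algebra.
From mathcomp Require Import ring zify.
From mathcomp Require Import boolp.

(* Fix finitely many variables, and let X_Z be the chromatic quasisymmetric
   polynomial of the subgraph induced on Z; it satisfies a recursion that peels
   off the vertices of the smallest colour. Put m = min Z and

     P_k = sum over compositions alpha of k of (-1)^(l(alpha) - 1) [alpha_1]_q e_alpha,

   so that (q - 1) P_k is the coefficient of z^k in E(qz)/E(z) for k > 0, where
   E(z) = prod (1 + x_i z).

   A decreasing tree is determined by its list, and the lists of the trees on U
   are built by inserting the vertices of U in increasing order; hence the sum of
   q^inv over these trees is c_U = prod [number of smaller neighbours in U]_q, over
   the vertices of U other than the root min U. Grouping forest triples by their
   first tree therefore reduces the theorem to

     X_Z = sum over U with m in U <= Z of c_U q^asc(Z - U, U) P_|U| X_(Z - U).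

   Multiplied by q - 1, this is proved by induction on the number of variables:
   adding a variable x to E changes the coefficients Q_k of E(qz)/E(z) by
   Q'_k + x Q'_(k-1) = Q_k + q x Q_(k-1), and the induction step becomes an identity
   between sums over independent sets I of c_(Z - I) q^asc(Z - I, I) and
   c_(Z - I) q^asc(I, Z - I). That identity is proved by removing the largest
   vertex N: in a natural unit interval graph the neighbours of N form a clique
   that contains every vertex between its least element and N. *)

Set Implicit Arguments.
Unset Strict Implicit.
Unset Printing Implicit Defensive.
Import GRing.Theory.
Local Open Scope ring_scope.

(** * Independent sets and the key identity *)

Section SubsetSums.
Variables (T : finType) (V : nmodType).
Implicit Types (S I : {set T}) (F : {set T} -> V).

Lemma big_subsetU1 (a : T) S (P : pred {set T}) F : a \notin S ->
  \sum_(I : {set T} | (I \subset a |: S) && P I) F I =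
  \sum_(I : {set T} | (I \subset S) && P I) F I +
  \sum_(I : {set T} | (I \subset S) && P (a |: I)) F (a |: I).
Proof.
move=> aS; rewrite (bigID (fun I : {set T} => a \in I)) /= addrC; congr (_ + _).
  apply: eq_bigl => I; case: (boolP (a \in I)) => aI /=.
    by rewrite andbF; symmetry; apply/negbTE/negP => /andP[/subsetP/(_ a aI)]; rewrite (negbTE aS).
  by rewrite andbT -subDset (setDidPl _) // disjoint_sym disjoints1.
rewrite (reindex_onto (fun I => a |: I) (fun I => I :\ a)) /=; last first.
  by move=> I /andP[_ aI]; rewrite setD1K.
apply: eq_bigl => I; rewrite setU11 andbT.
case: (boolP (a \in I)) => aI.
  have -> : (a |: I) :\ a == I = false.
    by apply/eqP => eI; move: aI; rewrite -eI !inE eqxx.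
  rewrite andbF; symmetry; apply/negbTE/negP => /andP[/subsetP/(_ a aI)].
  by rewrite (negbTE aS).
rewrite setU1K // eqxx andbT; congr (_ && _).
by rewrite subUset sub1set setU11 /= -subDset (setDidPl _) // disjoint_sym disjoints1.
Qed.

Lemma exchange_disjoint S (G : {set T} -> {set T} -> V) (P Q : pred {set T}) :
  \sum_(U : {set T} | (U \subset S) && P U)
     \sum_(I : {set T} | (I \subset S :\: U) && Q I) G U I =
  \sum_(I : {set T} | (I \subset S) && Q I)
     \sum_(U : {set T} | (U \subset S :\: I) && P U) G U I.
Proof.
rewrite (exchange_big_dep (fun I : {set T} => (I \subset S) && Q I)) /=; last first.
  by move=> U I _ /andP[]; rewrite subsetD => /andP[-> _] ->.
apply: eq_bigr => I /andP[IS QI]; apply: eq_bigl => U.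
by rewrite !subsetD IS QI /= andbT disjoint_sym andbAC.
Qed.

Lemma sum_disjoint_union S (G : {set T} -> {set T} -> V) (P Q : pred {set T}) :
  \sum_(B : {set T} | (B \subset S) && P B)
     \sum_(I : {set T} | (I \subset S :\: B) && Q I) G B I =
  \sum_(U : {set T} | U \subset S)
     \sum_(I : {set T} | [&& I \subset U, Q I & P (U :\: I)]) G (U :\: I) I.
Proof.
rewrite (exchange_disjoint _ _ P Q).
rewrite [RHS](exchange_big_dep (fun I : {set T} => (I \subset S) && Q I)) /=; last first.
  by move=> U I US /and3P[IU -> _]; rewrite (subset_trans IU US).
apply: eq_bigr => I /andP[IS QI].
rewrite [RHS](reindex_onto (fun U => I :|: U) (fun U => U :\: I)) /=; last first.
  move=> U /andP[_ /and3P[/subsetP IU _ _]]; apply/setP => x; rewrite !inE.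
  by case: (boolP (x \in I)) => // /IU ->.
apply: eq_big => [U|U /andP[]].
  rewrite QI subUset IS subsetUl /= setDUl setDv set0U subsetD.
  case: (boolP ([disjoint U & I])) => dUI; last first.
    rewrite andbF /=; symmetry; apply/negbTE/negP => /andP[_ /eqP eU].
    by case/negP: dUI; apply/setDidPl.
  by rewrite (setDidPl _) // eqxx !andbT.
rewrite subsetD => /andP[_ dUI] _.
by rewrite setDUl setDv set0U (setDidPl _).
Qed.

End SubsetSums.

Section Graph.
Variables (n : nat) (E : rel 'I_n).
Implicit Types (A B C I S K : {set 'I_n}) (u v m N : 'I_n).

Definition down_deg B v : nat := #|[set u in B | (u < v)%N && E u v]|.

Definition edges_up A B : nat := \sum_(b in B) down_deg A b.

Definition independent I : bool := [forall i in I, forall j in I, ~~ E i j].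

Lemma down_degU A B v : [disjoint A & B] ->
  down_deg (A :|: B) v = (down_deg A v + down_deg B v)%N.
Proof.
move=> dAB; rewrite /down_deg.
have -> : [set u in A :|: B | (u < v)%N && E u v] =
  [set u in A | (u < v)%N && E u v] :|: [set u in B | (u < v)%N && E u v].
  by apply/setP => x; rewrite !inE andb_orl.
rewrite cardsU disjoint_setI0 ?cards0 ?subn0 //; apply: disjointW dAB.
  by apply/subsetP => x; rewrite !inE => /andP[].
by apply/subsetP => x; rewrite !inE => /andP[].
Qed.

Lemma edges_upUl A B C : [disjoint A & B] ->
  edges_up (A :|: B) C = (edges_up A C + edges_up B C)%N.
Proof.
by move=> dAB; rewrite /edges_up -big_split; apply: eq_bigr => v _; rewrite down_degU.
Qed.

Lemma edges_upUr A B C : [disjoint B & C] ->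
  edges_up A (B :|: C) = (edges_up A B + edges_up A C)%N.
Proof. by move=> dBC; rewrite /edges_up -bigU //; apply: eq_bigl => v; rewrite !inE. Qed.

Lemma down_degU1_max N B v : (v <= N)%N -> down_deg (N |: B) v = down_deg B v.
Proof.
move=> vN; apply: eq_card => u; rewrite !inE.
by case: eqP => [->|//]; rewrite ltnNge vN /= !andbF.
Qed.

Lemma edges_up0l B : edges_up set0 B = 0%N.
Proof.
rewrite /edges_up big1 // => v _; apply/eqP; rewrite cards_eq0; apply/eqP/setP => u.
by rewrite !inE.
Qed.

Lemma edges_up0r A : edges_up A set0 = 0%N.
Proof. by rewrite /edges_up big_set0. Qed.

Lemma edges_upU1_max N A B : {in B, forall v, (v <= N)%N} ->
  edges_up (N |: A) B = edges_up A B.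
Proof. by move=> BN; apply: eq_bigr => v /BN; apply: down_degU1_max. Qed.

Lemma edges_upU1r N A B : N \notin B ->
  edges_up A (N |: B) = (down_deg A N + edges_up A B)%N.
Proof. by move=> NB; rewrite /edges_up big_setU1. Qed.

End Graph.

Definition qint (R : nzRingType) (q : R) (d : nat) : R := \sum_(i < d) q ^+ i.

(* [B] is the set of vertices other than the root [m]. *)
Definition tree_wt n (E : rel 'I_n) (R : comNzRingType) (q : R) (m : 'I_n)
    (B : {set 'I_n}) : R :=
  \prod_(v in B) qint q (down_deg E (m |: B) v).

Section Key.
Variables (n : nat) (E : rel 'I_n).
Hypotheses (symE : symmetric E) (irrE : irreflexive E)
  (nuiE : natural_unit_interval E).
Variables (R : comNzRingType) (q y : R) (m : 'I_n).
Implicit Types (A B I S K : {set 'I_n}) (u v N : 'I_n).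

Local Notation dn := (down_deg E).
Local Notation up := (edges_up E).
Local Notation indep := (independent E).

(* With B the complement of I in [m |: S], [wtBI] counts the ascents from B to I
   and [wtIB] those from I to B. *)
Definition wtBI S I : R :=
  y ^+ #|I| * tree_wt E q m (S :\: I) * q ^+ up (m |: (S :\: I)) I.
Definition wtIB S I : R :=
  y ^+ #|I| * tree_wt E q m (S :\: I) * q ^+ up I (S :\: I).

Definition sumBI S (P : pred {set 'I_n}) : R :=
  \sum_(I : {set 'I_n} | (I \subset S) && (indep I && P I)) wtBI S I.
Definition sumIB S (P : pred {set 'I_n}) : R :=
  \sum_(I : {set 'I_n} | (I \subset S) && (indep I && P I)) wtIB S I.

Definition nbr_window S N : {set 'I_n} := [set u in m |: S | E u N].

Section Step.
Variables (S : {set 'I_n}) (N : 'I_n).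
Hypotheses (mS : forall v, v \in S -> (m < v)%N) (SN : forall v, v \in m |: S -> (v < N)%N).
Local Notation W := (nbr_window S N).

Lemma max_notin : N \notin m |: S.
Proof. by apply/negP => /SN; rewrite ltnn. Qed.

Lemma sub_ltN I : I \subset m |: S -> {in I, forall v, (v <= N)%N}.
Proof. by move=> /subsetP IS v /IS /SN /ltnW. Qed.

Lemma dn_window I : I \subset m |: S -> dn I N = #|I :&: W|.
Proof.
move=> /subsetP IS; apply: eq_card => u; rewrite !inE.
case: (boolP (u \in I)) => //= uI; have := IS u uI; rewrite !inE => ->.
by rewrite SN // IS.
Qed.

Lemma wtBI_in I : I \subset S -> wtBI (N |: S) (N |: I) = y * q ^+ dn (m |: (S :\: I)) N * wtBI S I.
Proof.
move=> IS; have NS := max_notin; rewrite !inE negb_or in NS; case/andP: NS => Nm NS.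
have NI : N \notin I by apply: contra NS; move/subsetP: IS => IS /IS.
have eS : (N |: S) :\: (N |: I) = S :\: I.
  by apply/setP => x; rewrite !inE; case: eqP => // ->; rewrite (negbTE NS) andbF.
rewrite /wtBI eS cardsU1 NI exprS edges_upU1r // exprD; ring.
Qed.

Lemma wtIB_in I : I \subset S -> wtIB (N |: S) (N |: I) = y * wtIB S I.
Proof.
move=> IS; have NS := max_notin; rewrite !inE negb_or in NS; case/andP: NS => Nm NS.
have NI : N \notin I by apply: contra NS; move/subsetP: IS => IS /IS.
have eS : (N |: S) :\: (N |: I) = S :\: I.
  by apply/setP => x; rewrite !inE; case: eqP => // ->; rewrite (negbTE NS) andbF.
rewrite /wtIB eS cardsU1 NI exprS edges_upU1_max; first by ring.
by apply: sub_ltN; rewrite (subset_trans (subsetDl _ _)) ?subsetUr.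
Qed.

Lemma diffU1_out I : I \subset S -> (N |: S) :\: I = N |: (S :\: I).
Proof.
move=> IS; have NS := max_notin; rewrite !inE negb_or in NS; case/andP: NS => Nm NS.
have NI : N \notin I by apply: contra NS; move/subsetP: IS => IS /IS.
by apply/setP => x; rewrite !inE; case: eqP => // ->; rewrite NI.
Qed.

Lemma tree_wt_max B : B \subset S ->
  tree_wt E q m (N |: B) = qint q (dn (m |: B) N) * tree_wt E q m B.
Proof.
move=> BS; have NS := max_notin; rewrite !inE negb_or in NS; case/andP: NS => Nm NS.
have NB : N \notin B by apply: contra NS; move/subsetP: BS => BS /BS.
rewrite /tree_wt big_setU1 //= setUCA down_degU1_max //; congr (_ * _).
apply: eq_bigr => v vB; rewrite down_degU1_max //.
by apply: (@sub_ltN B) => //; apply: subset_trans BS (subsetUr _ _).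
Qed.

Lemma wtBI_out I : I \subset S ->
  wtBI (N |: S) I = qint q (dn (m |: (S :\: I)) N) * wtBI S I.
Proof.
move=> IS; rewrite /wtBI diffU1_out // tree_wt_max ?subsetDl // setUCA edges_upU1_max; first by ring.
by apply: sub_ltN; apply: subset_trans IS (subsetUr _ _).
Qed.

Lemma wtIB_out I : I \subset S ->
  wtIB (N |: S) I = qint q (dn (m |: (S :\: I)) N) * q ^+ dn I N * wtIB S I.
Proof.
move=> IS; rewrite /wtIB diffU1_out // tree_wt_max ?subsetDl //.
have NS := max_notin; rewrite !inE negb_or in NS; case/andP: NS => Nm NS.
rewrite edges_upU1r ?exprD; first by ring.
by rewrite !inE (negbTE NS) andbF.
Qed.

Lemma window_suffix u v : u \in W -> v \in m |: S -> (u < v)%N -> v \in W.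
Proof.
rewrite !inE => /andP[uS EuN] vS uv; rewrite vS.
by have [] := nuiE uv (SN _) EuN; rewrite ?inE.
Qed.

Lemma window_clique u v : u \in W -> v \in W -> u != v -> E u v.
Proof.
move=> uW vW; have := uW; have := vW; rewrite !inE => /andP[vS EvN] /andP[uS EuN].
case: (ltngtP u v) => [uv|vu|/val_inj->]; last by rewrite eqxx.
  by have [] := nuiE uv (SN _) EuN; rewrite ?inE.
by have [] := nuiE vu (SN _) EvN; rewrite ?inE // symE.
Qed.

Lemma independent_clique_le1 I K : indep I ->
  {in K &, forall u v, u != v -> E u v} -> (#|I :&: K| <= 1)%N.
Proof.
move=> /forall_inP indI cK; rewrite leqNgt; apply/negP => /card_gt1P[u [v [uI vI uv]]].
move: uI vI; rewrite !inE => /andP[uI uK] /andP[vI vK].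
by have /forall_inP/(_ v vI) := indI u uI; rewrite cK.
Qed.

Lemma independentU1 I : I \subset S ->
  indep (N |: I) = indep I && (#|I :&: W| == 0)%N.
Proof.
move=> IS; rewrite cards_eq0 setI_eq0; apply/idP/andP => [/forall_inP ind|[/forall_inP ind dIW]].
  split.
    apply/forall_inP => i iI; apply/forall_inP => j jI.
    by have /forall_inP := ind i (setU1r _ iI); apply; rewrite setU1r.
  rewrite disjoints_subset; apply/subsetP => i iI; rewrite !inE negb_and.
  by have /forall_inP/(_ N (setU11 _ _)) -> := ind i (setU1r _ iI); rewrite orbT.
have nE i : i \in I -> ~~ E i N.
  by move=> iI; have := disjointFr dIW iI; rewrite !inE (subsetP IS) // orbT /= => ->.
apply/forall_inP => i; rewrite !inE => /orP[/eqP->|iI]; apply/forall_inP => j; rewrite !inE => /orP[/eqP->|jI].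
- by rewrite irrE.
- by rewrite symE nE.
- by rewrite nE.
by have /forall_inP := ind i iI; apply.
Qed.

Lemma dn_rest I : I \subset S -> dn (m |: (S :\: I)) N = (#|W| - #|I :&: W|)%N.
Proof.
move=> IS; rewrite dn_window ?setUS ?subsetDl //.
rewrite [I :&: W]setIC -cardsD; apply: eq_card => u; rewrite !inE.
case: (u =P m) => [->|] //=.
  by case: (boolP (m \in I)) => // mI; have := mS (subsetP IS _ mI); rewrite ltnn.
by rewrite -!andbA; case: (u \in I); case: (u \in S).
Qed.

(* Splitting off the largest vertex [N]: it lies in [I], or in the tree with [I]
   avoiding its neighbours, or in the tree with [I] meeting its clique of
   neighbours in one vertex. *)
Lemma sumBI_step (P : pred {set 'I_n}) :
  sumBI (N |: S) P =
    qint q #|W| * sumBI S (fun I => P I && (#|I :&: W| == 0)%N) +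
    qint q (#|W| - 1) * sumBI S (fun I => P I && (#|I :&: W| != 0)%N) +
    y * q ^+ #|W| * sumBI S (fun I => P (N |: I) && (#|I :&: W| == 0)%N).
Proof.
have NS := max_notin; rewrite !inE negb_or in NS; case/andP: NS => Nm NS.
rewrite /sumBI big_subsetU1 //; congr (_ + _); last first.
  rewrite mulr_sumr; apply: eq_big => [I|I /and3P[IS]].
    case: (boolP (I \subset S)) => //= IS; rewrite independentU1 //.
    by rewrite andbAC andbA.
  rewrite independentU1 // => /andP[_ /eqP I0] _.
  by rewrite wtBI_in // dn_rest // I0 subn0.
rewrite (bigID (fun I : {set 'I_n} => #|I :&: W| == 0)%N) /=; congr (_ + _).
  rewrite mulr_sumr; apply: eq_big => [I|I]; first by rewrite !andbA.
  by move=> /andP[/andP[IS _] /eqP I0]; rewrite wtBI_out // dn_rest // I0 subn0.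
rewrite mulr_sumr; apply: eq_big => [I|I]; first by rewrite !andbA.
move=> /andP[/and3P[IS iI _] I0]; rewrite wtBI_out // dn_rest //.
have := independent_clique_le1 iI window_clique.
by case: #|_| I0 => [|[|]].
Qed.

Lemma sumIB_step (P : pred {set 'I_n}) :
  sumIB (N |: S) P =
    qint q #|W| * sumIB S (fun I => P I && (#|I :&: W| == 0)%N) +
    q * qint q (#|W| - 1) * sumIB S (fun I => P I && (#|I :&: W| != 0)%N) +
    y * sumIB S (fun I => P (N |: I) && (#|I :&: W| == 0)%N).
Proof.
have NS := max_notin; rewrite !inE negb_or in NS; case/andP: NS => Nm NS.
rewrite /sumIB big_subsetU1 //; congr (_ + _); last first.
  rewrite mulr_sumr; apply: eq_big => [I|I /and3P[IS]].
    case: (boolP (I \subset S)) => //= IS; rewrite independentU1 //.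
    by rewrite andbAC andbA.
  by move=> _ _; rewrite wtIB_in.
have sS I : I \subset S -> I \subset m |: S by move=> IS; apply: subset_trans IS (subsetUr _ _).
rewrite (bigID (fun I : {set 'I_n} => #|I :&: W| == 0)%N) /=; congr (_ + _).
  rewrite mulr_sumr; apply: eq_big => [I|I]; first by rewrite !andbA.
  move=> /andP[/andP[IS _] /eqP I0]; rewrite wtIB_out // dn_rest // dn_window ?sS //.
  by rewrite I0 subn0 mulr1.
rewrite mulr_sumr; apply: eq_big => [I|I]; first by rewrite !andbA.
move=> /andP[/and3P[IS iI _] I0]; rewrite wtIB_out // dn_rest // dn_window ?sS //.
have := independent_clique_le1 iI window_clique.
case: #|_| I0 => [|[|]] // _ _; rewrite expr1; ring.
Qed.

End Step.
End Key.

Section KeyInduction.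
Variables (n : nat) (E : rel 'I_n).
Hypotheses (symE : symmetric E) (irrE : irreflexive E)
  (nuiE : natural_unit_interval E).
Variables (R : comNzRingType) (q y : R) (m : 'I_n).
Implicit Types (I S K : {set 'I_n}) (P Q : pred {set 'I_n}).

Local Notation sumP := (sumBI E q y m).
Local Notation sumR := (sumIB E q y m).

Lemma qintS d : qint q d.+1 = 1 + q * qint q d.
Proof.
rewrite /qint big_ord_recl expr0 mulr_sumr; congr (_ + _).
by apply: eq_bigr => i _; rewrite exprS.
Qed.

Lemma qint_pow d : q ^+ d = 1 + (q - 1) * qint q d.
Proof.
elim: d => [|d IH]; first by rewrite /qint big_ord0 mulr0 addr0.
by rewrite exprS IH qintS; ring.
Qed.

Lemma eq_sumP S P Q : (forall I, I \subset S -> P I = Q I) -> sumP S P = sumP S Q.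
Proof.
by move=> PQ; apply: eq_bigl => I; case: (boolP (I \subset S)) => //= IS; rewrite PQ.
Qed.

Lemma eq_sumR S P Q : (forall I, I \subset S -> P I = Q I) -> sumR S P = sumR S Q.
Proof.
by move=> PQ; apply: eq_bigl => I; case: (boolP (I \subset S)) => //= IS; rewrite PQ.
Qed.

Lemma sumP_split S Q P : sumP S P =
  sumP S (fun I => P I && Q I) + sumP S (fun I => P I && ~~ Q I).
Proof.
by rewrite /sumBI (bigID Q) /=; congr (_ + _); apply: eq_bigl => I; rewrite -!andbA.
Qed.

Lemma sumR_split S Q P : sumR S P =
  sumR S (fun I => P I && Q I) + sumR S (fun I => P I && ~~ Q I).
Proof.
by rewrite /sumIB (bigID Q) /=; congr (_ + _); apply: eq_bigl => I; rewrite -!andbA.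
Qed.

Lemma sumP_false S P : (forall I, I \subset S -> P I = false) -> sumP S P = 0.
Proof.
by move=> P0; rewrite (@eq_sumP _ _ xpred0) // /sumBI big_pred0 // => I; rewrite !andbF.
Qed.

Lemma sumR_false S P : (forall I, I \subset S -> P I = false) -> sumR S P = 0.
Proof.
by move=> P0; rewrite (@eq_sumR _ _ xpred0) // /sumIB big_pred0 // => I; rewrite !andbF.
Qed.

Lemma independent0 : independent E set0.
Proof. by apply/forall_inP => i; rewrite inE. Qed.

Lemma sumP0 P : P set0 -> sumP set0 P = 1.
Proof.
move=> P0; rewrite /sumBI (big_pred1 set0) => [|I]; last first.
  by rewrite subset0 /=; case: (eqVneq I set0) => [->|//]; rewrite independent0 P0.
by rewrite /wtBI cards0 setD0 /tree_wt big_set0 edges_up0r !mulr1.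
Qed.

Lemma sumR0 P : P set0 -> sumR set0 P = 1.
Proof.
move=> P0; rewrite /sumIB (big_pred1 set0) => [|I]; last first.
  by rewrite subset0 /=; case: (eqVneq I set0) => [->|//]; rewrite independent0 P0.
by rewrite /wtIB cards0 setD0 /tree_wt big_set0 edges_up0r !mulr1.
Qed.

Definition meets K I := (#|I :&: K| != 0)%N.
Definition avoids K I := (#|I :&: K| == 0)%N.

Definition suffix_clique S K :=
  [/\ K \subset m |: S,
      forall u v, u \in K -> v \in m |: S -> (u < v)%N -> v \in K &
      {in K &, forall u v, u != v -> E u v}].

Definition key_total S :=
  (1 + y) * sumP S xpredT = (1 + q * y) * sumR S xpredT.

(* The part of [key_total] that survives when a vertex with neighbourhood [K],
   larger than all others, is added. *)
Definition key_clique S K :=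
  q ^+ #|K|.-1 * (1 + y) * sumP S (meets K) - (1 + q * y) * sumR S (meets K) =
  y * (q ^+ #|K| * (1 + y) * sumP S (avoids K) - (1 + q * y) * sumR S (avoids K)).

Lemma key_base (s : 'I_n) : (m < s)%N -> E m s ->
  key_total (s |: set0) /\
  forall K, K != set0 -> suffix_clique (s |: set0) K -> key_clique (s |: set0) K.
Proof.
move=> ms Ems.
have mS v : v \in (set0 : {set 'I_n}) -> (m < v)%N by rewrite inE.
have Ss v : v \in m |: set0 -> (v < s)%N by rewrite !inE orbF => /eqP->.
have W1 : #|nbr_window E m set0 s| = 1%N.
  apply/eqP/cards1P; exists m; apply/setP => x; rewrite !inE orbF.
  by case: eqP => [->|].
have i0 A : #|(set0 : {set 'I_n}) :&: A| = 0%N by rewrite set0I cards0.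
have q1 : qint q 1 = 1 by rewrite qintS /qint big_ord0 mulr0 addr0.
split; first rewrite /key_total.
  rewrite (sumBI_step symE irrE nuiE) // (sumIB_step symE irrE nuiE) // W1 q1 /= /qint big_ord0.
  rewrite !mulr0 !mul0r !addr0 !sumP0 ?i0 // !sumR0 ?i0 //; ring.
move=> K K0 [KS Ksuf _].
have sK : s \in K.
  case/set0Pn: K0 => u uK; have := subsetP KS u uK; rewrite !inE orbF => /orP[]/eqP e; last by rewrite -e.
  by apply: (Ksuf u _ uK); rewrite ?e // ?inE ?eqxx ?orbT.
have mt I : meets K (s |: I).
  by rewrite /meets -lt0n card_gt0; apply/set0Pn; exists s; rewrite !inE eqxx.
have av I : avoids K (s |: I) = false by apply/negbTE/mt.
have [k Kk] : exists k, #|K| = k.+1 by exists #|K|.-1; rewrite prednK // card_gt0.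
have sb I : I \subset (set0 : {set 'I_n}) -> I = set0 by rewrite subset0 => /eqP.
rewrite /key_clique Kk !(sumBI_step symE irrE nuiE) // !(sumIB_step symE irrE nuiE) // W1 q1 /= /qint big_ord0.
rewrite (@sumP_false _ (fun I => meets K I && _)); last by move=> I /sb->; rewrite /meets i0.
rewrite (@sumR_false _ (fun I => meets K I && _)); last by move=> I /sb->; rewrite /meets i0.
rewrite (@sumP_false _ (fun I => avoids K (s |: I) && _)); last by move=> I _; rewrite av.
rewrite (@sumR_false _ (fun I => avoids K (s |: I) && _)); last by move=> I _; rewrite av.
rewrite !mulr0 !mul0r !addr0 !sumP0 ?mt /avoids ?i0 // !sumR0 ?mt ?i0 //; rewrite (exprS q k); ring.
Qed.

Section InductionStep.
Variables (S : {set 'I_n}) (N : 'I_n).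
Hypotheses (mS : forall v, v \in S -> (m < v)%N) (SN : forall v, v \in m |: S -> (v < N)%N).
Hypotheses (IHt : key_total S)
  (IHc : forall K, K != set0 -> suffix_clique S K -> key_clique S K).
Local Notation W := (nbr_window E m S N).

Lemma window_suffix_clique : suffix_clique S W.
Proof.
split; first by apply/subsetP => x; rewrite inE => /andP[].
  by move=> u v uW vS uv; apply: (window_suffix nuiE SN uW).
by move=> u v uW vW uv; apply: (window_clique symE nuiE SN).
Qed.

Lemma sub_eq0 (a b c : R) : c = 0 -> a - b = c -> a = b.
Proof. by move=> -> /eqP; rewrite subr_eq0 => /eqP. Qed.

Lemma sumP_WE : sumP S xpredT = sumP S (avoids W) + sumP S (meets W).
Proof. exact: (sumP_split S (avoids W)). Qed.

Lemma sumR_WE : sumR S xpredT = sumR S (avoids W) + sumR S (meets W).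
Proof. exact: (sumR_split S (avoids W)). Qed.

Lemma key_total_step : key_total (N |: S).
Proof.
rewrite /key_total (sumBI_step symE irrE nuiE) // (sumIB_step symE irrE nuiE) //=.
rewrite -!/(avoids W _) -!/(meets W _).
have := IHt; rewrite /key_total sumP_WE sumR_WE.
have := IHc _ window_suffix_clique; rewrite /key_clique.
case: (boolP (W == set0)) => [/eqP-> _|W0 /(_ isT)].
  have -> : sumP S (meets set0) = 0 by apply: sumP_false => I _; rewrite /meets setI0 cards0.
  have -> : sumR S (meets set0) = 0 by apply: sumR_false => I _; rewrite /meets setI0 cards0.
  rewrite !addr0 cards0 /qint big_ord0 => h.
  by rewrite !mul0r !mulr0 !add0r expr0 mulr1 mulrCA h mulrCA.
have [d Wd] : exists d, #|W| = d.+1 by exists #|W|.-1; rewrite prednK // card_gt0.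
rewrite Wd subn1 /= exprS (qint_pow d) qintS.
move: (qint q d) (sumP S _) (sumP S _) (sumR S _) (sumR S _) => x pa pm ra rm hs ht.
apply: (@sub_eq0 _ _ ((1 + q * x) * ((1 + y) * (pa + pm) - (1 + q * y) * (ra + rm)) - ((1 + (q - 1) * x) * (1 + y) * pm - (1 + q * y) * rm - y * (q * (1 + (q - 1) * x) * (1 + y) * pa - (1 + q * y) * ra)))).
  by rewrite hs ht !subrr mulr0 subr0.
by ring.
Qed.

Lemma key_clique_step K : K != set0 -> suffix_clique (N |: S) K -> key_clique (N |: S) K.
Proof.
move=> K0 [KS Ksuf Kcl].
have NS := max_notin SN; have := NS; rewrite !inE negb_or => /andP[Nm NnS].
have NK : N \in K.
  case/set0Pn: K0 => u uK; have := subsetP KS u uK; rewrite !inE orbCA.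
  case/orP => [/eqP <-//|uS]; apply: (Ksuf u) => //; first by rewrite !inE eqxx orbT.
  by apply: SN; rewrite !inE.
set K' := K :\ N.
have KK' : #|K| = #|K'|.+1 by rewrite (cardsD1 N) NK.
have K'W : K' \subset W.
  apply/subsetP => u; rewrite !inE => /andP[uN uK].
  have := subsetP KS u uK; rewrite !inE (negbTE uN) /= => ->.
  by rewrite Kcl.
have K'sc : suffix_clique S K'.
  split.
  - by apply: subset_trans K'W _; case: window_suffix_clique.
  - move=> u v; rewrite !inE => /andP[uN uK] vS uv.
    have vN : v != N by apply: contraNneq NS => <-; rewrite !inE.
    by rewrite vN; apply: (Ksuf u) => //; rewrite !inE orbCA vS orbT.
  - by move=> u v; rewrite !inE => /andP[_ uK] /andP[_ vK]; apply: Kcl.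
have IK I : I \subset S -> I :&: K = I :&: K'.
  move=> /subsetP IS; apply/setP => x; rewrite !inE; case: (boolP (x \in I)) => //= xI.
  by case: eqP => //= xN; move: (IS x xI); rewrite xN (negbTE NnS).
have NI I : meets K (N |: I).
  by rewrite /meets -lt0n card_gt0; apply/set0Pn; exists N; rewrite !inE eqxx.
have NI' I : avoids K (N |: I) = false by apply/negbTE/NI.
have mono I : avoids W I -> avoids K' I.
  rewrite /avoids !cards_eq0 => /eqP h; rewrite -subset0 -h; exact: setIS.
rewrite /key_clique !(sumBI_step symE irrE nuiE) // !(sumIB_step symE irrE nuiE) //=.
rewrite -!/(avoids W _) -!/(meets W _).
have e1 I : I \subset S -> meets K I && avoids W I = false.
  move=> IS; rewrite /meets IK //; case: (boolP (avoids W I)) => [/mono|]; last by rewrite andbF.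
  by rewrite /avoids => ->.
have e2 I : I \subset S -> meets K I && meets W I = meets K' I.
  move=> IS; rewrite /meets IK //; case: (boolP (avoids W I)) => [|]; last by rewrite /avoids => ->; rewrite andbT.
  by move=> h; have := mono _ h; rewrite /avoids => ->.
have e3 I : I \subset S -> meets K (N |: I) && avoids W I = avoids W I by rewrite NI.
have e4 I : I \subset S -> avoids K I && avoids W I = avoids W I.
  move=> IS; rewrite {1}/avoids IK //; case: (boolP (avoids W I)) => [/mono|]; last by rewrite andbF.
  by rewrite /avoids => ->.
have e5 I : I \subset S -> avoids K I && meets W I = avoids K' I && ~~ avoids W I.
  by move=> IS; rewrite {1}/avoids IK.
have e6 I : I \subset S -> avoids K (N |: I) && avoids W I = false by rewrite NI'.
rewrite (sumP_false e1) (eq_sumP e2) (eq_sumP e3) (eq_sumP e4) (eq_sumP e5) (sumP_false e6).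
rewrite (sumR_false e1) (eq_sumR e2) (eq_sumR e3) (eq_sumR e4) (eq_sumR e5) (sumR_false e6).
have sPa : sumP S (avoids K') = sumP S (avoids W) + sumP S (fun I => avoids K' I && ~~ avoids W I).
  rewrite (sumP_split S (avoids W)); congr (_ + _); apply: eq_sumP => I _.
  by case: (boolP (avoids W I)) => [/mono->|]; rewrite ?andbF.
have sRa : sumR S (avoids K') = sumR S (avoids W) + sumR S (fun I => avoids K' I && ~~ avoids W I).
  rewrite (sumR_split S (avoids W)); congr (_ + _); apply: eq_sumR => I _.
  by case: (boolP (avoids W I)) => [/mono->|]; rewrite ?andbF.
have := IHt; rewrite /key_total (sumP_split S (avoids K')) (sumR_split S (avoids K')) /= -!/(meets _ _).
have := IHc _ K'sc; rewrite /key_clique.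
have -> : sumP S (fun I => ~~ avoids K' I) = sumP S (meets K') by [].
have -> : sumR S (fun I => ~~ avoids K' I) = sumR S (meets K') by [].
rewrite sPa sRa KK'.
case: (boolP (K' == set0)) => [/eqP K'0 _|K'0 /(_ isT)].
  have -> : sumP S (meets K') = 0 by apply: sumP_false => I _; rewrite /meets K'0 setI0 cards0.
  have -> : sumR S (meets K') = 0 by apply: sumR_false => I _; rewrite /meets K'0 setI0 cards0.
  rewrite K'0 cards0 !addr0 /=.
  case: (eqVneq W set0) => [->|W0].
    rewrite cards0 /qint !big_ord0.
    have -> : sumP S (fun I => avoids set0 I && ~~ avoids set0 I) = 0.
      by apply: sumP_false => I _; rewrite andbN.
    have -> : sumR S (fun I => avoids set0 I && ~~ avoids set0 I) = 0.
      by apply: sumR_false => I _; rewrite andbN.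
    rewrite !addr0; move: (sumP S _) (sumR S _) => pa ra h.
    apply: (@sub_eq0 _ _ (y * ((1 + y) * pa - (1 + q * y) * ra))).
      by rewrite h subrr mulr0.
    by ring.
  have [d Wd] : exists d, #|W| = d.+1 by exists #|W|.-1; rewrite prednK // card_gt0.
  rewrite Wd subn1 /= exprS (qint_pow d) qintS.
  move: (qint q d) (sumP S (avoids W)) (sumP S (fun I => avoids set0 I && ~~ avoids W I)) (sumR S (avoids W)) (sumR S (fun I => avoids set0 I && ~~ avoids W I)) => x pa pm ra rm ht.
  apply: (@sub_eq0 _ _ (- y * (q * x) * ((1 + y) * (pa + pm) - (1 + q * y) * (ra + rm)))).
    by rewrite ht subrr mulr0.
  by ring.
have W0 : W != set0.
  by apply: contraNneq K'0 => W0; move: K'W; rewrite W0 subset0.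
have [d Wd] : exists d, #|W| = d.+1 by exists #|W|.-1; rewrite prednK // card_gt0.
have [k Kk] : exists k, #|K'| = k.+1 by exists #|K'|.-1; rewrite prednK // card_gt0.
rewrite Wd Kk subn1 /= !exprS (qint_pow d) qintS.
move: (qint q d) (q ^+ k) (sumP S (avoids W)) (sumP S (fun I => avoids K' I && ~~ avoids W I)) (sumP S (meets K')).
move: (sumR S (avoids W)) (sumR S (fun I => avoids K' I && ~~ avoids W I)) (sumR S (meets K')) => ra rg rb x z pa pg pb hc _.
apply: (@sub_eq0 _ _ (q * x * (z * (1 + y) * pb - (1 + q * y) * rb - y * (q * z * (1 + y) * (pa + pg) - (1 + q * y) * (ra + rg))))).
  by rewrite hc subrr mulr0.
by ring.
Qed.

End InductionStep.

Lemma key_pair k S : #|S| = k.+1 -> (forall v, v \in S -> (m < v)%N) ->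
  (exists2 v, v \in S & E m v) ->
  key_total S /\ forall K, K != set0 -> suffix_clique S K -> key_clique S K.
Proof.
elim: k S => [|k IH] S cS mS [w wS Emw].
  have /cards1P[s eS] : #|S| == 1%N by rewrite cS.
  rewrite eS inE in wS; rewrite -(eqP wS) in eS.
  by rewrite eS -[[set w]]setU0; apply: key_base => //; apply: mS; rewrite eS inE.
have S0 : (0 < #|S|)%N by rewrite cS.
have [N NS Nmax] : exists2 N, N \in S & {in S, forall v : 'I_n, (v <= N)%N}.
  by case: (@arg_maxnP _ w (mem S) val wS) => N NS Nmax; exists N.
have eS : S = N |: (S :\ N) by rewrite setD1K.
have SN v : v \in m |: (S :\ N) -> (v < N)%N.
  rewrite !inE => /orP[/eqP->|/andP[vN vS]]; first exact: mS.
  by rewrite ltn_neqAle vN Nmax.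
have mS' v : v \in S :\ N -> (m < v)%N by rewrite inE => /andP[_ /mS].
have cS' : #|S :\ N| = k.+1 by apply/eqP; rewrite -eqSS -cS (cardsD1 N S) NS.
have [||IHt IHc] := IH (S :\ N) cS'; first exact: mS'.
  case: (eqVneq w N) => [wN|wN]; last by exists w; rewrite ?inE ?wN.
  have : (0 < #|S :\ N|)%N by rewrite cS'.
  rewrite card_gt0 => /set0Pn[v vS']; exists v => //.
  have mv := mS' v vS'; have vN := SN v (setU1r _ vS').
  by have [] := nuiE mv vN; rewrite -?wN.
rewrite eS; split; first exact: key_total_step.
by move=> K; apply: key_clique_step.
Qed.

End KeyInduction.

Section KeyCoefficients.
Variables (n : nat) (E : rel 'I_n).
Hypotheses (symE : symmetric E) (irrE : irreflexive E)
  (nuiE : natural_unit_interval E).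
Variables (R : comNzRingType) (q : R) (m : 'I_n).
Implicit Types (I S U B : {set 'I_n}).

Local Notation up := (edges_up E).
Local Notation c := (tree_wt E q m).
Local Notation indep := (independent E).

Lemma qint_polyC d : qint (q%:P) d = (qint q d)%:P.
Proof. by rewrite /qint rmorph_sum; apply: eq_bigr => i _; rewrite rmorphXn. Qed.

Lemma tree_wt_polyC B : tree_wt E q%:P m B = (c B)%:P.
Proof. by rewrite /tree_wt rmorph_prod; apply: eq_bigr => i _; rewrite qint_polyC. Qed.

Lemma coef_sumBI S k :
  (sumBI E q%:P 'X m S xpredT)`_k =
  \sum_(I : {set 'I_n} | [&& I \subset S, indep I & #|I| == k])
     c (S :\: I) * q ^+ up (m |: (S :\: I)) I.
Proof.
rewrite /sumBI coef_sum [RHS]big_mkcond [LHS]big_mkcond; apply: eq_bigr => I _.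
rewrite andbT; case: (I \subset S); case: (indep I) => //=.
rewrite /wtBI tree_wt_polyC -rmorphXn -mulrA -polyCM coefMC coefXn eq_sym.
by case: eqP; rewrite ?mul1r ?mul0r.
Qed.

Lemma coef_sumIB S k :
  (sumIB E q%:P 'X m S xpredT)`_k =
  \sum_(I : {set 'I_n} | [&& I \subset S, indep I & #|I| == k])
     c (S :\: I) * q ^+ up I (S :\: I).
Proof.
rewrite /sumIB coef_sum [RHS]big_mkcond [LHS]big_mkcond; apply: eq_bigr => I _.
rewrite andbT; case: (I \subset S); case: (indep I) => //=.
rewrite /wtIB tree_wt_polyC -rmorphXn -mulrA -polyCM coefMC coefXn eq_sym.
by case: eqP; rewrite ?mul1r ?mul0r.
Qed.

Lemma qint0 : qint q 0 = 0.
Proof. by rewrite /qint big_ord0. Qed.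

Lemma tree_wt_isolated S B : (forall v, v \in S -> (m < v)%N) -> ~~ [exists v in S, E m v] ->
  B \subset S -> B != set0 -> c B = 0.
Proof.
move=> mS isoS BS /set0Pn[w wB].
have [v vB vmin] : exists2 v, v \in B & {in B, forall u : 'I_n, (v <= u)%N}.
  by case: (@arg_minnP _ w (mem B) val wB) => v vB vmin; exists v.
rewrite /tree_wt (bigD1 v) //=.
have -> : down_deg E (m |: B) v = 0%N.
  apply/eqP; rewrite cards_eq0; apply/eqP/setP => u; rewrite !inE.
  apply/negP => /andP[/orP[/eqP->|uB]] /andP[uv Euv].
    by case/negP: isoS; apply/exists_inP; exists v => //; apply: (subsetP BS).
  by move: (vmin u uB); rewrite leqNgt uv.
by rewrite qint0 mul0r.
Qed.

Lemma key_isolated S : (forall v, v \in S -> (m < v)%N) -> ~~ [exists v in S, E m v] ->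
  forall I, I \subset S ->
  c (S :\: I) * q ^+ up I (S :\: I) = c (S :\: I) * q ^+ up (m |: (S :\: I)) I.
Proof.
move=> mS isoS I IS; case: (eqVneq (S :\: I) set0) => [SI0|SI0]; last first.
  by rewrite (tree_wt_isolated mS isoS _ SI0) ?subsetDl // !mul0r.
rewrite SI0 edges_up0r setU0; congr (_ * q ^+ _); symmetry.
rewrite /edges_up big1 // => v vI; apply/eqP; rewrite cards_eq0; apply/eqP/setP => u.
rewrite !inE; apply/negP => /andP[/eqP-> /andP[_ Emv]].
by case/negP: isoS; apply/exists_inP; exists v => //; apply: (subsetP IS).
Qed.

Lemma key_coef x S (a : nat) : (forall v, v \in S -> (m < v)%N) ->
  let sumw (w : {set 'I_n} -> R) (b : nat) :=
    \sum_(I : {set 'I_n} | [&& I \subset S, indep I & #|S :\: I| == b]) x ^+ #|I| * w I in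
  sumw (fun I => c (S :\: I) * q ^+ up I (S :\: I)) a +
    q * x * sumw (fun I => c (S :\: I) * q ^+ up I (S :\: I)) a.+1 =
  sumw (fun I => c (S :\: I) * q ^+ up (m |: (S :\: I)) I) a +
    x * sumw (fun I => c (S :\: I) * q ^+ up (m |: (S :\: I)) I) a.+1.
Proof.
move=> mS sumw.
have cSI I : I \subset S -> #|S :\: I| = (#|S| - #|I|)%N.
  by move=> IS; rewrite cardsD (setIidPr IS).
have leI I : I \subset S -> (#|I| <= #|S|)%N by move=> IS; apply: subset_leq_card.
have sumw_big w b : (#|S| < b)%N -> sumw w b = 0.
  move=> Sb; rewrite /sumw big_pred0 // => I; case: (boolP (I \subset S)) => //= IS.
  rewrite cSI //; case: eqP; rewrite ?andbF // => e.
  by move: Sb e; move: #|I| #|S| => i s Sb e; lia.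
case: (boolP [exists v in S, E m v]) => [/exists_inP nbr|iso]; last first.
  have eqw b : sumw (fun I => c (S :\: I) * q ^+ up I (S :\: I)) b =
               sumw (fun I => c (S :\: I) * q ^+ up (m |: (S :\: I)) I) b.
    by apply: eq_bigr => I /and3P[IS _ _]; rewrite key_isolated.
  have sumw0 w b : (forall I, I \subset S -> S :\: I != set0 -> w I = 0) -> sumw w b.+1 = 0.
    move=> w0; rewrite /sumw big1 // => I /and3P[IS _ /eqP cb]; rewrite w0 ?mulr0 //.
    by rewrite -card_gt0 cb.
  rewrite !eqw; congr (_ + _); rewrite !sumw0 ?mulr0 // => I IS SI0.
  by rewrite (tree_wt_isolated mS iso _ SI0) ?subsetDl ?mul0r.
case: (ltnP #|S| a) => [Sa|aS]; first by rewrite !sumw_big ?ltnS ?(ltnW Sa) // !mulr0.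
have [k Sk] : exists k, #|S| = k.+1.
  by case: nbr => v vS _; exists #|S|.-1; rewrite prednK // card_gt0; apply/set0Pn; exists v.
have [kt _] := key_pair symE irrE nuiE q%:P 'X Sk mS nbr.
have sumwE w b j : (b + j = #|S|)%N -> sumw w b =
    x ^+ j * \sum_(I : {set 'I_n} | [&& I \subset S, indep I & #|I| == j]) w I.
  move=> bj; rewrite mulr_sumr; apply: eq_big => [I|I /and3P[IS _]].
    case: (boolP (I \subset S)) => //= IS; rewrite cSI //; congr (_ && _).
    by move: (leI _ IS) bj; move: #|I| #|S| => i s le bj; apply/idP/idP => /eqP h; apply/eqP; lia.
  rewrite cSI // => /eqP e; suff -> : #|I| = j by [].
  by move: (leI _ IS) bj e; move: #|I| #|S| => i s le bj e; lia.
have := congr1 (fun p : {poly R} => p`_(#|S| - a)%N) kt.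
rewrite !mulrDl !mul1r !coefD.
rewrite -mulrA !coefXM coefCM coefXM !coef_sumBI !coef_sumIB.
rewrite !(@sumwE _ a (#|S| - a)%N) ?subnKC //.
case: eqP => [Sa0|/eqP Sa0].
  rewrite !addr0 mulr0 addr0 => e; rewrite !(sumw_big _ a.+1); first by rewrite e !mulr0.
    by lia.
  by lia.
move=> e; rewrite !(@sumwE _ a.+1 (#|S| - a).-1%N); [|lia|lia].
have e1 : (#|S| - a = (#|S| - a).-1.+1)%N by lia.
move: e; rewrite e1 /=; move: (_.-1) => j e.
rewrite !exprS; move: e; move: (x ^+ j) => z.
suff h (A B C D : R) : C + D = A + q * B ->
  x * z * A + q * x * (z * B) = x * z * C + x * (z * D) by apply: h.
move=> e; transitivity (x * z * (A + q * B)); first by ring.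
by rewrite -e; ring.
Qed.

End KeyCoefficients.

(** * The recursion for the chromatic quasisymmetric polynomial *)

Section Peeling.
Variables (n : nat) (E : rel 'I_n).
Hypotheses (symE : symmetric E) (irrE : irreflexive E)
  (nuiE : natural_unit_interval E).
Variables (R : comNzRingType) (q : R).
Implicit Types (I S U B Z : {set 'I_n}) (xs : seq R) (m : 'I_n) (phi : nat -> R).

Local Notation up := (edges_up E).
Local Notation indep := (independent E).

(* X_Z in the variables [xs]; the head of [xs] belongs to the smallest colour,
   whose colour class is [I]. *)
Fixpoint csf xs Z : R :=
  if xs is x :: xs' then
    \sum_(I : {set 'I_n} | (I \subset Z) && indep I)
      x ^+ #|I| * (q ^+ up I (Z :\: I) * csf xs' (Z :\: I))
  else (Z == set0)%:R.

(* The coefficients of E(qz)/E(z), where E(z) is the product of the 1 + x z. *)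
Fixpoint qratio xs : nat -> R :=
  if xs is x :: xs' then
    fix Q k := if k is k'.+1 then qratio xs' k'.+1 + q * x * qratio xs' k' - x * Q k'
               else 1
  else fun k => (k == 0%N)%:R.

Definition shift (a : nat) phi (k : nat) : R := if (a <= k)%N then phi (k - a)%N else 0.

Definition tree_sum m phi xs S : R :=
  \sum_(U : {set 'I_n} | U \subset S)
    tree_wt E q m U * q ^+ up (S :\: U) U * phi #|U| * csf xs (S :\: U).

Definition tree_part m a xs S : R :=
  \sum_(B : {set 'I_n} | (B \subset S) && (#|B| == a))
    tree_wt E q m B * q ^+ up (m |: B) (S :\: B) * csf xs (S :\: B).

Lemma qratio0 xs : qratio xs 0 = 1.
Proof. by case: xs. Qed.

Lemma qratioS x xs k :
  qratio (x :: xs) k.+1 + x * qratio (x :: xs) k = qratio xs k.+1 + q * x * qratio xs k.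
Proof. exact: subrK. Qed.

Lemma shift_qratio x xs a k :
  shift a (qratio (x :: xs)) k + x * shift a.+1 (qratio (x :: xs)) k =
  shift a (qratio xs) k + q * x * shift a.+1 (qratio xs) k.
Proof.
rewrite /shift; case: (ltngtP a k) => [ak|ak|->]; last 2 first.
- by rewrite !mulr0.
- by rewrite subnn !qratio0 !mulr0.
have -> : (k - a = (k - a.+1).+1)%N by lia.
exact: qratioS.
Qed.

Lemma tree_sumD m phi psi (a : R) xs S :
  tree_sum m (fun k => phi k + a * psi k) xs S = tree_sum m phi xs S + a * tree_sum m psi xs S.
Proof.
rewrite /tree_sum mulr_sumr -big_split; apply: eq_bigr => U _ /=; ring.
Qed.

Lemma eq_tree_sum m phi psi xs S : phi =1 psi -> tree_sum m phi xs S = tree_sum m psi xs S.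
Proof. by move=> e; apply: eq_bigr => U _; rewrite e. Qed.

Lemma diff_split I U S : I \subset U -> U \subset S ->
  S :\: I = (U :\: I) :|: (S :\: U) /\ [disjoint U :\: I & S :\: U].
Proof.
move=> /subsetP IU /subsetP US; split.
  apply/setP => x; rewrite !inE; case: (boolP (x \in U)) => [/US->|xU].
    by rewrite !orbF andbT.
  by rewrite andbF /=; case: (boolP (x \in I)) => // /IU; rewrite (negbTE xU).
rewrite -setI_eq0; apply/eqP/setP => x; rewrite !inE.
by case: (x \in U); rewrite ?andbF.
Qed.

Lemma diffUK I U : I \subset U -> U :\: I :|: I = U.
Proof. by move=> IU; rewrite setUC -{1}(setIidPr IU) setID. Qed.

Lemma diffDD I U : I \subset U -> U :\: (U :\: I) = I.
Proof. by move=> IU; rewrite setDDr setDv set0U (setIidPr IU). Qed.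

Lemma diffDK I U S : I \subset U -> S :\: I :\: (U :\: I) = S :\: U.
Proof. by move=> IU; rewrite setDDl setUC diffUK. Qed.

Lemma tree_sum_peel m phi x xs S :
  tree_sum m phi (x :: xs) S =
  \sum_(I : {set 'I_n} | (I \subset S) && indep I)
    x ^+ #|I| * q ^+ up I (S :\: I) * tree_sum m phi xs (S :\: I).
Proof.
rewrite /tree_sum /=.
transitivity (\sum_(U : {set 'I_n} | (U \subset S) && true)
   \sum_(I : {set 'I_n} | (I \subset S :\: U) && indep I)
     x ^+ #|I| * q ^+ up I (S :\: I) * (tree_wt E q m U *
        q ^+ up (S :\: I :\: U) U * phi #|U| * csf xs (S :\: I :\: U))).
  apply: eq_big => [U|U US]; first by rewrite andbT.
  rewrite mulr_sumr; apply: eq_bigr => I /andP[]; rewrite subsetD => /andP[IS dIU] _.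
  have US' : U \subset S :\: I by rewrite subsetD US disjoint_sym.
  have [e1 d1] := diff_split (sub0set U) US'; rewrite !setD0 in e1 d1.
  have [e2 d2] : (S :\: U = I :|: (S :\: I :\: U)) /\ [disjoint I & S :\: I :\: U].
    split; last by rewrite -setI_eq0; apply/eqP/setP => z; rewrite !inE; case: (z \in I); rewrite ?andbF.
    apply/setP => z; rewrite !inE; case: (boolP (z \in I)) => //= zI.
    by rewrite (subsetP IS) // (disjointFr dIU zI).
  have -> : S :\: U :\: I = S :\: I :\: U by rewrite !setDDl setUC.
  rewrite [in up (S :\: U) U]e2 edges_upUl // [in up I (S :\: I)]e1 edges_upUr // !exprD; ring.
rewrite (exchange_disjoint _ _ xpredT); apply: eq_bigr => I _.
by rewrite mulr_sumr; apply: eq_big => [U|//]; rewrite andbT.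
Qed.

Section Root.
Variable m : 'I_n.

Lemma tree_part_peel x xs a S : (forall v, v \in S -> (m < v)%N) ->
  \sum_(I : {set 'I_n} | (I \subset S) && indep I)
    x ^+ #|I| * q ^+ up I (S :\: I) *
      (tree_part m a xs (S :\: I) + q * x * tree_part m a.+1 xs (S :\: I)) =
  tree_part m a (x :: xs) S + x * tree_part m a.+1 (x :: xs) S.
Proof.
move=> mS.
have disjm B U : U \subset S -> B \subset U -> [disjoint m |: B & U :\: B].
  move=> US BU; rewrite -setI_eq0; apply/eqP/setP => z; rewrite !inE.
  case: (z =P m) => [->|_] /=; last by case: (z \in B).
  case: (boolP (m \in U)) => [mU|_]; last by rewrite andbF.
  by have := mS m (subsetP US _ mU); rewrite ltnn.
pose K U := q ^+ up (m |: U) (S :\: U) * csf xs (S :\: U).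
have partL b : \sum_(I : {set 'I_n} | (I \subset S) && indep I)
    x ^+ #|I| * q ^+ up I (S :\: I) * tree_part m b xs (S :\: I) =
  \sum_(U : {set 'I_n} | U \subset S) K U *
    \sum_(I : {set 'I_n} | [&& I \subset U, indep I & #|U :\: I| == b])
       x ^+ #|I| * (tree_wt E q m (U :\: I) * q ^+ up I (U :\: I)).
  pose G B I := x ^+ #|I| * q ^+ up I (S :\: I) * (tree_wt E q m B *
          q ^+ up (m |: B) (S :\: I :\: B) * csf xs (S :\: I :\: B)).
  transitivity (\sum_(I : {set 'I_n} | (I \subset S) && indep I)
     \sum_(B : {set 'I_n} | (B \subset S :\: I) && (#|B| == b)) G B I).
    by apply: eq_bigr => I _; rewrite mulr_sumr.
  rewrite -(exchange_disjoint S G (fun B => #|B| == b) indep) sum_disjoint_union.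
  apply: eq_bigr => U US; rewrite mulr_sumr; apply: eq_bigr => I /and3P[IU _ _].
  have [e1 d1] := diff_split IU US.
  have e2 : S :\: I :\: (U :\: I) = S :\: U by rewrite diffDK.
  have e3 : m |: U = (m |: (U :\: I)) :|: I.
    by rewrite -setUA diffUK.
  have d3 : [disjoint m |: (U :\: I) & I].
    have := disjm (U :\: I) U US (subsetDl _ _).
    by rewrite diffDD.
  rewrite /G /K e2 [in up I (S :\: I)]e1 edges_upUr // e3 (edges_upUl _ _ d3) !exprD; ring.
have partR b : tree_part m b (x :: xs) S =
  \sum_(U : {set 'I_n} | U \subset S) K U *
    \sum_(I : {set 'I_n} | [&& I \subset U, indep I & #|U :\: I| == b])
       x ^+ #|I| * (tree_wt E q m (U :\: I) * q ^+ up (m |: (U :\: I)) I).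
  pose G B I := tree_wt E q m B * q ^+ up (m |: B) (S :\: B) *
     (x ^+ #|I| * (q ^+ up I (S :\: B :\: I) * csf xs (S :\: B :\: I))).
  transitivity (\sum_(B : {set 'I_n} | (B \subset S) && (#|B| == b))
     \sum_(I : {set 'I_n} | (I \subset S :\: B) && indep I) G B I).
    by apply: eq_bigr => B _; rewrite mulr_sumr.
  rewrite sum_disjoint_union.
  apply: eq_bigr => U US; rewrite mulr_sumr; apply: eq_bigr => I /and3P[IU _ _].
  have UI : U :\: I \subset U by rewrite subsetDl.
  have [e1 d1] := diff_split UI US.
  rewrite diffDD // in e1 d1.
  have e2 : S :\: (U :\: I) :\: I = S :\: U by rewrite setDDl diffUK.
  have e3 : m |: U = (m |: (U :\: I)) :|: I.
    by rewrite -setUA diffUK.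
  have d3 : [disjoint m |: (U :\: I) & I].
    have := disjm (U :\: I) U US (subsetDl _ _).
    by rewrite diffDD.
  rewrite /G /K e2 e1 edges_upUr // e3 (edges_upUl _ _ d3) !exprD; ring.
transitivity (
  \sum_(I : {set 'I_n} | (I \subset S) && indep I)
    x ^+ #|I| * q ^+ up I (S :\: I) * tree_part m a xs (S :\: I) +
  q * x * \sum_(I : {set 'I_n} | (I \subset S) && indep I)
    x ^+ #|I| * q ^+ up I (S :\: I) * tree_part m a.+1 xs (S :\: I)).
  by rewrite mulr_sumr -big_split; apply: eq_bigr => I _ /=; ring.
rewrite !partL !partR !mulr_sumr -!big_split; apply: eq_bigr => U US /=.
have mU v : v \in U -> (m < v)%N by move/(subsetP US)/mS.
have := key_coef symE irrE nuiE q x a mU; rewrite /=.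
suff h (A B C D k : R) : A + q * x * B = C + x * D ->
  k * A + q * x * (k * B) = k * C + x * (k * D) by apply: h.
by move=> e; transitivity (k * (A + q * x * B)); [ring | rewrite e; ring].
Qed.

Lemma tree_wt0 : tree_wt E q m set0 = 1.
Proof. by rewrite /tree_wt big_set0. Qed.

Lemma tree_sum_shift xs a S : (forall v, v \in S -> (m < v)%N) ->
  tree_sum m (shift a (qratio xs)) xs S = tree_part m a xs S.
Proof.
elim: xs a S => [|x xs IH] a S mS.
  have D0 U : U \subset S -> (S :\: U == set0) = (U == S).
    by move=> US; rewrite setD_eq0 eqEsubset US.
  rewrite /tree_sum (bigD1 S) //= big1 ?addr0; last first.
    by move=> U /andP[US US']; rewrite D0 // (negbTE US') mulr0.
  rewrite setDv eqxx mulr1 edges_up0l mulr1 /tree_part.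
  case: (eqVneq #|S| a) => [Sa|Sa]; last first.
    rewrite big1 => [|B /andP[BS /eqP Ba]]; last first.
      by rewrite /= D0 //; case: eqP => [e|]; rewrite ?mulr0 //; rewrite -Ba e eqxx in Sa.
    rewrite /shift; case: ltnP => h; rewrite ?mulr0 // subn_eq0.
    by move: h; rewrite leq_eqVlt eq_sym (negbTE Sa) /= ltnNge => /negbTE->; rewrite mulr0.
  rewrite (bigD1 S) /=; last by rewrite subxx Sa eqxx.
  rewrite big1 ?addr0 => [|B /andP[/andP[BS _] nB]]; last by rewrite D0 // (negbTE nB) mulr0.
  by rewrite setDv eqxx edges_up0r !mulr1 /shift Sa leqnn subnn eqxx mulr1.
have peel b : tree_sum m (shift b (qratio (x :: xs))) (x :: xs) S +
      x * tree_sum m (shift b.+1 (qratio (x :: xs))) (x :: xs) S =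
    tree_part m b (x :: xs) S + x * tree_part m b.+1 (x :: xs) S.
  rewrite -tree_sumD (eq_tree_sum _ _ _ (shift_qratio x xs b)) tree_sumD.
  rewrite !tree_sum_peel -tree_part_peel // mulr_sumr -big_split.
  apply: eq_bigr => I /andP[IS _].
  have mSI v : v \in S :\: I -> (m < v)%N by rewrite inE => /andP[_ /mS].
  by rewrite /= !IH //; ring.
have big b : (#|S| < b)%N -> tree_sum m (shift b (qratio (x :: xs))) (x :: xs) S =
                             tree_part m b (x :: xs) S.
  move=> Sb; rewrite /tree_sum big1 => [|U US]; last first.
    by rewrite /shift leqNgt (leq_ltn_trans (subset_leq_card US) Sb) mulr0 mul0r.
  rewrite /tree_part big1 // => B /andP[BS /eqP Bb].
  by move: Sb; rewrite ltnNge -Bb (subset_leq_card BS).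
have [k ak] : exists k, (#|S| < a + k)%N by exists #|S|.+1; rewrite addnS ltnS leq_addl.
elim: k a ak => [|k IHk] a ak; first by apply: big; rewrite addn0 in ak.
have := peel a; rewrite (IHk a.+1) ?addSnnS //; exact: addIr.
Qed.

Lemma up_root_le1 I : indep I -> (forall v, v \in I -> (m < v)%N) ->
  up [set m] I = ~~ indep (m |: I).
Proof.
move=> indI mI.
have dnE v : v \in I -> down_deg E [set m] v = E m v.
  move=> vI; rewrite /down_deg; case: (boolP (E m v)) => Emv.
    apply/eqP/cards1P; exists m; apply/setP => u; rewrite !inE.
    by case: eqP => //= ->; rewrite mI.
  apply/eqP; rewrite cards_eq0; apply/eqP/setP => u; rewrite !inE.
  by case: eqP => //= ->; rewrite (negbTE Emv) andbF.
rewrite /up (eq_bigr (fun v => nat_of_bool (E m v))) => [|v vI]; last exact: dnE.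
case: (boolP (indep (m |: I))) => [/forall_inP ind|nind].
  apply/eqP; rewrite sum_nat_eq0; apply/forall_inP => v vI.
  by have /forall_inP/(_ v (setU1r _ vI))/negbTE -> := ind m (setU11 _ _).
have [v vI Emv] : exists2 v, v \in I & E m v.
  apply/exists_inP; apply: contraNT nind => /exists_inPn nE.
  apply/forall_inP => i; rewrite !inE => /orP[/eqP->|iI]; apply/forall_inP => j; rewrite !inE => /orP[/eqP->|jI].
  - by rewrite irrE.
  - exact: nE.
  - by rewrite symE; apply: nE.
  by move/forall_inP/(_ i iI)/forall_inP: indI; apply.
rewrite (bigD1 v) //= Emv big1 ?addn0 // => u /andP[uI uv].
apply/eqP; rewrite eqb0; apply/negP => Emu.
move/forall_inP: indI => indI.
case: (ltngtP u v) => [lt|lt|/val_inj e]; last by rewrite e eqxx in uv.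
  by have [_ Euv] := nuiE (mI u uI) lt Emv; have /forall_inP/(_ v vI) := indI u uI; rewrite Euv.
by have [_ Euv] := nuiE (mI v vI) lt Emu; have /forall_inP/(_ u uI) := indI v vI; rewrite Euv.
Qed.

Lemma tree_sum_qratio xs S : (forall v, v \in S -> (m < v)%N) ->
  tree_sum m (fun k => qratio xs k.+1) xs S = (q - 1) * csf xs (m |: S).
Proof.
elim: xs S => [|x xs IH] S mS.
  rewrite /tree_sum big1 /= => [|U _]; last by rewrite mulr0 mul0r.
  case: eqP => [/setP/(_ m)|]; last by rewrite mulr0.
  by rewrite !inE eqxx.
have mNS : m \notin S by apply/negP => /mS; rewrite ltnn.
have part0 ys (T : {set 'I_n}) : (forall v, v \in T -> (m < v)%N) ->
    tree_sum m (qratio ys) ys T = q ^+ up [set m] T * csf ys T.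
  move=> mT; transitivity (tree_part m 0 ys T).
    by rewrite -tree_sum_shift //; apply: eq_tree_sum => k; rewrite /shift leq0n subn0.
  rewrite /tree_part (big_pred1 set0) => [|B]; last first.
    by rewrite cards_eq0 /=; case: eqP => [->|]; rewrite ?sub0set ?andbF.
  by rewrite tree_wt0 mul1r setU0 setD0.
have peel : tree_sum m (fun k => qratio (x :: xs) k.+1) (x :: xs) S +
      x * tree_sum m (qratio (x :: xs)) (x :: xs) S =
    \sum_(I : {set 'I_n} | (I \subset S) && indep I)
      x ^+ #|I| * q ^+ up I (S :\: I) *
        ((q - 1) * csf xs (m |: (S :\: I)) +
         q * x * (q ^+ up [set m] (S :\: I) * csf xs (S :\: I))).
  rewrite -tree_sumD (eq_tree_sum _ _ _ (qratioS x xs)) tree_sumD.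
  rewrite !tree_sum_peel mulr_sumr -big_split; apply: eq_bigr => I /andP[IS _].
  have mSI v : v \in S :\: I -> (m < v)%N by rewrite inE => /andP[_ /mS].
  by rewrite /= IH // part0 //; ring.
rewrite part0 // in peel.
apply: (addIr (x * (q ^+ up [set m] S * csf (x :: xs) S))); rewrite peel /=.
rewrite big_subsetU1 // mulrDr.
have splitI : \sum_(I : {set 'I_n} | (I \subset S) && indep (m |: I))
    x ^+ #|m |: I| * (q ^+ up (m |: I) ((m |: S) :\: (m |: I)) * csf xs ((m |: S) :\: (m |: I))) =
  \sum_(I : {set 'I_n} | (I \subset S) && indep I) (indep (m |: I))%:R *
    (x ^+ #|I|.+1 * (q ^+ (up [set m] (S :\: I) + up I (S :\: I)) * csf xs (S :\: I))).
  rewrite [LHS]big_mkcond [RHS]big_mkcond; apply: eq_bigr => I _.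
  case: (boolP (I \subset S)) => //= IS.
  case: (boolP (indep (m |: I))) => [indmI|_]; last by rewrite mul0r; case: ifP.
  have -> : indep I.
    apply/forall_inP => i iI; apply/forall_inP => j jI.
    by move/forall_inP/(_ i (setU1r _ iI))/forall_inP: indmI => /(_ j (setU1r _ jI)).
  have mI : m \notin I by apply: contra mNS; apply: (subsetP IS).
  have -> : (m |: S) :\: (m |: I) = S :\: I.
    by apply/setP => z; rewrite !inE; case: eqP => // ->; rewrite (negbTE mNS) andbF.
  by rewrite mul1r cardsU1 mI edges_upUl // disjoints1.
rewrite splitI !mulr_sumr -!big_split; apply: eq_bigr => I /andP[IS indI] /=.
have mI : m \notin I by apply: contra mNS; apply: (subsetP IS).
have mI' v : v \in I -> (m < v)%N by move/(subsetP IS)/mS.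
have -> : (m |: S) :\: I = m |: (S :\: I).
  by apply/setP => z; rewrite !inE; case: eqP => // ->; rewrite mI.
have -> : up I (m |: (S :\: I)) = up I (S :\: I).
  rewrite edges_upU1r; last by rewrite !inE (negbTE mNS) andbF.
  have -> : down_deg E I m = 0%N; last by [].
  apply/eqP; rewrite cards_eq0; apply/eqP/setP => u; rewrite !inE.
  by apply/negP => /andP[/mI' mu /andP[um _]]; move: (ltn_trans mu um); rewrite ltnn.
have -> : up [set m] S = (up [set m] (S :\: I) + ~~ indep (m |: I))%N.
  rewrite -up_root_le1 //.
  have [e dI] := diff_split (sub0set I) IS; rewrite !setD0 in e dI.
  by rewrite {1}e edges_upUr // addnC.
by case: (indep (m |: I)); rewrite [x ^+ #|I|.+1]exprS !exprD /= ?expr0 ?expr1; ring.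
Qed.

End Root.
End Peeling.

Section Compositions.

Fixpoint compositions_fuel (f k : nat) : seq (seq nat) :=
  if k is 0 then [:: [::]] else
  if f is f'.+1 then
    [seq rcons al i.+1 | i <- iota 0 k, al <- compositions_fuel f' (k - i.+1)]
  else [::].

Definition compositions k := compositions_fuel k k.

Lemma compositions_fuelE f k : (k <= f)%N -> compositions_fuel f k = compositions k.
Proof.
rewrite /compositions.
elim: f {-2}f (leqnn f) k => [|d IH] f.
  by rewrite leqn0 => /eqP-> [].
case: f => [|f] fd [|k] // kf; rewrite /=; congr (map _ _ ++ flatten _).
  by rewrite subn1 /= IH.
by apply/eq_in_map => i; rewrite mem_iota => ik; rewrite !IH //; lia.
Qed.

Lemma compositionsS k : compositions k.+1 =
  [seq rcons al i.+1 | i <- iota 0 k.+1, al <- compositions (k - i)].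
Proof.
rewrite [LHS]/compositions /= subn0 subn1; congr (_ ++ flatten _).
apply/eq_in_map => i; rewrite mem_iota => ik.
by rewrite subSS compositions_fuelE //; lia.
Qed.

Lemma mem_compositions k al :
  (al \in compositions k) = is_composition al && (sumn al == k).
Proof.
elim/last_ind: al k => [|al a IH] [|k]; rewrite ?compositionsS //.
- by apply/negbTE/negP => /allpairsPdep[i [b [_ _]]] /(congr1 size); rewrite size_rcons.
- rewrite /is_composition all_rcons sumn_rcons /= inE; case: al {IH} => [|? ?] /=; last first.
    by rewrite addn_eq0; case: (a =P 0%N) => [->|]; rewrite ?andbF.
  by case: a.
rewrite /is_composition all_rcons sumn_rcons -/(is_composition al).
apply/allpairsPdep/idP => [[i [b [ik bk /rcons_inj[eb ->]]]]|].
  by move: ik bk; rewrite mem_iota -eb IH => ik /andP[-> /eqP->] /=; apply/eqP; lia.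
case/andP => /andP[/= a0 ca] /eqP sk; exists a.-1, al; rewrite -[0%N :: _]/(iota 0 k.+1) mem_iota prednK //; split => //.
  by lia.
by rewrite IH ca /=; apply/eqP; lia.
Qed.

Lemma compositions_uniq k : uniq (compositions k).
Proof.
suff H : forall d k, (k <= d)%N -> uniq (compositions k) by exact: (H k).
elim=> [|d IH] [|j] // jd; rewrite compositionsS; apply: allpairs_uniq_dep.
- exact: iota_uniq.
- by move=> i _; apply: IH; lia.
by move=> [i a] [j' b] _ _ /= /rcons_inj[-> ->].
Qed.

End Compositions.

Section ElementarySymmetric.
Variables (R : comNzRingType) (q : R).
Implicit Types (xs : seq R).

Fixpoint elem_poly xs (k : nat) : R :=
  if xs is x :: xs' then elem_poly xs' k + x * (if k is k'.+1 then elem_poly xs' k' else 0)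
  else (k == 0%N)%:R.

Lemma elem_poly0 xs : elem_poly xs 0 = 1.
Proof. by elim: xs => //= x xs ->; rewrite mulr0 addr0. Qed.

Lemma elem_poly_qratio xs k :
  \sum_(j < k.+1) elem_poly xs (k - j) * qratio q xs j = q ^+ k * elem_poly xs k.
Proof.
elim: xs k => [|x xs IH] k.
  rewrite big_ord_recl /= subn0 big1 ?addr0 ?mulr1 => [|i _]; last by rewrite mulr0.
  by case: k => [|k]; rewrite ?mul1r ?mulr0.
case: k => [|k]; first by rewrite big_ord_recl big_ord0 addr0 subnn !elem_poly0 qratio0 mulr1.
have split_conv : \sum_(j < k.+2) elem_poly (x :: xs) (k.+1 - j) * qratio q (x :: xs) j =
    \sum_(j < k.+2) elem_poly xs (k.+1 - j) * qratio q (x :: xs) j +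
    x * \sum_(j < k.+1) elem_poly xs (k - j) * qratio q (x :: xs) j.
  rewrite big_ord_recr [in RHS]big_ord_recr addrAC; congr (_ + _); last first.
    by rewrite subnn !elem_poly0.
  rewrite mulr_sumr -big_split; apply: eq_bigr => i _.
  have -> : (k.+1 - i = (k - i).+1)%N by rewrite subSn // -ltnS.
  by rewrite /=; ring.
rewrite split_conv big_ord_recl qratio0 mulr1 subn0 mulr_sumr -addrA -big_split.
rewrite (eq_bigr (fun j : 'I_k.+1 => elem_poly xs (k.+1 - lift ord0 j) * qratio q xs (lift ord0 j) +
    q * x * (elem_poly xs (k - j) * qratio q xs j))) => [|j _]; last first.
  have h := qratioS q x xs j; rewrite !lift0 subSS.
  rewrite -[LHS]/(_ * _ + x * (_ * _)).
  transitivity (elem_poly xs (k - j) * (qratio q (x :: xs) j.+1 + x * qratio q (x :: xs) j)); first by ring.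
  by rewrite h; ring.
rewrite big_split -mulr_sumr IH addrA.
have h := IH k.+1; rewrite big_ord_recl qratio0 mulr1 subn0 in h.
by rewrite [elem_poly (x :: xs) _]/= mulrDr -h exprS; ring.
Qed.

(* [(q - 1)^-1] times the coefficient of [z^k] in E(qz)/E(z), for [k > 0] *)
Definition signed_comp_sum xs k : R :=
  \sum_(al <- compositions k)
    (-1) ^+ (size al - 1) * qint q (head 0%N al) * \prod_(a <- al) elem_poly xs a.

Lemma signed_comp_sumS xs k : signed_comp_sum xs k.+1 =
  qint q k.+1 * elem_poly xs k.+1 - \sum_(i < k) signed_comp_sum xs (k - i) * elem_poly xs i.+1.
Proof.
rewrite /signed_comp_sum compositionsS big_allpairs_dep -[iota 0 k.+1]/(index_iota 0 k.+1) big_mkord.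
rewrite big_ord_recr /= addrC subnn; congr (_ + _).
  by rewrite big_seq1 /= big_seq1 expr0 mul1r.
rewrite -sumrN; apply: eq_bigr => i _; rewrite mulr_suml -sumrN !big_seq.
apply: eq_bigr => al; rewrite mem_compositions => /andP[_ /eqP sal].
have -> : head 0%N (rcons al i.+1) = head 0%N al.
  by case: al sal => //= s0; have := ltn_ord i; lia.
have s1 : (size (rcons al i.+1) - 1 = (size al - 1).+1)%N.
  by rewrite size_rcons; case: al sal => //= [s0|]; [have := ltn_ord i; lia|lia].
rewrite s1 exprS -cats1 big_cat big_seq1 /=; ring.
Qed.

Lemma signed_comp_sum_qratio xs k :
  (q - 1) * signed_comp_sum xs k.+1 = qratio q xs k.+1.
Proof.
elim/ltn_ind: k => k IH.
have := elem_poly_qratio xs k.+1.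
rewrite big_ord_recl qratio0 mulr1 subn0 big_ord_recr /= subnn elem_poly0 mul1r.
move=> h; rewrite signed_comp_sumS mulrBr mulr_sumr.
have -> : \sum_(i < k) (q - 1) * (signed_comp_sum xs (k - i) * elem_poly xs i.+1) =
          \sum_(i < k) elem_poly xs (k.+1 - i.+1) * qratio q xs i.+1.
  rewrite (reindex_inj rev_ord_inj) /=; apply: eq_bigr => i _.
  rewrite mulrA [RHS]mulrC -IH // (_ : (k - (k - i.+1) = i.+1)%N); last by rewrite subKn.
  by congr (_ * elem_poly _ _); rewrite subnSK.
rewrite mulrA.
have <- : q ^+ k.+1 - 1 = (q - 1) * qint q k.+1.
  by rewrite (qint_pow q k.+1); ring.
rewrite mulrBl mul1r -h; rewrite /bump /=; under [X in _ + (X + _)]eq_bigr => i _ do rewrite add1n.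
by ring.
Qed.

End ElementarySymmetric.

Lemma csf_rec n (E : rel 'I_n) (symE : symmetric E) (irrE : irreflexive E)
    (nuiE : natural_unit_interval E) (R : comNzRingType) (q : R) xs (m : 'I_n) (S : {set 'I_n}) :
  GRing.lreg (q - 1) -> (forall v, v \in S -> (m < v)%N) ->
  csf E q xs (m |: S) =
  \sum_(U : {set 'I_n} | U \subset S)
    tree_wt E q m U * q ^+ edges_up E (S :\: U) U * signed_comp_sum q xs #|U|.+1 *
    csf E q xs (S :\: U).
Proof.
move=> reg_q mS; apply: reg_q; rewrite -tree_sum_qratio // mulr_sumr.
by apply: eq_bigr => U _; rewrite -signed_comp_sum_qratio; ring.
Qed.

(** * Trees and their lists *)

Section SearchWords.
Variables (n : nat) (E : rel 'I_n).
Hypotheses (symE : symmetric E) (irrE : irreflexive E)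
  (nuiE : natural_unit_interval E).
Implicit Types (a b w acc : seq 'I_n) (v x y m : 'I_n) (B : {set 'I_n}).

Fixpoint word_inv (w : seq 'I_n) : nat :=
  if w is x :: w' then (count (fun y => (y < x)%N && E y x) w' + word_inv w')%N else 0%N.

Definition descent_edge : rel 'I_n := fun x y => (y < x)%N ==> E x y.

(* [acc] is the set of letters before the word [w]. *)
Fixpoint linked (acc w : seq 'I_n) : bool :=
  if w is x :: w' then has (fun y => (x < y)%N || E y x) acc && linked (x :: acc) w'
  else true.

(* The lists of the decreasing trees with smallest vertex [m]. *)
Definition search_word m w : bool := path descent_edge m w && linked [:: m] w.

Lemma linked_cat acc a b : linked acc (a ++ b) = linked acc a && linked (rev a ++ acc) b.
Proof.
by elim: a acc => //= x a IH acc; rewrite IH rev_cons cat_rcons andbA.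
Qed.

Section Insertion.
Variables (m v : 'I_n) (a b : seq 'I_n).
Hypothesis max_v : all (fun x => (x < v)%N) (m :: a ++ b).
Hypothesis uniq_ab : uniq (m :: a ++ b).

Lemma lt_v x : x \in m :: a ++ b -> (x < v)%N.
Proof. by move/allP: max_v; apply. Qed.

Lemma linked_max acc : all (fun x => (x < v)%N) b -> linked (v :: acc) b.
Proof.
elim: b acc => //= x c IH acc /andP[-> cv] /=.
rewrite (_ : linked (x :: v :: acc) c = linked (v :: x :: acc) c); first exact: IH.
suff perm_acc : forall c l1 l2, l1 =i l2 -> linked l1 c = linked l2 c.
  by apply: perm_acc => z; rewrite !inE orbCA.
elim=> //= z d IHd l1 l2 e; rewrite (eq_has_r e); congr (_ && _).
by apply: IHd => t; rewrite !inE e.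
Qed.

Lemma search_word_insert : search_word m (a ++ v :: b) =
  [&& search_word m (a ++ b), (if b is y :: _ then E y v else true)
    & has (E^~ v) (m :: a)].
Proof.
have bv : all (fun x => (x < v)%N) b.
  by apply/allP => x xb; apply: lt_v; rewrite inE mem_cat xb !orbT.
have lastm : last m a \in m :: a ++ b by rewrite -cat_cons mem_cat mem_last.
rewrite /search_word !cat_path !linked_cat /= linked_max // andbT.
have -> : has (fun x => (v < x)%N || E x v) (rev a ++ [:: m]) = has (E^~ v) (m :: a).
  rewrite (@eq_in_has _ _ (E^~ v)) => [|x]; last first.
    rewrite mem_cat mem_rev inE => xa.
    by rewrite ltnNge ltnW // lt_v // inE mem_cat orbCA orbA xa.
  by rewrite has_cat has_rev /= orbF orbC.
have -> : descent_edge (last m a) v by rewrite /descent_edge ltnNge (ltnW (lt_v lastm)).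
rewrite andTb /=.
case: (boolP ((E m v) || has (E^~ v) a)) => [hasv|_]; last by rewrite !andbF.
have -> : linked (rev a ++ [:: m]) b.
  have [w0 w0a Ew0] : exists2 w0, w0 \in m :: a & E w0 v by apply/hasP; rewrite /=.
  have w0acc : w0 \in rev a ++ [:: m] by rewrite mem_cat mem_rev inE orbC -in_cons.
  have : {in b, forall x, x != w0}.
    move=> x xb; apply: contraTneq uniq_ab => e.
    rewrite -cat_cons cat_uniq; apply/negP => /and3P[_ /hasPn/(_ x xb)].
    by rewrite e w0a.
  elim: b bv (rev a ++ [:: m]) w0acc => //= x c IH /andP[xv cv] acc w0acc xw.
  rewrite IH //; last 2 first.
    by rewrite inE w0acc orbT.
    by move=> z zc; apply: xw; rewrite inE zc orbT.
  rewrite andbT; apply/hasP; exists w0 => //; case: ltnP => //= w0x.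
  have w0x' : (w0 < x)%N by rewrite ltn_neqAle w0x andbT eq_sym (xw x) ?inE ?eqxx.
  by have [] := nuiE w0x' xv Ew0.
rewrite !andbT; case: b bv lastm => [|y c] /= bv lastm; first by rewrite !andbT.
case/andP: bv => yv cv; rewrite /descent_edge yv /= [E v y]symE.
case: (boolP (E y v)) => Eyv; last by rewrite !andbF.
suff -> : ((y < last m a)%N ==> E (last m a) y) by rewrite !andbT andbA andbAC.
apply/implyP => ylast; have lv : (last m a < v)%N by have := lt_v _; apply; rewrite -cat_cons mem_cat mem_last.
by have [] := nuiE ylast lv Eyv; rewrite symE.
Qed.

Lemma word_inv_insert : word_inv (m :: a ++ v :: b) =
  (word_inv (m :: a ++ b) + count (E^~ v) b)%N.
Proof.
have mE : forall l, (forall x, x \in l -> (x < v)%N) ->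
  word_inv (l ++ v :: b) = (word_inv (l ++ b) + count (E^~ v) b)%N.
  elim=> [_|x l IH lv] /=.
    rewrite addnC; congr (_ + _)%N; apply: eq_in_count => x xb.
    by rewrite lt_v // inE mem_cat xb !orbT.
  rewrite IH => [|z zl]; last by apply: lv; rewrite inE zl orbT.
  rewrite !count_cat /= addnA; congr (_ + _ + _)%N; congr (_ + _)%N.
  by rewrite ltnNge ltnW // lv // inE eqxx.
rewrite -!cat_cons; apply: mE => x xa; apply: lt_v.
by rewrite -cat_cons mem_cat xa.
Qed.

End Insertion.

Arguments word_inv : simpl never.

Variables (R : comNzRingType) (q : R).

Lemma sum_insert_positions (p : pred 'I_n) (b0 : bool) w :
  \sum_(i < (size w).+1 | (if drop i w is y :: _ then p y else true) && (b0 || has p (take i w)))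
     q ^+ count p (drop i w) = qint q (count p w + b0).
Proof.
elim: w b0 => [|x w IH] b0.
  rewrite big_mkcond big_ord_recl big_ord0 /= addr0 orbF add0n.
  by case: b0; rewrite ?qint0 // qintS qint0 mulr0 addr0.
rewrite big_mkcond big_ord_recl /= orbF.
have -> : \sum_(i < (size w).+1)
    (if (match drop (bump 0 i) (x :: w) with [::] => true | y :: _ => p y end) &&
        (b0 || has p (take (bump 0 i) (x :: w)))
     then q ^+ count p (drop (bump 0 i) (x :: w)) else 0) = qint q (count p w + (b0 || p x)).
  rewrite -IH [RHS]big_mkcond; apply: eq_bigr => i _.
  by rewrite /bump /= orbA.
case: (p x); case: b0; rewrite /= ?addn0 ?add0n ?addn1 ?add1n ?add0r ?addn0 //.
by rewrite [in RHS]/qint big_ord_recr addrC.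
Qed.

Lemma rem_middle (v : 'I_n) a b : v \notin a -> rem v (a ++ v :: b) = a ++ b.
Proof.
elim: a => [|x a IH] /=; first by rewrite eqxx.
by rewrite inE negb_or => /andP[vx va]; rewrite eq_sym (negbTE vx) IH.
Qed.

Lemma big_permutations_cons (v : 'I_n) (s : seq 'I_n) (F : seq 'I_n -> R) :
  uniq (v :: s) ->
  \sum_(w <- permutations (v :: s)) F w =
  \sum_(w <- permutations s) \sum_(i < (size w).+1) F (take i w ++ v :: drop i w).
Proof.
move=> /= /andP[vs us].
pose l := [seq take i w ++ v :: drop i w | w <- permutations s, i <- iota 0 (size w).+1].
have idx w (i : nat) : v \notin w -> (i <= size w)%N -> index v (take i w ++ v :: drop i w) = i.
  move=> vw iw; rewrite index_cat; case: ifP => [/mem_take|_]; first by rewrite (negbTE vw).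
  by rewrite /= eqxx addn0 size_takel.
have remv w (i : nat) : v \notin w -> rem v (take i w ++ v :: drop i w) = w.
  by move=> vw; rewrite rem_middle ?cat_take_drop //; apply: contra vw => /mem_take.
have vperm w : w \in permutations s -> v \notin w.
  by rewrite mem_permutations => /perm_mem->.
have pl : perm_eq (permutations (v :: s)) l.
  apply: uniq_perm; first exact: permutations_uniq.
    apply: allpairs_uniq_dep; first exact: permutations_uniq.
      by move=> w _; apply: iota_uniq.
    move=> [w i] [w' i'] /allpairsPdep[w1 [i1 [w1s i1s e1]]] /allpairsPdep[w2 [i2 [w2s i2s e2]]].
    case: e1 => -> ->; case: e2 => -> -> /= e.
    have ew : w1 = w2 by rewrite -(remv w1 i1) ?e ?remv ?vperm.
    subst w2; suff -> : i1 = i2 by [].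
    move: i1s i2s; rewrite !mem_iota !add0n !ltnS => i1s i2s.
    by rewrite -(idx w1 i1) ?e ?idx ?vperm.
  move=> w; rewrite mem_permutations; apply/idP/allpairsPdep => [pw|[w' [i [w's _ ->]]]].
    have vw : v \in w by rewrite (perm_mem pw) inE eqxx.
    exists (rem v w), (index v w); split.
    - by rewrite mem_permutations -(perm_cons v) perm_sym -(permPl pw) perm_to_rem // perm_sym.
    - by rewrite mem_iota /= add0n ltnS size_rem // -ltnS prednK ?index_mem //; case: (w) vw.
    - have iw : (index v w <= size w)%N by rewrite ltnW // index_mem.
      rewrite remE take_size_cat ?drop_size_cat ?size_takel // -drop_index //.
      by rewrite cat_take_drop.
  by rewrite -cat1s perm_catCA /= perm_cons cat_take_drop -mem_permutations.
rewrite (perm_big _ pl) /l big_allpairs_dep; apply: eq_bigr => w _.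
by rewrite -[iota 0 _]/(index_iota 0 (size w).+1) big_mkord.
Qed.

Lemma down_deg_count (A : {set 'I_n}) (v : 'I_n) (w : seq 'I_n) :
  uniq w -> A =i w -> (forall u, u \in A -> u != v -> (u < v)%N) ->
  down_deg E A v = count (E^~ v) w.
Proof.
move=> uw Aw Av; rewrite -size_filter -(card_uniqP _) ?filter_uniq //.
apply: eq_card => u; rewrite mem_filter !inE -Aw; case: (boolP (u \in A)) => uA; rewrite ?andbF //=.
rewrite andbT; case: (eqVneq u v) => [->|uv]; first by rewrite irrE andbF.
by rewrite Av.
Qed.

Lemma sum_search_words m B : (forall v, v \in B -> (m < v)%N) ->
  \sum_(w <- permutations (enum B) | search_word m w) q ^+ word_inv (m :: w) =
  tree_wt E q m B.
Proof.
move: {2}#|B| (erefl #|B|) => k; elim: k B => [|k IH] B cB mB.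
  have -> : B = set0 by apply/eqP; rewrite -cards_eq0 cB.
  by rewrite enum_set0 /tree_wt big_set0 big_mkcond big_seq1.
have [z0 z0B] : exists z0, z0 \in B by apply/set0Pn; rewrite -card_gt0 cB.
have [v vB vmax] : exists2 v, v \in B & {in B, forall u : 'I_n, (u <= v)%N}.
  by case: (@arg_maxnP _ z0 (mem B) val z0B) => v vB vmax; exists v.
pose B' := B :\ v.
have cB' : #|B'| = k by apply/eqP; rewrite -eqSS -cB (cardsD1 v B) vB.
have mB' u : u \in B' -> (m < u)%N by rewrite inE => /andP[_ /mB].
have vB' : v \notin B' by rewrite !inE eqxx.
have eB : B = v |: B' by rewrite setD1K.
have B'v u : u \in m |: B' -> (u < v)%N.
  rewrite !inE => /orP[/eqP->|/andP[uv uB]]; first exact: mB.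
  by rewrite ltn_neqAle uv vmax.
have pe : perm_eq (enum B) (v :: enum B').
  apply: uniq_perm; rewrite /= ?mem_enum ?vB' ?enum_uniq // => u.
  by rewrite eB !inE !mem_enum !inE.
rewrite (perm_big _ (perm_permutations pe)) big_mkcond big_permutations_cons; last first.
  by rewrite /= mem_enum vB' enum_uniq.
have -> : tree_wt E q m B = qint q (down_deg E (m |: B) v) * tree_wt E q m B'.
  rewrite eB /tree_wt big_setU1 //=; congr (_ * _); apply: eq_bigr => u uB'.
  by rewrite (setUCA [set m]) (@down_degU1_max _ E v) //; apply/ltnW/B'v; rewrite !inE -in_setD1 uB' orbT.
rewrite -IH // mulr_sumr [RHS]big_mkcond !big_seq; apply: eq_bigr => w.
rewrite mem_permutations => pw.
have mem_w u : (u \in w) = (u \in B') by rewrite (perm_mem pw) mem_enum.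
have umw : uniq (m :: w).
  by rewrite /= (perm_uniq pw) enum_uniq andbT mem_w; apply/negP => /mB'; rewrite ltnn.
have lt_w : all (fun x : 'I_n => (x < v)%N) (m :: w).
  by apply/allP => x; rewrite inE mem_w => xw; apply: B'v; rewrite !inE -in_setD1.
have -> : down_deg E (m |: B) v = count (E^~ v) w + E m v :> nat.
  rewrite eB (setUCA [set m]) (@down_degU1_max _ E v) // (@down_deg_count _ v (m :: w)) //=.
  - by rewrite addnC.
  - by move=> u; rewrite !inE mem_w !inE.
  - by move=> u /B'v.
rewrite -sum_insert_positions.
case: (boolP (search_word m w)) => sw; last first.
  rewrite big1 // => i _; rewrite search_word_insert ?cat_take_drop //.
  by rewrite (negbTE sw).
rewrite mulr_suml [RHS]big_mkcond; apply: eq_bigr => i _.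
rewrite search_word_insert ?cat_take_drop // sw /=; case: ifP => // _.
by rewrite word_inv_insert ?cat_take_drop // exprD mulrC.
Qed.

End SearchWords.

Section ParentTrees.
Variables (n : nat) (E : rel 'I_n).
Hypotheses (symE : symmetric E) (irrE : irreflexive E).
Implicit Types (T : subgraph n) (x y z : 'I_n).

Lemma adj_sym T : symmetric (adj T).
Proof. by move=> x y; rewrite /adj setUC. Qed.

Lemma set2_eq x y x' y' : [set x; y] = [set x'; y'] ->
  (x = x' /\ y = y') \/ (x = y' /\ y = x').
Proof.
move=> e.
have : x \in [set x'; y'] by rewrite -e !inE eqxx.
have : y \in [set x'; y'] by rewrite -e !inE eqxx orbT.
have : x' \in [set x; y] by rewrite e !inE eqxx.
have : y' \in [set x; y] by rewrite e !inE eqxx orbT.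
rewrite !inE.
by case/orP=> /eqP ?; case/orP=> /eqP ?; case/orP=> /eqP ?; case/orP=> /eqP ?; subst; auto.
Qed.

Lemma adj_subgraph T x y : is_subgraph E T -> adj T x y ->
  [/\ x \in verts T, y \in verts T & E x y].
Proof.
move=> subT /subT[x' [y' [xT yT Exy /set2_eq[[-> ->]|[-> ->]]]]]; split => //.
by rewrite symE.
Qed.

Lemma parents_tree T : is_subgraph E T -> verts T != set0 ->
  (forall x, x \in verts T -> ~~ is_largest T x ->
     #|[pred y in verts T | adj T x y & (x < y)%N]| = 1%N) ->
  is_tree T.
Proof.
move=> subT V0 par; split => //.
  have [z zV] := set0Pn _ V0.
  have [M MV Mmax] : exists2 M, M \in verts T & {in verts T, forall u : 'I_n, (u <= M)%N}.
    by case: (@arg_maxnP _ z (mem (verts T)) val zV) => M MV Mmax; exists M.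
  have toM x : x \in verts T -> connect (adj T) x M.
    move: {2}(n - x)%N (leqnn (n - x)%N) => k; elim: k x => [|k IH] x.
      by rewrite leqn0 subn_eq0 leqNgt ltn_ord.
    move=> xk xV; case: (boolP (is_largest T x)) => [/andP[_ /forall_inP/(_ M MV) Mx]|nl].
      have -> : x = M by apply/val_inj/eqP; rewrite eqn_leq Mx Mmax.
      exact: connect0.
    have /eqP/card1P[/= y ye] := par x xV nl; have := ye y; rewrite !inE eqxx => /and3P[yV xy lt].
    apply: connect_trans (connect1 xy) (IH y _ yV).
    by have := ltn_ord y; lia.
  move=> x y xV yV; apply: connect_trans (toM x xV) _.
  by rewrite (sym_connect_sym (@adj_sym T)) toM.
move=> c sc uc.
have [x0 x0c] : exists x, x \in c by case: c sc {uc} => // x c; exists x; rewrite inE eqxx.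
have [x xc xmin] : exists2 x, x \in c & {in c, forall u : 'I_n, (x <= u)%N}.
  by case: (@arg_minnP _ x0 (mem c) val x0c) => x xc xmin; exists x.
have [i c' ec] := rot_to xc.
have : ucycle (adj T) (rot i c) by rewrite rot_ucycle.
have : (2 < size (rot i c))%N by rewrite size_rot.
have min' u : u \in rot i c -> (x <= u)%N by rewrite mem_rot; apply: xmin.
rewrite ec in min' *; case: c' ec min' => [|y [|z c']] // ec min' _.
rewrite /ucycle (cycle_path x) /= => /andP[/andP[lx /and3P[xy yz pz]]].
rewrite !inE !negb_or => /and3P[/and3P[nxy nxz xc'] /andP[nyz yc'] _].
set l := last z c' in lx.
have l_in : l \in z :: c' by apply: mem_last.
have ny : y != l.
  by apply: contraNneq nyz => yl; move: l_in; rewrite -yl inE (negbTE yc') orbF.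
have nx : x != l.
  by apply: contraNneq nxz => xl; move: l_in; rewrite -xl inE (negbTE xc') orbF.
have lt_x u : u \in x :: y :: z :: c' -> x != u -> (x < u)%N.
  by move=> uc' nxu; rewrite ltn_neqAle nxu min'.
have xy_lt : (x < y)%N by apply: lt_x; rewrite ?inE ?eqxx ?orbT.
have xl_lt : (x < l)%N by apply: lt_x; rewrite // !inE -in_cons l_in !orbT.
have [xV yV _] := adj_subgraph subT xy.
have [lV _ _] := adj_subgraph subT lx.
have nl : ~~ is_largest T x.
  by rewrite /is_largest xV /=; apply/forall_inPn; exists y; rewrite // -ltnNge.
have /eqP/card1P[/= u ue] := par x xV nl.
have := ue y; rewrite !inE yV xy xy_lt => /esym/eqP yu.
have := ue l; rewrite !inE lV adj_sym lx xl_lt => /esym/eqP lu.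
by rewrite yu lu eqxx in ny.
Qed.

End ParentTrees.

Section WordTrees.
Variables (n : nat) (E : rel 'I_n).
Hypotheses (symE : symmetric E) (irrE : irreflexive E)
  (nuiE : natural_unit_interval E).
Implicit Types (T : subgraph n) (x y z : 'I_n) (acc w s : seq 'I_n) (V : {set 'I_n}).

Definition maxv x y : 'I_n := if (x < y)%N then y else x.

(* [acc] lists the letters before [x], the most recent one first.  The letter [x]
   is attached to the most recent larger letter, or, if there is none, to the
   largest one. *)
Definition link acc x : 'I_n :=
  if [seq y : 'I_n <- acc | (x < y)%N] is y :: _ then y
  else foldr maxv (head x acc) acc.

Variant link_spec acc x : 'I_n -> Prop :=
| LinkPrevious u y t of acc = u ++ y :: t & all (fun z : 'I_n => (z <= x)%N) u & (x < y)%N :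
    link_spec acc x y
| LinkMax y of all (fun z : 'I_n => (z <= x)%N) acc & y \in acc & all (fun z : 'I_n => (z <= y)%N) acc :
    link_spec acc x y.

Lemma linkP acc x : acc != [::] -> link_spec acc x (link acc x).
Proof.
move=> acc0; rewrite /link.
case ef: [seq y : 'I_n <- acc | (x < y)%N] => [|y t].
  have all_le : all (fun z : 'I_n => (z <= x)%N) acc.
    apply/allP => z zacc; rewrite leqNgt; apply/negP => xz.
    have : z \in [seq y : 'I_n <- acc | (x < y)%N] by rewrite mem_filter xz.
    by rewrite ef.
  apply: LinkMax => //.
    case: acc acc0 {ef all_le} => // a acc _; rewrite /head.
    have H d l : foldr maxv d l \in d :: l.
      elim: l => [|b l] /=; first by rewrite mem_head.
      move: (foldr _ _ _) => F IH; rewrite /maxv; case: ltnP => _; last by rewrite !inE eqxx orbT.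
      by move: IH; rewrite !inE => /orP[->//|->]; rewrite !orbT.
    by have := H a (a :: acc); rewrite !inE orbA orbb.
  have H d l : all (fun z : 'I_n => (z <= foldr maxv d l)%N) l.
    elim: l => //= b l; move: (foldr _ _ _) => F IH; rewrite /maxv; case: ltnP => [lt|le]; first by rewrite IH (ltnW lt).
    rewrite leqnn /=; apply: sub_all IH => z; move/leq_trans; exact.
  exact: H.
have [u [v [eacc u_le xy]]] : exists u v, [/\ acc = u ++ y :: v, all (fun z : 'I_n => (z <= x)%N) u & (x < y)%N].
  elim: acc t ef {acc0} => //= a acc IH t; case: ifP => xa.
    by case=> <- _; exists [::], acc.
  by move/IH => [u [v [-> hu xy]]]; exists (a :: u), v; split => //=; rewrite leqNgt xa.
exact: LinkPrevious eacc u_le xy.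
Qed.

Lemma link_in acc x : acc != [::] -> link acc x \in acc.
Proof.
move=> acc0; case: (linkP x acc0) => [u y t -> _ _|y _ //].
by rewrite mem_cat inE eqxx orbT.
Qed.

Fixpoint word_edges acc w : {set {set 'I_n}} :=
  if w is x :: w' then [set x; link acc x] |: word_edges (x :: acc) w' else set0.

Fixpoint edges_ok acc w : bool :=
  if w is x :: w' then E (link acc x) x && edges_ok (x :: acc) w' else true.

Lemma word_edgesP acc w (e : {set 'I_n}) :
  reflect (exists a x b, w = a ++ x :: b /\ e = [set x; link (rev a ++ acc) x])
          (e \in word_edges acc w).
Proof.
elim: w acc => [|y w IH] acc /=.
  by rewrite inE; constructor => -[[|? ?] [? [? []]]].
rewrite !inE; apply: (iffP orP) => [[/eqP->|/IH[a [x [b [-> ->]]]]]|[[|z a] [x [b [/= [ey eb] ee]]]]].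
- by exists [::], y, w.
- by exists (y :: a), x, b; rewrite rev_cons cat_rcons.
- by left; rewrite ee ey.
- by right; apply/IH; exists a, x, b; rewrite ee ey rev_cons cat_rcons.
Qed.

Definition earlier_descent : rel 'I_n := fun y x => descent_edge E x y.

Lemma edges_ok_step acc x y : sorted earlier_descent (y :: acc) -> x \notin y :: acc ->
  descent_edge E y x && has (fun a : 'I_n => (x < a)%N || E a x) (y :: acc) =
  E (link (y :: acc) x) x.
Proof.
move=> srt xacc.
have neq z : z \in y :: acc -> (z <= x)%N -> (z < x)%N.
  by move=> zacc zx; rewrite ltn_neqAle zx andbT; apply: contraNneq xacc => /val_inj <-.
have acc0 : y :: acc != [::] by [].
apply/idP/idP => [/andP[dyx /hasP[e e_in exE]]|Ex].
  case: (linkP x acc0) => [[|h u] g t eacc hu xg|g all_le g_in g_max].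
  - by case: eacc => eg _; move: dyx; rewrite /descent_edge eg xg.
  - move: srt; rewrite eacc; case/lastP: u hu eacc => [|u k] hu eacc.
      move=> /= /andP[]; rewrite /earlier_descent /descent_edge => hg _.
      have hx : (h < x)%N.
        by apply: neq; [rewrite eacc inE eqxx | case/andP: hu].
      have Egh := implyP hg (ltn_trans hx xg).
      by have [_] := nuiE hx xg (etrans (symE _ _) Egh); rewrite symE.
    have kx : (k < x)%N.
      apply: neq; last by move: hu; rewrite /= all_rcons => /and3P[].
      by rewrite eacc inE mem_cat mem_rcons inE eqxx orbT.
    rewrite /= cat_rcons cat_path /= => /and4P[_ _ kg _].
    have Egk := implyP kg (ltn_trans kx xg).
    by have [_] := nuiE kx xg (etrans (symE _ _) Egk); rewrite symE.
  - have ex : (e < x)%N by apply: neq => //; move/allP: all_le; apply.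
    move: exE; rewrite ltnNge (ltnW ex) /= => Eex.
    have := allP g_max _ e_in; rewrite leq_eqVlt => /orP[/eqP/val_inj <- //|eg].
    have gx : (g < x)%N by apply: neq => //; move/allP: all_le; apply.
    by have [] := nuiE eg gx Eex.
apply/andP; split; last by apply/hasP; exists (link (y :: acc) x); rewrite ?link_in // Ex orbT.
apply/implyP => xy; move: Ex; rewrite /link /= xy.
done.
Qed.

Lemma edges_okE acc w y : sorted earlier_descent (y :: acc) -> uniq (y :: acc ++ w) ->
  path (descent_edge E) y w && linked E (y :: acc) w = edges_ok (y :: acc) w.
Proof.
elim: w acc y => //= x w IH acc y srt /andP[].
rewrite mem_cat inE !negb_or => /and3P[yacc yx yw].
rewrite cat_uniq => /and3P[uacc /= /norP[xacc dis] /andP[xw uw]].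
have xyacc : x \notin y :: acc by rewrite inE negb_or eq_sym yx.
rewrite -(edges_ok_step srt xyacc) andbACA.
case: (boolP (descent_edge E y x && _)) => //= /andP[dyx _].
rewrite IH //; first by rewrite /= {1}/earlier_descent dyx.
rewrite /= inE mem_cat !negb_or eq_sym yx xacc xw mem_cat negb_or yacc yw cat_uniq uacc uw dis.
by [].
Qed.

Definition larger_nbrs (Ed : {set {set 'I_n}}) V x : nat :=
  #|[pred y in V | ([set x; y] \in Ed) && (x < y)%N]|.

Definition pretree V (Ed : {set {set 'I_n}}) : Prop :=
  (forall e, e \in Ed -> exists x y, [/\ x \in V, y \in V, E x y & e = [set x; y]]) /\
  (forall x, x \in V -> larger_nbrs Ed V x = [exists z in V, (x < z)%N]).

Lemma pretree_step acc x Ed : acc != [::] -> x \notin acc -> E (link acc x) x ->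
  pretree [set z in acc] Ed ->
  pretree [set z in x :: acc] ([set x; link acc x] |: Ed).
Proof.
move=> acc0 xacc Elx [sub par].
have lacc := link_in x acc0.
have EdV y z : [set y; z] \in Ed -> y \in acc /\ z \in acc.
  move=> /sub[y' [z' []]]; rewrite !inE => y'a z'a _ e.
  by case: (set2_eq e) => -[-> ->].
have nx y : ([set x; y] \in Ed) = false by apply/negP => /EdV[]; rewrite (negbTE xacc).
have nx' y : ([set y; x] \in Ed) = false by apply/negP => /EdV[]; rewrite (negbTE xacc).
have newE y z : ([set y; z] == [set x; link acc x]) =
    ((y == x) && (z == link acc x)) || ((y == link acc x) && (z == x)).
  apply/eqP/orP => [/set2_eq[[-> ->]|[-> ->]]|[/andP[/eqP-> /eqP->]|/andP[/eqP-> /eqP->]]] //.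
  - by left; rewrite !eqxx.
  - by right; rewrite !eqxx.
  - by rewrite setUC.
have ltneq z : z \in acc -> (z <= x)%N -> (z < x)%N.
  by move=> zacc zx; rewrite ltn_neqAle zx andbT; apply: contraNneq xacc => /val_inj <-.
have nxl : x != link acc x by apply: contraNneq xacc => {1}->.
split.
  move=> e; rewrite !inE => /orP[/eqP->|/sub[y [z [yA zA Eyz ->]]]].
    by exists x, (link acc x); rewrite !inE eqxx lacc orbT symE.
  by exists y, z; rewrite !inE -!in_cons; split=> //; move: yA zA; rewrite !inE => yA zA; rewrite ?yA ?zA orbT.
move=> z; rewrite inE /larger_nbrs.
case: (linkP x acc0) newE lacc nxl Elx => [u y t eacc hu xy|y all_le _ ymax] newE yacc nxy Eyx.
  have exA v : [exists z0 in [set z1 in x :: acc], (v < z0)%N] = [exists z0 in [set z1 in acc], (v < z0)%N].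
    apply/exists_inP/exists_inP => -[z0]; rewrite !inE.
      case/orP => [/eqP-> vx|z0a vz]; first by exists y; rewrite ?inE // (ltn_trans vx xy).
      by exists z0; rewrite ?inE.
    by move=> z0a vz; exists z0; rewrite ?inE // z0a orbT.
  rewrite inE => /orP[/eqP->|zacc].
    rewrite exA; have -> : [exists z0 in [set z1 in acc], (x < z0)%N].
      by apply/exists_inP; exists y; rewrite ?inE.
    apply/eqP/card1P; exists y => v; rewrite !inE newE eqxx nx /= orbF.
    have -> : (x == y) = false by apply: negbTE.
    rewrite /= orbF; case: (v =P y) => [->|]; last by rewrite andbF.
    by rewrite xy yacc orbT.
  have zx : z != x by apply: contraNneq xacc => <-.
  rewrite exA -par ?inE //; apply: eq_card => v; rewrite !inE newE (negbTE zx) /=.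
  case: (v =P x) => [->|_] /=; last by rewrite andbF.
  rewrite nx' (negbTE xacc) andbT orbF; case: (z =P y) => [->|] //=.
  by rewrite ltnNge ltnW.
have yx : (y < x)%N by apply: ltneq => //; move/allP: all_le; apply.
rewrite inE => /orP[/eqP->|zacc].
  have -> : [exists z0 in [set z1 in x :: acc], (x < z0)%N] = false.
    apply/negbTE/exists_inPn => z0; rewrite !inE -leqNgt => /orP[/eqP->//|].
    by move/(allP all_le).
  apply: eq_card0 => v; rewrite !inE newE eqxx nx /= orbF.
  have -> : (x == y) = false by apply: negbTE.
  rewrite /= orbF.
  by case: (v =P y) => [->|]; rewrite ?andbF // ltnNge (ltnW yx) !andbF.
have zx : z != x by apply: contraNneq xacc => <-.
have -> : [exists z0 in [set z1 in x :: acc], (z < z0)%N].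
  by apply/exists_inP; exists x; rewrite ?inE ?eqxx // ltneq // (allP all_le).
case: (z =P y) => [ezy|/eqP nzy].
  apply/eqP/card1P; exists x => v; rewrite !inE newE ezy eqxx.
  have -> : (y == x) = false by rewrite eq_sym; apply: negbTE.
  rewrite /=.
  case: (v =P x) => [->|_] /=; first by rewrite yx.
  apply/negP => /and3P[vacc yv lt].
  by move: lt; rewrite ltnNge (allP ymax).
have := par z; rewrite !inE => /(_ zacc).
have -> : [exists z0 in [set z1 in acc], (z < z0)%N].
  apply/exists_inP; exists y; rewrite ?inE // ltn_neqAle (allP ymax) // andbT.
  by apply: contraNneq nzy => /val_inj->.
move=> <-; apply: eq_card => v; rewrite !inE newE (negbTE zx) (negbTE nzy) /=.
by case: (v =P x) => [->|_] //=; rewrite nx' andbF.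
Qed.

Lemma pretree_word acc w Ed : acc != [::] -> uniq (acc ++ w) -> edges_ok acc w ->
  pretree [set z in acc] Ed ->
  pretree [set z in acc ++ w] (word_edges acc w :|: Ed).
Proof.
elim: w acc Ed => [|x w IH] acc Ed acc0 /=; first by rewrite cats0 set0U.
rewrite -cat_rcons => u /andP[Elx ok] pre.
have xacc : x \notin acc by move: u; rewrite cat_uniq rcons_uniq => /andP[/andP[]].
have eqs : (x :: acc) ++ w =i rcons acc x ++ w.
  by move=> z; rewrite !mem_cat mem_rcons.
have := IH (x :: acc) ([set x; link acc x] |: Ed) isT.
have -> : [set z in (x :: acc) ++ w] = [set z in rcons acc x ++ w].
  by apply/setP => z; rewrite !inE -eqs inE.
rewrite setUCA setUA; apply => //; last exact: pretree_step.
rewrite -(perm_uniq (s1 := rcons acc x ++ w)) //.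
by apply: perm_cat => //; rewrite perm_rcons.
Qed.

Definition word_tree m w : subgraph n :=
  Subgraph [set z in m :: w] (word_edges [:: m] w).

Lemma word_tree_decreasing m w : uniq (m :: w) -> edges_ok [:: m] w ->
  decreasing_subtree E (word_tree m w).
Proof.
move=> u ok.
have pre0 : pretree [set z in [:: m]] set0.
  split=> [e|x]; rewrite ?inE // => /eqP->.
  have -> : [exists z in [set z0 in [:: m]], (m < z)%N] = false.
    by apply/negbTE/exists_inPn => z; rewrite !inE => /eqP->; rewrite ltnn.
  by apply: eq_card0 => y; rewrite !inE andbF.
have [] := pretree_word (acc := [:: m]) isT u ok pre0; rewrite setU0 => sub par.
have par' x : x \in verts (word_tree m w) -> ~~ is_largest (word_tree m w) x ->
   #|[pred y in verts (word_tree m w) | adj (word_tree m w) x y & (x < y)%N]| = 1%N.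
  move=> xV; rewrite /is_largest xV /= => /forall_inPn[y yV]; rewrite -ltnNge => xy.
  have := par x xV; rewrite /larger_nbrs.
  have -> : [exists z in [set z in [:: m] ++ w], (x < z)%N] by apply/exists_inP; exists y.
  by [].
split => //; apply: (parents_tree symE) => //.
by apply/set0Pn; exists m; rewrite !inE eqxx.
Qed.

End WordTrees.

Section ListTree.
Variables (n : nat) (E : rel 'I_n).
Hypotheses (symE : symmetric E) (irrE : irreflexive E)
  (nuiE : natural_unit_interval E).
Implicit Types (T : subgraph n) (x y z m : 'I_n) (w s a b : seq 'I_n) (V : {set 'I_n}).

Lemma sorted_enum_set V : sorted (fun x y : 'I_n => (x < y)%N) (enum V).
Proof.
have -> : enum V = filter (mem V) (enum 'I_n) by rewrite {1}/enum_mem enumT.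
apply: sorted_filter; first by move=> y x z; apply: ltn_trans.
by have := iota_ltn_sorted 0 n; rewrite -val_enum_ord sorted_map.
Qed.

Lemma filter_enum_min V (P : pred 'I_n) x : x \in V -> P x ->
  (forall y, y \in V -> P y -> (x <= y)%N) ->
  exists t, [seq y <- enum V | P y] = x :: t.
Proof.
move=> xV Px xmin.
have : x \in [seq y <- enum V | P y] by rewrite mem_filter Px mem_enum.
have : sorted (fun x y : 'I_n => (x < y)%N) [seq y <- enum V | P y].
  by apply: sorted_filter (sorted_enum_set V) => y z t; apply: ltn_trans.
case es: [seq y <- enum V | P y] => [//|z t] /= pzt.
rewrite inE => /orP[/eqP->|xt]; first by exists t.
have /allP/(_ x xt) zx := order_path_min (fun y x z => @ltn_trans y x z) pzt.
have : z \in [seq y <- enum V | P y] by rewrite es inE eqxx.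
rewrite mem_filter mem_enum => /andP[Pz zV].
by have := xmin z zV Pz; rewrite leqNgt zx.
Qed.

Lemma take1_enum m V : m \in V -> (forall v, v \in V -> (m <= v)%N) -> take 1 (enum V) = [:: m].
Proof.
move=> mV mmin; have [] := filter_enum_min (P := predT) mV isT; first by move=> y yV _; apply: mmin.
by move=> t; rewrite filter_predT => ->; rewrite /= take0.
Qed.

Lemma list_step_min T s x : x \in verts T -> x \notin s -> has (adj T x) s ->
  (forall y, y \in verts T -> y \notin s -> has (adj T y) s -> (x <= y)%N) ->
  list_step T s = rcons s x.
Proof.
move=> xV xs xadj xmin; rewrite /list_step.
have [||t ->//] := filter_enum_min (P := fun y => (y \notin s) && has (adj T y) s) xV.
  by rewrite xs.
by move=> y yV /andP[]; apply: xmin.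
Qed.

Lemma index_middle a b x : uniq (a ++ x :: b) -> index x (a ++ x :: b) = size a.
Proof.
rewrite cat_uniq => /and3P[_ /hasPn/(_ x)]; rewrite inE eqxx => /(_ isT)/negbTE xa _.
by rewrite index_cat xa /= eqxx addn0.
Qed.

Section OfWord.
Variables (m : 'I_n) (w : seq 'I_n).
Hypotheses (uw : uniq (m :: w)) (mw : forall v, v \in w -> (m < v)%N).
Local Notation T := (word_tree m w).

Lemma list_step_word a x b : w = a ++ x :: b ->
  list_step T (m :: a) = rcons (m :: a) x.
Proof.
move=> ew.
have acc0 l : rev l ++ [:: m] != [::] by rewrite -size_eq0 size_cat addn1.
have mem_acc l z : (z \in rev l ++ [:: m]) = (z \in m :: l).
  by rewrite mem_cat mem_rev !inE orbC.
have xa : x \notin m :: a.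
  move: uw; rewrite ew -cat_cons cat_uniq => /and3P[_ /hasPn/(_ x) h _].
  by apply: h; rewrite inE eqxx.
apply: list_step_min => //.
- by rewrite inE ew inE mem_cat inE eqxx !orbT.
- apply/hasP; exists (link (rev a ++ [:: m]) x); first by rewrite -mem_acc link_in.
  by apply/word_edgesP; exists a, x, b.
move=> y; rewrite inE => yV ya /hasP[z za].
move=> /word_edgesP[a' [y' [b' [ew' /set2_eq[[ey ez]|[ey ez]]]]]]; last first.
  have yl : y \in m :: a' by rewrite ey -mem_acc link_in.
  have uyz : uniq ((m :: a') ++ y' :: b') by rewrite cat_cons -ew'.
  have yidx : (index y (m :: w) < size (m :: a'))%N.
    by rewrite ew' -cat_cons index_cat yl index_mem.
  have zidx : index z (m :: w) = size (m :: a').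
    by rewrite ez ew' -cat_cons index_middle.
  have zidx' : (index z (m :: w) < size (m :: a))%N.
    by rewrite ew -cat_cons index_cat za index_mem.
  have yidx' : (size (m :: a) <= index y (m :: w))%N.
    by rewrite ew -cat_cons index_cat (negbTE ya) leq_addr.
  by move: yidx zidx' yidx'; rewrite zidx; move: (size _) (size _) (index _ _) => i j k; lia.
rewrite -ey in ew' ez.
case: (eqVneq y x) => [->//|yx].
have [c ea'] : exists c, a' = a ++ x :: c.
  have ya'x : (size (m :: a) < size (m :: a'))%N.
    have yi : index y (m :: w) = size (m :: a').
      by rewrite ew' -cat_cons index_middle // cat_cons -ew'.
    rewrite -yi ew -cat_cons index_cat (negbTE ya) /= eq_sym (negbTE yx).
    by rewrite addnS ltnS leq_addr.
  have : take (size a').+1 w = rcons a' y by rewrite ew' -cat_rcons take_size_cat // size_rcons.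
  have lt : (size a < size a')%N by [].
  have ea : take (size a').+1 w = a ++ x :: take (size a' - size a) b.
    rewrite ew take_cat ltnNge ltnW ?ltnS ?(ltnW lt) //=.
    by rewrite subSn ?(ltnW lt).
  rewrite ea => e; have := congr1 (take (size a')) e.
  rewrite -cats1 [in RHS]take_size_cat // take_cat ltnNge (ltnW lt) /=.
  have -> : (size a' - size a = (size a' - size a).-1.+1)%N by rewrite prednK // subn_gt0.
  by move=> <-; eexists.
have eacc : rev a' ++ [:: m] = rev c ++ x :: (rev a ++ [:: m]).
  by rewrite ea' rev_cat rev_cons -!catA cat_rcons.
case: (linkP y (acc0 a')) ez => [u z' t e hu yz'|z' all_le _ _] ez.
  have zz : z \in rev a ++ [:: m] by rewrite mem_acc.
  have uu : uniq (rev a' ++ [:: m]).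
    move: uw; rewrite ew' -cat_cons cat_uniq => /andP[h _].
    by rewrite cats1 -rev_cons rev_uniq.
  have xu : x \in u.
    have xi : (index x (rev a' ++ [:: m]) < index z (rev a' ++ [:: m]))%N.
      rewrite {1}eacc index_middle -?eacc //.
      have zc : z \notin rev c.
        move: uu; rewrite eacc cat_uniq => /and3P[_ /hasPn/(_ z)]; rewrite inE zz orbT => /(_ isT).
        by [].
      rewrite eacc index_cat (negbTE zc) /=; case: (x =P z) => [xz|_]; last by rewrite addnS ltnS leq_addr.
      by move: xa; rewrite xz za.
    move: xi; rewrite ez e [X in (_ < X)%N]index_cat.
    have zu : z' \notin u.
      move: uu; rewrite e cat_uniq => /and3P[_ /hasPn/(_ z')]; rewrite inE eqxx => /(_ isT).
      by [].
    rewrite (negbTE zu) /= eqxx addn0 index_cat; case: (boolP (x \in u)) => // _.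
    by rewrite ltnNge leq_addr.
  by move/allP: hu; apply.
by move/allP: all_le; apply; rewrite eacc mem_cat inE eqxx orbT.
Qed.

Lemma list_tree_word : list_tree T = m :: w.
Proof.
rewrite /list_tree /= (@take1_enum m); last 2 first.
- by rewrite !inE eqxx.
- by move=> v; rewrite !inE => /orP[/eqP->//|/mw/ltnW].
have -> : #|[set z in m :: w]|.-1 = size w.
  by rewrite (cardsE (mem (m :: w))) (card_uniqP uw).
suff H k : (k <= size w)%N -> iter k (list_step T) [:: m] = m :: take k w.
  by rewrite H // take_size.
elim: k => [|k IH] kw; first by rewrite take0.
rewrite iterS IH; last exact: ltnW.
rewrite (@list_step_word _ (nth m w k) (drop k.+1 w)).
  by rewrite (take_nth m).
by rewrite -drop_nth // cat_take_drop.
Qed.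

End OfWord.
End ListTree.

Lemma subgraph_eq n (T T' : subgraph n) :
  verts T = verts T' -> edges T = edges T' -> T = T'.
Proof. by case: T T' => [V D] [V' D'] /= -> ->. Qed.

Section TreeWord.
Variables (n : nat) (E : rel 'I_n).
Hypotheses (symE : symmetric E) (irrE : irreflexive E)
  (nuiE : natural_unit_interval E).
Implicit Types (x y z t u v : 'I_n) (s a : seq 'I_n).
Variables (T : subgraph n) (m : 'I_n).
Hypotheses (decT : decreasing_subtree E T) (mT : m \in verts T)
  (min_m : forall v, v \in verts T -> (m <= v)%N).

Lemma parent_unique x z t : adj T x z -> adj T x t -> (x < z)%N -> (x < t)%N -> z = t.
Proof.
case: decT => subT _ par xz xt lxz lxt.
have [xV zV _] := adj_subgraph symE subT xz.
have [_ tV _] := adj_subgraph symE subT xt.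
have nl : ~~ is_largest T x.
  by rewrite /is_largest xV /=; apply/forall_inPn; exists z; rewrite // -ltnNge.
have /eqP/card1P[/= u ue] := par x xV nl.
have := ue z; rewrite !inE zV xz lxz => /esym/eqP->.
by have := ue t; rewrite !inE tV xt lxt => /esym/eqP->.
Qed.

Definition top_closed s : Prop := forall z t, z \in s -> adj T z t -> (z < t)%N ->
  t \in s \/ {in s, forall u, (u <= z)%N}.

Definition greedy s : Prop := forall s1 y s2, s = s1 ++ y :: s2 -> s1 != [::] ->
  forall z, z \in verts T -> z \notin s1 -> has (adj T z) s1 -> (y <= z)%N.

Definition edges_within s : Prop := forall x y,
  ([set x; y] \in word_edges [:: m] (behead s)) = [&& adj T x y, x \in s & y \in s].



Lemma word_edges_rcons acc a x :
  word_edges acc (rcons a x) = [set x; link (rev a ++ acc) x] |: word_edges acc a.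
Proof.
elim: a acc => [|y a IH] acc /=; first by rewrite setUC.
by rewrite IH rev_cons cat_rcons setUCA.
Qed.

Record prefix_inv s : Prop := PrefixInv {
  prefix_head : exists a, s = m :: a;
  prefix_uniq : uniq s;
  prefix_sub : {subset s <= verts T};
  prefix_top : top_closed s;
  prefix_greedy : greedy s;
  prefix_edges : edges_within s }.

Lemma crossing_edge s : m \in s -> (exists2 v, v \in verts T & v \notin s) ->
  exists2 v, v \in verts T & (v \notin s) && has (adj T v) s.
Proof.
move=> ms [v vV vs]; case: decT => subT [_ conn _] _.
apply/exists_inP; apply: contraNT vs => /exists_inPn nocross.
rewrite -(closed_connect _ (conn m v mT vV)) // => x y xy.
have [xV yV _] := adj_subgraph symE subT xy.
apply/idP/idP => [xs|ys].
  have := nocross y yV; rewrite negb_and negbK => /orP[//|/hasPn/(_ x xs)].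
  by rewrite adj_sym xy.
have := nocross x xV; rewrite negb_and negbK => /orP[//|/hasPn/(_ y ys)].
by rewrite xy.
Qed.

Lemma adj_link s x : prefix_inv s -> x \in verts T -> x \notin s -> has (adj T x) s ->
  (forall y, y \in verts T -> y \notin s -> has (adj T y) s -> (x <= y)%N) ->
  {in s, forall z, adj T x z = (z == link (rev s) x)} /\
  ((link (rev s) x < x)%N -> {in s, forall z, (z <= link (rev s) x)%N}).
Proof.
move=> [_ us sV topI gr _] xV xs /hasP[z0 z0s xz0] xmin.
have s0 : rev s != [::] by rewrite -size_eq0 size_rev size_eq0; case: (s) z0s.
have lt_of_le z : z \in s -> (z <= x)%N -> (z < x)%N.
  by move=> zs zx; rewrite ltn_neqAle zx andbT; apply: contraNneq xs => /val_inj <-.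
have below z : z \in s -> adj T x z -> (z < x)%N -> {in s, forall u, (u <= z)%N}.
  move=> zs xz zx; case: (topI z x zs _ zx) => //; first by rewrite adj_sym.
  by rewrite (negbTE xs).
have irr z : adj T z z -> False.
  by case: decT => subT _ _ /(adj_subgraph symE subT)[_ _]; rewrite irrE.
case: (linkP x s0) => [u y t es hu xy|y all_le ys ymax].
  have ys : y \in s by rewrite -mem_rev es mem_cat inE eqxx orbT.
  split; last by move=> yx; have := ltn_trans xy yx; rewrite ltnn.
  have above z : z \in s -> adj T x z -> (x < z)%N -> z = y.
    move=> zs xz xltz; move: (zs); rewrite -mem_rev es mem_cat inE => /or3P[zu|/eqP//|zt].
      by move/allP/(_ z zu): hu; rewrite leqNgt xltz.
    have es' : s = rev t ++ y :: rev u by rewrite -[s]revK es rev_cat rev_cons cat_rcons.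
    have xt : x \notin rev t by apply: contra xs; rewrite es' mem_cat => ->.
    have := gr (rev t) y (rev u) es' _ x xV xt; rewrite -size_eq0 size_rev size_eq0.
    have -> : t != [::] by case: (t) zt.
    have -> : has (adj T x) (rev t) by apply/hasP; exists z; rewrite ?mem_rev.
    by move=> /(_ isT isT); rewrite leqNgt xy.
  have nolow z : z \in s -> adj T x z -> (x < z)%N.
    move=> zs xz; rewrite ltnNge; apply/negP => /(lt_of_le _ zs) zx.
    by have := below z zs xz zx y ys; rewrite leqNgt (ltn_trans zx xy).
  have xy_adj : adj T x y by rewrite -(above z0) ?nolow.
  move=> z zs; apply/idP/eqP => [xz|->//]; apply: above => //; exact: nolow.
have zlow z : z \in s -> (z < x)%N by move=> zs; apply: lt_of_le => //; apply: (allP all_le); rewrite mem_rev.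
rewrite mem_rev in ys.
have is_y z : z \in s -> adj T x z -> z = y.
  move=> zs xz; apply/val_inj/eqP; rewrite eqn_leq (allP ymax) ?mem_rev //=.
  exact: (below z zs xz (zlow z zs)).
split; last by move=> _ z zs; apply: (allP ymax); rewrite mem_rev.
move=> z zs; apply/idP/eqP => [xz|->]; first exact: is_y.
by rewrite -(is_y z0).
Qed.

Lemma prefix_step s : prefix_inv s -> (exists2 v, v \in verts T & v \notin s) ->
  exists2 x, list_step T s = rcons s x & prefix_inv (rcons s x).
Proof.
move=> pi; have [[a es] us sV topI gr ed] := pi => out.
have ms : m \in s by rewrite es inE eqxx.
have [v vV /andP[vs vadj]] := crossing_edge ms out.
pose cand := [pred y in verts T | (y \notin s) && has (adj T y) s].
have vc : cand v by rewrite !inE vV vs.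
have [x /andP[xV /andP[xs xadj]] xmin'] : exists2 x, cand x & forall y, cand y -> (x <= y)%N.
  by case: (@arg_minnP _ v cand val vc) => x xc xmin; exists x.
have xmin y : y \in verts T -> y \notin s -> has (adj T y) s -> (x <= y)%N.
  by move=> yV ys yadj; apply: xmin'; rewrite !inE yV ys.
have [lnk lnk_max] := adj_link pi xV xs xadj xmin.
exists x; first exact: list_step_min.
have irr z : adj T z z = false.
  by apply/negP; case: decT => subT _ _ /(adj_subgraph symE subT)[_ _]; rewrite irrE.
have lt_or z : z \in s -> (z < x)%N \/ (x < z)%N.
  move=> zs; case: (ltngtP z x) => [||/val_inj e]; [by left|by right|].
  by rewrite e (negbTE xs) in zs.
have s0 : rev s != [::] by rewrite es -size_eq0 size_rev.
have ls : link (rev s) x \in s by rewrite -mem_rev link_in.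
have xl : adj T x (link (rev s) x) by rewrite lnk.
split.
- by exists (rcons a x); rewrite es.
- by rewrite rcons_uniq xs.
- by move=> z; rewrite mem_rcons inE => /orP[/eqP->|/sV].
- move=> z t; rewrite mem_rcons inE => /orP[/eqP->|zs] zt ltzt.
    case: (boolP (t \in s)) => ts; first by left; rewrite mem_rcons inE ts orbT.
    right=> u; rewrite mem_rcons inE => /orP[/eqP->//|us'].
    case: (lt_or _ ls) => [lx|xl_lt].
      by apply: leq_trans (lnk_max lx u us') (ltnW lx).
    by move: ts; rewrite -(parent_unique xl zt xl_lt ltzt) ls.
  case: (eqVneq t x) => [->|tx]; first by left; rewrite mem_rcons inE eqxx.
  case: (topI z t zs zt ltzt) => [ts|zmax]; first by left; rewrite mem_rcons inE ts orbT.
  right=> u; rewrite mem_rcons inE => /orP[/eqP->|/zmax//].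
  case: (lt_or _ zs) => [zx|/ltnW//].
  case: (lt_or _ ls) => [lx|xl_lt].
    have lz : link (rev s) x = z.
      by apply/val_inj/eqP; rewrite eqn_leq zmax // lnk_max.
    rewrite lz adj_sym in xl.
    by rewrite (parent_unique xl zt zx ltzt) eqxx in tx.
  by have := zmax _ ls; rewrite leqNgt (ltn_trans zx xl_lt).
- move=> s1 y s2; case/lastP: s2 => [|s2 y'].
    rewrite cats1 => /rcons_inj[<- <-] _ z; exact: xmin.
  rewrite -rcons_cons -rcons_cat => /rcons_inj[e _]; exact: gr e.
move=> y z; rewrite [behead _](_ : _ = rcons a x); last by rewrite es.
rewrite word_edges_rcons in_setU1 cats1 -rev_cons -es.
have := ed y z; rewrite [behead s](_ : _ = a) ?es // => ->; rewrite -es !mem_rcons !inE.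
have eqset : ([set y; z] == [set x; link (rev s) x]) =
    ((y == x) && (z == link (rev s) x)) || ((y == link (rev s) x) && (z == x)).
  apply/eqP/orP => [/set2_eq[[-> ->]|[-> ->]]|[/andP[/eqP-> /eqP->]|/andP[/eqP-> /eqP->]]] //.
  - by left; rewrite !eqxx.
  - by right; rewrite !eqxx.
  - by rewrite setUC.
rewrite eqset; have lx : (link (rev s) x == x) = false by apply: contraNF xs => /eqP<-.
case: (eqVneq y x) => [->|yx]; case: (eqVneq z x) => [->|zx] /=.
- by rewrite irr eq_sym lx.
- rewrite (negbTE xs) /= !andbF !orbF.
  case: (boolP (z \in s)) => zs; first by rewrite andbT lnk.
  by rewrite andbF; apply: contraNF zs => /eqP->.
- rewrite (negbTE xs) !andbF !andbT ?orbF.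
  case: (boolP (y \in s)) => ys; first by rewrite ?andbT adj_sym lnk.
  by rewrite andbF; apply: contraNF ys => /eqP->.
- by rewrite andbF.
Qed.

Lemma tree_word : exists w, [/\ list_tree T = m :: w, uniq (m :: w),
  T = word_tree m w & search_word E m w].
Proof.
have inv0 : prefix_inv [:: m].
  split=> //.
  - by exists [::].
  - by move=> z; rewrite inE => /eqP->.
  - by move=> z t; rewrite inE => /eqP-> _ _; right=> u; rewrite inE => /eqP->.
  - by move=> [|x [|? ?]] y s2.
  - move=> x y; rewrite /= !inE; symmetry; apply/and3P => -[xy /eqP ex /eqP ey].
    move: xy; rewrite ex ey; case: decT => subT _ _ /(adj_subgraph symE subT)[_ _].
    by rewrite irrE.
have H k : (k < #|verts T|)%N -> exists2 s, iter k (list_step T) [:: m] = s & prefix_inv s /\ size s = k.+1.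
  elim: k => [|k IH] kV; first by exists [:: m].
  have [s es [inv ss]] := IH (ltnW kV).
  have [|x ex inv'] := prefix_step inv.
    apply/exists_inP; apply: contraTT kV => /exists_inPn sub.
    rewrite -leqNgt -ss -(card_uniqP (prefix_uniq inv)); apply/subset_leq_card/subsetP => v vV.
    by have := sub v vV; rewrite negbK.
  by exists (rcons s x); rewrite ?iterS ?es ?ex // size_rcons ss.
have V0 : (0 < #|verts T|)%N by rewrite card_gt0; apply/set0Pn; exists m.
have [|s es [inv ss]] := H #|verts T|.-1; first by rewrite prednK.
have [[w ew] us sV topI gr ed] := inv.
have Vs : verts T = [set z in m :: w].
  apply/esym/eqP; rewrite eqEcard; apply/andP; split.
    by apply/subsetP => z; rewrite inE -ew; apply: sV.
  by rewrite (cardsE (mem (m :: w))) -ew (card_uniqP us) ss prednK.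
have eT : T = word_tree m w.
  apply: subgraph_eq => //; apply/setP => e; case: decT => subT _ _; apply/idP/idP => eE.
    have [x [y [xV yV _ ee]]] := subT e eE; rewrite ee.
    have := ed x y; rewrite ew /= /adj -ee eE => ->.
    by move: xV yV; rewrite Vs !inE => -> ->.
  have /word_edgesP[a [x [b [_ ee]]]] := eE.
  move: eE; rewrite ee; have := ed x (link (rev a ++ [:: m]) x).
  by rewrite ew /= => -> /and3P[].
have uw : uniq (m :: w) by rewrite -ew.
exists w; split => //; first by rewrite /list_tree (take1_enum mT min_m) es.
rewrite /search_word (edges_okE symE nuiE) //.
have okE : forall a b, w = a ++ b -> edges_ok E (rev a ++ [:: m]) b.
  move=> a b; elim: b a => //= x b IH a e; rewrite (_ : x :: _ = rev (rcons a x) ++ [:: m]); last first.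
    by rewrite rev_rcons.
  rewrite IH ?cat_rcons // andbT; case: decT => subT _ _.
  have [//|_ _] := adj_subgraph symE (x := link (rev a ++ [:: m]) x) (y := x) subT.
    by rewrite eT /adj /= setUC; apply/word_edgesP; exists a, x, b.
  by [].
exact: (okE [::] w).
Qed.

End TreeWord.

(** * Forest triples *)

Section Forests.
Variables (n : nat) (E : rel 'I_n).
Hypotheses (symE : symmetric E) (irrE : irreflexive E)
  (nuiE : natural_unit_interval E).
Implicit Types (x y z m : 'I_n) (U V Z : {set 'I_n}) (T : subgraph n)
  (t : tree_triple n) (F : seq (tree_triple n)).

Definition trees_on V : seq (subgraph n) :=
  [seq Subgraph V D | D <- enum [set: {set {set 'I_n}}] & `[< decreasing_subtree E (Subgraph V D) >]].

Lemma mem_trees_on V T : T \in trees_on V <-> verts T = V /\ decreasing_subtree E T.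
Proof.
split=> [/mapP[D]|[<-]].
  by rewrite mem_filter => /andP[/asboolP dec _] ->.
case: T => V' D /= dec; apply/mapP; exists D => //.
by rewrite mem_filter mem_enum inE andbT; apply/asboolP.
Qed.

Lemma trees_on_uniq V : uniq (trees_on V).
Proof. by rewrite map_inj_uniq; [exact/filter_uniq/enum_uniq | move=> D D' []]. Qed.

Lemma sum_trees_on (R : comNzRingType) (q : R) m (B : {set 'I_n}) :
  (forall v, v \in B -> (m < v)%N) ->
  \sum_(T <- trees_on (m |: B)) q ^+ word_inv E (list_tree T) = tree_wt E q m B.
Proof.
move=> mB; have mNB : m \notin B by apply/negP => /mB; rewrite ltnn.
have uw w : w \in permutations (enum B) -> uniq (m :: w).
  rewrite mem_permutations => pw.
  by rewrite /= (perm_mem pw) mem_enum mNB (perm_uniq pw) enum_uniq.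
have mw w : w \in permutations (enum B) -> forall v, v \in w -> (m < v)%N.
  by rewrite mem_permutations => pw v; rewrite (perm_mem pw) mem_enum => /mB.
have Vw w : w \in permutations (enum B) -> [set z in m :: w] = m |: B.
  by rewrite mem_permutations => pw; apply/setP => z; rewrite !inE (perm_mem pw) mem_enum.
rewrite -sum_search_words //.
have pe : perm_eq (trees_on (m |: B))
    [seq word_tree m w | w <- permutations (enum B) & search_word E m w].
  apply: uniq_perm; first exact: trees_on_uniq.
    rewrite map_inj_in_uniq ?filter_uniq ?permutations_uniq // => w w'.
    rewrite !mem_filter => /andP[_ pw] /andP[_ pw'] e.
    have := list_tree_word (uw _ pw) (mw _ pw).
    by rewrite e list_tree_word ?uw //; [case | exact: mw].
  move=> T; apply/idP/mapP => [/mem_trees_on[VT dec]|[w]].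
    have mT : m \in verts T by rewrite VT setU11.
    have minT v : v \in verts T -> (m <= v)%N by rewrite VT !inE => /orP[/eqP->//|/mB/ltnW].
    have [w [lw umw eT sw]] := tree_word symE irrE nuiE dec mT minT.
    exists w => //; rewrite mem_filter sw mem_permutations /=.
    apply: uniq_perm; rewrite ?enum_uniq //; first by case/andP: umw.
    move=> z; rewrite mem_enum; have := congr1 (fun X : {set 'I_n} => z \in X) VT; rewrite {1}eT !inE.
    case: (z =P m) => [->|] //= _; rewrite (negbTE mNB); by case/andP: umw => /negbTE.
  rewrite mem_filter => /andP[sw pw] ->; apply/mem_trees_on; split; first exact: Vw.
  apply: (word_tree_decreasing symE); first exact: uw.
  by rewrite -(edges_okE symE nuiE) // -?/(search_word E m w) //; apply: uw.
rewrite (perm_big _ pe) big_map big_filter [LHS]big_seq_cond [RHS]big_seq_cond; apply: eq_bigr => w /andP[pw _].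
by rewrite list_tree_word ?uw //; apply: mw.
Qed.

Definition triples_on V : seq (tree_triple n) :=
  [seq TreeTriple p.1 p.2 r | p <- [seq (T, al) | T <- trees_on V, al <- compositions #|V|],
                              r <- iota 1 (head 0%N p.2)].

Lemma mem_triples_on V t : t \in triples_on V <-> is_tree_triple E t /\ verts (tt_tree t) = V.
Proof.
split.
  case/allpairsPdep => -[T al] [r [/allpairsP[[T' al'] /= [/mem_trees_on[VT dec] alV [-> ->]]]]].
  rewrite mem_iota add1n ltnS => hr ->; split=> //=; split => //=.
    by move: alV; rewrite mem_compositions => /andP[].
  by move: alV; rewrite mem_compositions VT => /andP[_ /eqP].
case: t => T al r [[/= dec comp sal hr] VT].
apply/allpairsPdep; exists (T, al), r; split => //.
  apply/allpairsP; exists (T, al); split => //=; first exact/mem_trees_on.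
  by rewrite mem_compositions comp sal VT /=.
by rewrite mem_iota add1n ltnS.
Qed.

Lemma triples_on_uniq V : uniq (triples_on V).
Proof.
apply: allpairs_uniq_dep.
- apply: allpairs_uniq; rewrite ?trees_on_uniq ?compositions_uniq //.
  by move=> [? ?] [? ?] _ _ [-> ->].
- by move=> p _; apply: iota_uniq.
by move=> [[T al] r] [[T' al'] r'] _ _ /= [-> -> ->].
Qed.

Fixpoint forests (k : nat) Z : seq (seq (tree_triple n)) :=
  if k is k'.+1 then
    if enum Z is m :: _ then
      [seq t :: F | t <- [seq t | U <- enum (powerset (Z :\ m)), t <- triples_on (m |: U)],
                    F <- forests k' (Z :\: verts (tt_tree t))]
    else [:: [::]]
  else [:: [::]].

Definition forest_on Z F : Prop :=
  [/\ forall t, t \in F -> is_tree_triple E t,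
      forall v : 'I_n, count (fun t => v \in verts (tt_tree t)) F = (v \in Z) :> nat
    & sorted (fun t u => (min_vert (tt_tree t) < min_vert (tt_tree u))%N) F].

Lemma enum_cons Z m s : enum Z = m :: s -> m \in Z /\ (forall v, v \in Z -> (m <= v)%N).
Proof.
move=> e; split; first by rewrite -mem_enum e inE eqxx.
move=> v; rewrite -mem_enum e inE => /orP[/eqP->//|vs].
have := sorted_enum_set Z; rewrite e /=.
by move/(order_path_min (fun y x z => @ltn_trans y x z))/allP/(_ v vs)/ltnW.
Qed.

Lemma enum_nil Z : enum Z = [::] -> Z = set0.
Proof. by move=> e; apply/setP => v; rewrite -mem_enum e !inE. Qed.

Lemma min_vertE T m : m \in verts T -> (forall v, v \in verts T -> (m <= v)%N) ->
  min_vert T = m.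
Proof.
move=> mT mmin; rewrite /min_vert; have := take1_enum mT mmin.
by case: (enum _) => //= x s [] <-.
Qed.

Lemma min_vertP T : verts T != set0 ->
  exists m, [/\ m \in verts T, forall v, v \in verts T -> (m <= v)%N & min_vert T = m].
Proof.
case ee: (enum (verts T)) => [|m s]; first by rewrite (enum_nil ee) eqxx.
by have [mT mmin] := enum_cons ee => _; exists m; split => //; apply: min_vertE.
Qed.

Lemma triple_nonempty t : is_tree_triple E t -> verts (tt_tree t) != set0.
Proof. by case=> [[_ [? _ _] _]]. Qed.

Lemma sorted_min_vert t F :
  sorted (fun t u => (min_vert (tt_tree t) < min_vert (tt_tree u))%N) (t :: F) =
  all (fun u => (min_vert (tt_tree t) < min_vert (tt_tree u))%N) F &&
  sorted (fun t u => (min_vert (tt_tree t) < min_vert (tt_tree u))%N) F.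
Proof. by rewrite [LHS]/= path_sortedE // => b a c /=; apply: ltn_trans. Qed.

Lemma forest_on_cons Z m t F : m \in Z -> (forall v, v \in Z -> (m <= v)%N) ->
  forest_on Z (t :: F) <->
  [/\ is_tree_triple E t, m \in verts (tt_tree t), verts (tt_tree t) \subset Z
    & forest_on (Z :\: verts (tt_tree t)) F].
Proof.
move=> mZ mmin; split.
  case=> tri cnt srt.
  have tt := tri t (mem_head _ _).
  have sub : verts (tt_tree t) \subset Z.
    apply/subsetP => v vt; have := cnt v; rewrite /= vt.
    by case: (v \in Z).
  have mt : m \in verts (tt_tree t).
    apply/negPn/negP => mt; have := cnt m; rewrite /= (negbTE mt) mZ add0n => c1.
    have : has (fun u => m \in verts (tt_tree u)) F by rewrite has_count c1.
    case/hasP => u uF mu.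
    have [m1 [m1t _ e1]] := min_vertP (triple_nonempty tt).
    have tu : is_tree_triple E u by apply: tri; rewrite inE uF orbT.
    have [m2 [m2u m2min e2]] := min_vertP (triple_nonempty tu).
    move: srt; rewrite sorted_min_vert => /andP[/allP/(_ u uF)] + _.
    rewrite e1 e2 ltnNge => /negP; apply; apply: leq_trans (m2min m mu) (mmin m1 _).
    exact: (subsetP sub).
  split => //; split.
  - by move=> u uF; apply: tri; rewrite inE uF orbT.
  - move=> v; have := cnt v; rewrite /= !inE; case: (v \in verts _) => /=; last by rewrite add0n.
    by case: (v \in Z) => //= -[].
  - by move: srt; rewrite sorted_min_vert => /andP[].
case=> tt mt sub [tri cnt srt]; split.
- by move=> u; rewrite inE => /orP[/eqP->|/tri].
- move=> v; rewrite /= cnt !inE; case: (boolP (v \in verts _)) => //= vt.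
  by rewrite (subsetP sub).
rewrite sorted_min_vert srt andbT; apply/allP => u uF.
have uZ v : v \in verts (tt_tree u) -> (v \in Z) && (v \notin verts (tt_tree t)).
  move=> vu; have := cnt v; rewrite !inE andbC; case: (_ && _) => // c0.
  have : has (fun u => v \in verts (tt_tree u)) F by apply/hasP; exists u.
  by rewrite has_count c0.
have [m2 [m2u _ ->]] := min_vertP (triple_nonempty (tri u uF)).
rewrite (min_vertE mt) => [|v /(subsetP sub)/mmin //].
have /andP[m2Z m2t] := uZ _ m2u.
rewrite ltn_neqAle mmin // andbT; apply: contraNneq m2t => /val_inj <-; exact: mt.
Qed.

Lemma mem_forests k Z F : (#|Z| <= k)%N -> F \in forests k Z <-> forest_on Z F.
Proof.
have nil_on V : V = set0 -> forall G, G \in [:: [::]] <-> forest_on V G.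
  move=> -> G; rewrite inE; split=> [/eqP->|[tri cnt _]].
    by split => // v; rewrite inE.
  case: G tri cnt => // t G tri cnt.
  have [m [mt _ _]] := min_vertP (triple_nonempty (tri t (mem_head _ _))).
  by have := cnt m; rewrite /= mt inE.
elim: k Z F => [|k IH] Z F /=.
  by rewrite leqn0 cards_eq0 => /eqP Z0; apply: nil_on.
move=> Zk; case ee: (enum Z) => [|m s]; first by apply: nil_on; apply: enum_nil.
have [mZ mmin] := enum_cons ee.
have cardD t : m \in verts (tt_tree t) -> (#|Z :\: verts (tt_tree t)| <= k)%N.
  move=> mt; rewrite -ltnS; apply: leq_trans Zk; apply: proper_card.
  rewrite properE subsetDl; apply/subsetPn; exists m => //.
  by rewrite inE mt.
have tripE t : t \in [seq t | U <- enum (powerset (Z :\ m)), t <- triples_on (m |: U)] <->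
    [/\ is_tree_triple E t, m \in verts (tt_tree t) & verts (tt_tree t) \subset Z].
  split=> [/allpairsPdep[U [u [+ + ->]]]|[tt mt sub]].
    rewrite mem_enum powersetE => US /mem_triples_on[tt ->]; split => //.
      exact: setU11.
    by rewrite subUset sub1set mZ (subset_trans US) ?subsetDl.
  apply/allpairsPdep; exists (verts (tt_tree t) :\ m), t; split => //.
    by rewrite mem_enum powersetE setSD.
  by apply/mem_triples_on; rewrite setD1K.
split.
  case/allpairsPdep => t [G [/tripE[tt mt sub] GF ->]].
  by apply/(forest_on_cons _ _ mZ mmin); split => //; apply/IH => //; apply: cardD.
case: F => [[_ cnt _]|t G /(forest_on_cons _ _ mZ mmin)[tt mt sub on]].
  by have := cnt m; rewrite mZ.
apply/allpairsPdep; exists t, G; split => //; first exact/tripE.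
by apply/IH => //; apply: cardD.
Qed.

Lemma forests_uniq k Z : uniq (forests k Z).
Proof.
elim: k Z => //= k IH Z; case ee: (enum Z) => [//|m s].
apply: allpairs_uniq_dep => [|t _|[t F] [t' F'] _ _ /= [-> ->]] //.
apply: allpairs_uniq_dep => [|U _|[U t] [U' t']]; [exact: enum_uniq|exact: triples_on_uniq|].
case/allpairsPdep => V [u [VS uV [-> ->]]] /allpairsPdep[V' [u' [VS' uV' [-> ->]]]] /= e.
move: uV uV' VS VS'; rewrite e => /mem_triples_on[_ e1] /mem_triples_on[_ e2].
rewrite !mem_enum !powersetE => /subsetP VS /subsetP VS'.
have mV : m \notin V by apply/negP => /VS; rewrite !inE eqxx.
have mV' : m \notin V' by apply/negP => /VS'; rewrite !inE eqxx.
by rewrite -(setU1K mV) -(setU1K mV') -e1 -e2.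
Qed.

Lemma list_tree_perm T : decreasing_subtree E T -> perm_eq (list_tree T) (enum (verts T)).
Proof.
move=> dec; have V0 : verts T != set0 by case: dec => _ [].
have [m [mT minT _]] := min_vertP V0.
have [w [-> uw eT _]] := tree_word symE irrE nuiE dec mT minT.
apply: uniq_perm; rewrite ?enum_uniq // => z.
by rewrite mem_enum eT /= [RHS]inE.
Qed.

Definition forest_word F : seq 'I_n := flatten [seq list_tree (tt_tree t) | t <- F].

Lemma forest_word_perm Z F : forest_on Z F -> perm_eq (forest_word F) (enum Z).
Proof.
elim: F Z => [|t F IH] Z on.
  case: on => _ cnt _; apply: uniq_perm; rewrite ?enum_uniq // => v.
  by have := cnt v; rewrite mem_enum /=; case: (v \in Z).
case ee: (enum Z) => [|m s].
  case: on => tri cnt _; have [m [mt _ _]] := min_vertP (triple_nonempty (tri t (mem_head _ _))).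
  by have := cnt m; rewrite /= mt -mem_enum ee.
have [mZ mmin] := enum_cons ee; rewrite -ee.
have /(forest_on_cons _ _ mZ mmin)[[dec _ _ _] mt sub /IH pF] := on.
have pt := list_tree_perm dec.
apply: uniq_perm; rewrite ?enum_uniq //.
  rewrite /= cat_uniq (perm_uniq pt) enum_uniq (perm_uniq pF) enum_uniq andbT /=.
  apply/hasPn => z; rewrite (perm_mem pF) mem_enum inE => /andP[zt _].
  by rewrite (perm_mem pt) mem_enum.
move=> z; rewrite /= mem_cat (perm_mem pt) (perm_mem pF) !mem_enum !inE.
by case: (boolP (z \in verts _)) => //= /(subsetP sub) ->.
Qed.

Lemma word_inv_cat (a b : seq 'I_n) : word_inv E (a ++ b) =
  (word_inv E a + word_inv E b + \sum_(x <- a) count (fun y : 'I_n => (y < x)%N && E y x) b)%N.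
Proof.
elim: a => [|x a IH]; first by rewrite big_nil addn0.
by rewrite cat_cons /word_inv -/(word_inv E) IH count_cat big_cons; lia.
Qed.

Lemma cross_inv U V (a b : seq 'I_n) : perm_eq a (enum U) -> perm_eq b (enum V) ->
  (\sum_(x <- a) count (fun y : 'I_n => (y < x)%N && E y x) b)%N = edges_up E V U.
Proof.
move=> pa pb; rewrite (perm_big _ pa) /edges_up big_enum /=; apply: eq_bigr => x _.
rewrite (permP pb) -sum1_count big_enum_cond /= /down_deg -sum1_card.
by apply: eq_bigl => y; rewrite inE.
Qed.

Section ForestSum.
Variables (R : comNzRingType) (q : R) (e : nat -> R).

Definition triple_wt t : R :=
  (-1) ^+ (size (tt_comp t) - 1) * q ^+ (word_inv E (list_tree (tt_tree t)) + (tt_r t - 1)) *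
  \prod_(a <- tt_comp t) e a.

Definition forest_wt F : R :=
  (-1) ^+ (\sum_(t <- F) (size (tt_comp t) - 1)) *
  q ^+ (word_inv E (forest_word F) + \sum_(t <- F) (tt_r t - 1)) *
  \prod_(a <- flatten [seq tt_comp t | t <- F]) e a.

Lemma forest_wt_cons Z t F : is_tree_triple E t -> forest_on (Z :\: verts (tt_tree t)) F ->
  forest_wt (t :: F) =
  triple_wt t * q ^+ edges_up E (Z :\: verts (tt_tree t)) (verts (tt_tree t)) * forest_wt F.
Proof.
case=> dec _ _ _ on; rewrite /forest_wt /triple_wt !big_cons big_cat /= word_inv_cat.
rewrite (cross_inv (list_tree_perm dec) (forest_word_perm on)) !exprD.
suff h (a a' b b' c d d' f f' : R) : a * a' * (b * b' * c * (d * d')) * (f * f') =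
  a * (b * d) * f * c * (a' * (b' * d') * f') by apply: h.
by ring.
Qed.

End ForestSum.

Lemma sum_triples_on (R : comNzRingType) (q : R) xs m (B : {set 'I_n}) :
  (forall v, v \in B -> (m < v)%N) ->
  \sum_(t <- triples_on (m |: B)) triple_wt q (elem_poly xs) t =
  tree_wt E q m B * signed_comp_sum q xs #|B|.+1.
Proof.
move=> mB; rewrite big_allpairs_dep big_allpairs -sum_trees_on // mulr_suml.
apply: eq_bigr => T _; rewrite /signed_comp_sum mulr_sumr.
have -> : #|m |: B| = #|B|.+1.
  by rewrite cardsU1; case: (boolP (m \in B)) => // /mB; rewrite ltnn.
apply: eq_bigr => al _; rewrite /triple_wt /=.
transitivity (\sum_(1 <= r < (head 0%N al).+1) (-1) ^+ (size al - 1) * q ^+ (r - 1) * q ^+ word_inv E (list_tree T) * \prod_(a <- al) elem_poly xs a).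
  rewrite /index_iota subSS subn0; apply: eq_bigr => r _; rewrite exprD.
  by rewrite -!mulrA; congr (_ * _); rewrite mulrCA.
rewrite big_add1 /= big_mkord /qint mulr_sumr mulr_suml mulr_sumr.
apply: eq_bigr => i _; rewrite subSS subn0.
suff h (a b c d : R) : a * b * c * d = c * (a * b * d) by apply: h.
by ring.
Qed.

Lemma csf0 (R : comNzRingType) (q : R) xs : csf E q xs set0 = 1.
Proof.
elim: xs => [|x xs IH] /=; first by rewrite eqxx.
rewrite (big_pred1 set0) => [|I]; last first.
  by rewrite subset0 /=; case: (eqVneq I set0) => [->|//]; rewrite independent0.
by rewrite set0D edges_up0r cards0 IH !mulr1.
Qed.

Lemma sum_forests (R : comNzRingType) (q : R) xs k Z : GRing.lreg (q - 1) -> (#|Z| <= k)%N ->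
  \sum_(F <- forests k Z) forest_wt q (elem_poly xs) F = csf E q xs Z.
Proof.
move=> reg_q; have nilE : forest_wt q (elem_poly xs) [::] = 1.
  by rewrite /forest_wt !big_nil !mulr1.
elim: k Z => [|k IH] Z /=.
  by rewrite leqn0 cards_eq0 => /eqP->; rewrite big_seq1 nilE csf0.
move=> Zk; case ee: (enum Z) => [|m s].
  by rewrite (enum_nil ee) big_seq1 nilE csf0.
have [mZ mmin] := enum_cons ee.
have mS v : v \in Z :\ m -> (m < v)%N.
  by rewrite !inE => /andP[vm vZ]; rewrite ltn_neqAle mmin // andbT eq_sym.
rewrite -[in RHS](setD1K mZ) (csf_rec symE irrE nuiE xs reg_q mS).
rewrite big_allpairs_dep big_allpairs_dep big_enum /=.
apply: eq_big => [U|U]; first by rewrite powersetE.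
rewrite powersetE => US.
have mU v : v \in U -> (m < v)%N by move/(subsetP US)/mS.
have mNU : m \notin U by apply/negP => /mU; rewrite ltnn.
have eD : Z :\: (m |: U) = Z :\ m :\: U by rewrite setDDl.
transitivity (\sum_(t <- triples_on (m |: U)) triple_wt q (elem_poly xs) t *
   (q ^+ edges_up E (Z :\ m :\: U) (m |: U) * csf E q xs (Z :\ m :\: U))).
  rewrite !big_seq; apply: eq_bigr => t /mem_triples_on[tt vt].
  have cD : (#|Z :\: (m |: U)| <= k)%N.
    rewrite -ltnS; apply: leq_trans Zk; apply: proper_card.
    rewrite properE subsetDl; apply/subsetPn; exists m => //.
    by rewrite !inE eqxx.
  rewrite vt eD -eD -IH // mulrA mulr_sumr !big_seq; apply: eq_bigr => F.
  rewrite -vt in cD *; move=> /(mem_forests _ cD) FF.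
  by rewrite (forest_wt_cons _ _ tt FF).
rewrite -mulr_suml sum_triples_on //.
rewrite edges_upU1r //.
have -> : down_deg E (Z :\ m :\: U) m = 0%N.
  apply/eqP; rewrite cards_eq0; apply/eqP/setP => u; rewrite !inE.
  apply/negP => /andP[/and3P[_ um uZ] /andP[lt _]].
  by move: (mmin u uZ); rewrite leqNgt lt.
by rewrite add0n; ring.
Qed.

End Forests.

(** * Elementary symmetric and chromatic polynomials as sums of monomials *)

Section StrictSequences.

Fixpoint strict_seqs (d j k : nat) : seq (seq nat) :=
  if d is d'.+1 then
    strict_seqs d' j.+1 k ++
    (if k is k'.+1 then [seq j :: s | s <- strict_seqs d' j.+1 k'] else [::])
  else if k is 0 then [:: [::]] else [::].

Lemma mem_strict_seqs d j k s : (s \in strict_seqs d j k) =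
  [&& size s == k, sorted ltn s & all (fun i => j <= i < j + d)%N s].
Proof.
elim: d j k s => [|d IH] j k s /=.
  case: s k => [|i s] [|k] //=; rewrite addn0 ?inE.
  by have -> : (j <= i < j)%N = false; [lia | rewrite !andbF].
have allS t : all (fun i => j.+1 <= i < j.+1 + d)%N t -> all (fun i => j <= i < j + d.+1)%N t.
  by apply: sub_all => i /andP[ji id]; rewrite ltnW //= addnS -addSn.
have sortedE i t : sorted ltn (i :: t) = sorted ltn t && all (ltn i) t.
  by rewrite /= (path_sortedE ltn_trans) andbC.
rewrite mem_cat IH; case: s => [|i s].
  by case: k => [|k] //=; apply/negbTE/negP => /mapP[].
apply/orP/and3P => [[/and3P[sk ss sj]|]|].
- by split => //; apply: allS.
- case: k => // k /mapP[t]; rewrite IH => /and3P[/eqP<- ts tj] [-> ->].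
  rewrite sortedE ts /= leqnn allS // addnS ltnS leq_addr; split => //.
  by apply: sub_all tj => a /andP[].
rewrite sortedE => -[/eqP<- /andP[ss si]] /= /andP[/andP[ji id] sj].
have [eji|nji] := eqVneq j i; [right|left].
  rewrite eji mem_map => [|? ? []//]; rewrite IH eqxx ss /=; apply/allP => a sa.
  by have := allP si a sa; have := allP sj a sa; move=> /=; lia.
rewrite eqxx ss si /=; apply/andP; split; first by lia.
by apply/allP => a sa; have := allP si a sa; have := allP sj a sa; move=> /=; lia.
Qed.

Lemma strict_seqs_uniq d j k : uniq (strict_seqs d j k).
Proof.
elim: d j k => [|d IH] j k /=; first by case: k.
rewrite cat_uniq IH; case: k => //= k; rewrite map_inj_uniq ?IH ?andbT => [|? ? []//].
apply/hasPn => _ /mapP[s _ ->]; rewrite mem_strict_seqs /= ltnn !andbF //.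
Qed.

Lemma elem_poly_strict (R : comNzRingType) (x : nat -> R) d j k :
  elem_poly [seq x i | i <- iota j d] k = \sum_(s <- strict_seqs d j k) \prod_(i <- s) x i.
Proof.
elim: d j k => [|d IH] j k /=.
  by case: k => [|k]; rewrite ?big_nil // big_seq1 big_nil.
rewrite big_cat IH; congr (_ + _); case: k => [|k]; first by rewrite big_nil mulr0.
by rewrite big_map IH mulr_sumr; apply: eq_bigr => s _; rewrite big_cons.
Qed.

End StrictSequences.

Section Colourings.
Variables (n : nat) (E : rel 'I_n).
Implicit Types (I Z : {set 'I_n}) (kap : {ffun 'I_n -> nat}).

Definition recolour I (j : nat) kap : {ffun 'I_n -> nat} :=
  [ffun v => if v \in I then j else kap v].

(* Colourings of [Z] only, extended by [0] to all vertices. *)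
Fixpoint colourings (d j : nat) Z : seq {ffun 'I_n -> nat} :=
  if d is d'.+1 then
    [seq recolour A j kap | A <- enum [pred A : {set 'I_n} | (A \subset Z) && independent E A],
       kap <- colourings d' j.+1 (Z :\: A)]
  else if Z == set0 then [:: [ffun=> 0%N]] else [::].

Definition colouring_on j d Z kap : Prop :=
  [/\ forall v, v \notin Z -> kap v = 0%N,
      forall v, v \in Z -> (j <= kap v < j + d)%N
    & forall u v, u \in Z -> v \in Z -> E u v -> kap u != kap v].

Definition asc_on Z kap : nat :=
  \sum_(v in Z) #|[set u in Z | [&& (u < v)%N, E u v & (kap u < kap v)%N]]|.

Lemma mem_colourings d j Z kap : kap \in colourings d j Z <-> colouring_on j d Z kap.
Proof.
elim: d j Z kap => [|d IH] j Z kap /=.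
  have [->|/set0Pn[z zZ]] := eqVneq Z set0; rewrite ?inE; last first.
    by split => // -[_ /(_ z zZ)]; rewrite addn0 leqNgt andNb.
  split=> [/eqP->|[k0 _ _]]; first by split => u; rewrite ?ffunE ?inE.
  by apply/eqP/ffunP => v; rewrite ffunE k0 ?inE.
split.
  case/allpairsPdep => I [kap' [+ /IH[k0 kj kp] ->]].
  rewrite mem_enum inE => /andP[IZ indI].
  have ZD v : v \in Z -> v \notin I -> v \in Z :\: I by rewrite inE => -> ->.
  have kne v : v \in Z -> v \notin I -> kap' v != j.
    by move=> vZ vI; have := kj v (ZD v vZ vI); case: eqP => // ->; rewrite ltnn.
  split=> [v vZ|v vZ|u v uZ vZ uv]; rewrite !ffunE.
  - have /negbTE-> : v \notin I by apply: contra vZ; apply/subsetP.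
    by apply: k0; rewrite inE (negbTE vZ) andbF.
  - case: ifPn => [_|/(ZD v vZ)/kj]; first by rewrite leqnn addnS ltnS leq_addr.
    by move=> /andP[? ?]; rewrite ltnW //= addnS -addSn.
  - case: ifPn => uI; case: ifPn => vI.
    + by move/forall_inP/(_ u uI)/forall_inP/(_ v vI): indI; rewrite uv.
    + by rewrite eq_sym; apply: kne.
    + by apply: kne.
    + by apply: kp => //; apply: ZD.
case=> k0 kj kp; pose I := [set v in Z | kap v == j].
have IZ : I \subset Z by apply/subsetP => v; rewrite inE => /andP[].
apply/allpairsPdep; exists I, (recolour I 0 kap); split.
- rewrite mem_enum inE IZ; apply/forall_inP => u; rewrite inE => /andP[uZ /eqP uj].
  apply/forall_inP => v; rewrite inE => /andP[vZ /eqP vj].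
  by apply/negP => /(kp u v uZ vZ); rewrite uj vj eqxx.
- apply/IH; split=> [v|v|u v]; rewrite !ffunE ?inE.
  + by case: (boolP (v \in Z)) => [_|/k0->]; case: (kap v == j).
  + case: (boolP (v \in Z)) => [vZ|]; last by rewrite andbF.
    by have := kj v vZ; case: eqP => //=; lia.
  + move=> /andP[uI uZ] /andP[vI vZ]; move: uI vI; rewrite uZ vZ /= => /negbTE-> /negbTE->.
    exact: kp.
- apply/ffunP => v; rewrite !ffunE inE.
  by case: (boolP (v \in Z)) => //= vZ; case: eqP.
Qed.

Lemma colourings_uniq d j Z : uniq (colourings d j Z).
Proof.
elim: d j Z => [|d IH] j Z /=; first by case: eqP.
apply: allpairs_uniq_dep => [|I _|[I k] [I' k']]; [exact: enum_uniq|exact: IH|].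
case/allpairsPdep => V [f [VZ /mem_colourings fc [-> ->]]].
case/allpairsPdep => V' [f' [VZ' /mem_colourings fc' [-> ->]]] /= e.
have setE W g : W \in enum [pred I : {set 'I_n} | (I \subset Z) && independent E I] ->
    colouring_on j.+1 d (Z :\: W) g -> W = [set v in Z | recolour W j g v == j].
  rewrite mem_enum inE => /andP[/subsetP WZ _] [_ gj _]; apply/setP => v; rewrite inE ffunE.
  case: ifPn => [vW|vW]; first by rewrite eqxx WZ.
  case: (boolP (v \in Z)) => //= vZ; symmetry; apply/eqP => gv.
  by have := gj v; rewrite inE vW vZ gv ltnn => /(_ isT).
have eV : V = V' by rewrite (setE _ _ VZ fc) (setE _ _ VZ' fc') e.
rewrite -eV in fc' e *; congr (existT _ _ _); apply/ffunP => v.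
have := congr1 (fun g : {ffun 'I_n -> nat} => g v) e; rewrite !ffunE.
by case: ifP => // vV _; case: fc fc' => f0 _ _ [f0' _ _]; rewrite f0 ?f0' // inE vV.
Qed.

Lemma asc_on_recolour I d j Z kap : I \subset Z -> independent E I ->
  colouring_on j.+1 d (Z :\: I) kap ->
  asc_on Z (recolour I j kap) = (edges_up E I (Z :\: I) + asc_on (Z :\: I) kap)%N.
Proof.
move=> /subsetP IZ indI [_ kj _]; rewrite /asc_on (bigID (mem I)) /=.
rewrite big1 ?add0n => [|v /andP[vZ vI]]; last first.
  apply/eqP; rewrite cards_eq0; apply/eqP/setP => u; rewrite !inE !ffunE vI.
  apply/negP => /and4P[uZ _ _]; case: ifPn => uI; first by rewrite ltnn.
  by have := kj u; rewrite inE uI uZ => /(_ isT); lia.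
rewrite /edges_up -big_split; apply: eq_big => [v|v /andP[vZ vI]]; first by rewrite inE andbC.
have jv : (j < kap v)%N by have := kj v; rewrite inE vI vZ => /(_ isT) /andP[].
rewrite /= /down_deg -cardsUI [X in (_ = _ + X)%N](_ : _ = 0%N) ?addn0.
  apply: eq_card => u; rewrite !inE !ffunE (negbTE vI).
  case: (boolP (u \in I)) => [uI|_] /=; last by case: (u \in Z).
  by rewrite IZ // jv !andbT orbF.
apply/eqP; rewrite cards_eq0; apply/eqP/setP => u; rewrite !inE.
by case: (u \in I); rewrite ?andbF.
Qed.

Lemma csf_colourings (R : comNzRingType) (q : R) (x : nat -> R) d j Z :
  csf E q [seq x i | i <- iota j d] Z =
  \sum_(kap <- colourings d j Z) q ^+ asc_on Z kap * \prod_(v in Z) x (kap v).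
Proof.
elim: d j Z => [|d IH] j Z /=.
  case: eqP => [->|_]; rewrite ?big_nil // big_seq1.
  by rewrite /asc_on !big_set0 mulr1.
rewrite big_allpairs_dep big_enum; apply: eq_bigr => I /andP[IZ indI].
rewrite IH !mulr_sumr !big_seq; apply: eq_bigr => kap /mem_colourings kc.
rewrite (asc_on_recolour IZ indI kc) [in RHS](big_setID I) /= (setIidPr IZ).
have -> : \prod_(v in I) x (recolour I j kap v) = x j ^+ #|I|.
  by rewrite -prodr_const; apply: eq_bigr => v vI; rewrite ffunE vI.
have -> : \prod_(v in Z :\: I) x (recolour I j kap v) = \prod_(v in Z :\: I) x (kap v).
  by apply: eq_bigr => v; rewrite inE ffunE => /andP[/negbTE->].
by rewrite exprD; ring.
Qed.

End Colourings.

Lemma graph_invE n (E : rel 'I_n) (s : seq 'I_n) : graph_inv E s = word_inv E s.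
Proof.
have graphE t : graph_inv E t = (\sum_(i < size t) \sum_(j < size t)
    ((i < j) && (tnth (in_tuple t) j < tnth (in_tuple t) i) &&
      E (tnth (in_tuple t) j) (tnth (in_tuple t) i)))%N.
  rewrite pair_bigA /= -big_mkcond /= sum1_card; apply: eq_card => p.
  by rewrite !unfold_in /= andbA.
elim: s => [|x s IH].
  by rewrite graphE big_ord0.
rewrite graphE /= big_ord_recl big_ord_recl /= add0n -IH graphE; congr (_ + _)%N.
  rewrite -sum1_count [RHS]big_mkcond [RHS]big_tnth; apply: eq_bigr => j _.
  by rewrite !(tnth_nth x) /=; case: (_ && _).
apply: eq_bigr => i _; rewrite big_ord_recl /= add0n; apply: eq_bigr => j _.
by rewrite !(tnth_nth x).
Qed.

Lemma is_forest_tripleE n (E : rel 'I_n) F : is_forest_triple E F <-> forest_on E [set: 'I_n] F.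
Proof.
by split=> -[tri cnt srt]; split => // v; rewrite cnt inE.
Qed.

(** * Power series *)

(* Imported only here, because [classical_sets] shadows many names of [finset]. *)
From mathcomp Require Import finmap multiset.
From mathcomp Require Import boolp classical_sets functions cardinality fsbigop.

Section SeriesRing.
Local Open Scope mset_scope.
Local Open Scope classical_set_scope.
Implicit Types (m p a b : {mset nat}%mset) (f g h : series).

Definition submonoms m : seq monom :=
  undup [seq seq_mset (mask (val t) (enum_mset m)) | t : (size (enum_mset m)).-tuple bool].

Lemma mem_submonoms m p : (p \in submonoms m) = (p `<=` m)%mset.
Proof.
rewrite mem_undup; apply/mapP/msubsetP => [[t _ ->] i|pm].
  rewrite mset_seqE -[leqRHS]count_mem_mset.
  by apply: leq_count_subseq; apply: mask_subseq.
have /count_subseqP[s /subseqP[t st es] ps] : forall i, (count_mem i (enum_mset p) <= count_mem i (enum_mset m))%N.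
  by move=> i; rewrite !count_mem_mset.
exists (Tuple (introT eqP st)); first by rewrite mem_enum.
by rewrite /= -es -[LHS]seq_mset_id; apply/eq_seq_msetP.
Qed.

Lemma submonoms_uniq m : uniq (submonoms m).
Proof. exact: undup_uniq. Qed.

Lemma series_mulE f g m : series_mul f g m =
  \sum_(p <- submonoms m) (f p * g (msetB m p) : {poly int}).
Proof.
rewrite /series_mul.
have -> : [set p : monom * monom | msetD p.1 p.2 = m] =
          [set` [seq (p, msetB m p) | p <- submonoms m]].
  apply/seteqP; split=> [[p p'] /= <-|[p p'] /= /mapP[a]].
    apply/mapP; exists p; first by rewrite mem_submonoms; apply/msubsetP => i; rewrite !msetE2 leq_addr.
    by congr pair; apply/msetP => i; rewrite !msetE2 addKn.
  by rewrite mem_submonoms => am [-> ->]; rewrite msetBDKC.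
rewrite -fsbig_seq; last by rewrite map_inj_uniq ?submonoms_uniq // => p p' [].
by rewrite big_map.
Qed.

Lemma perm_submonoms_compl m : perm_eq (submonoms m) [seq msetB m p | p <- submonoms m].
Proof.
apply: uniq_perm; rewrite ?submonoms_uniq //.
  rewrite map_inj_in_uniq ?submonoms_uniq // => p p'.
  rewrite !mem_submonoms => pm pm' e.
  by rewrite -(msetBBK pm) e msetBBK.
move=> p; rewrite mem_submonoms; apply/idP/mapP => [pm|[a _ ->]].
  by exists (msetB m p); rewrite ?msetBBK // mem_submonoms msubsetDl.
exact: msubsetDl.
Qed.

Lemma series_mulC : commutative series_mul.
Proof.
move=> f g; apply/funext => m; rewrite !series_mulE.
rewrite (perm_big _ (perm_submonoms_compl m)) big_map !big_seq; apply: eq_bigr => p.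
by rewrite mem_submonoms => pm; rewrite msetBBK // mulrC.
Qed.

Lemma msubD_B m a b : (a `<=` m)%mset -> ((b `<=` m `\` a) = (a `+` b `<=` m))%mset.
Proof.
move=> /msubsetP am; apply/msubsetP/msubsetP => h i; have := h i; have := am i; rewrite !msetE2; lia.
Qed.

Lemma series_mulA : associative series_mul.
Proof.
move=> f g h; apply/funext => m; rewrite !series_mulE.
pose G a b : {poly int} := f a * (g b * h (msetB (msetB m a) b)).
transitivity (\sum_(a <- submonoms m) \sum_(b <- submonoms m | (a `+` b `<=` m)%mset) G a b).
  rewrite !big_seq; apply: eq_bigr => a; rewrite mem_submonoms => am.
  rewrite series_mulE mulr_sumr -[RHS]big_filter; apply: perm_big.
  apply: uniq_perm; rewrite ?filter_uniq ?submonoms_uniq // => b.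
  rewrite mem_filter !mem_submonoms msubD_B //; case: (boolP (_ `<=` m)%mset) => //= abm.
  by symmetry; apply/msubsetP => i; have /msubsetP/(_ i) := abm; rewrite !msetE2; lia.
transitivity (\sum_(p <- submonoms m) \sum_(a <- submonoms m | (a `<=` p)%mset)
   f a * (g (msetB p a) * h (msetB m p))); last first.
  rewrite !big_seq; apply: eq_bigr => p; rewrite mem_submonoms => pm.
  rewrite series_mulE mulr_suml -[LHS]big_filter.
  rewrite (perm_big (submonoms p)); first by apply: eq_bigr => a _; rewrite mulrA.
  apply: uniq_perm; rewrite ?filter_uniq ?submonoms_uniq // => a.
  rewrite mem_filter !mem_submonoms; case: (boolP (a `<=` p)%mset) => //= ap.
  exact: msubset_trans ap pm.
rewrite [RHS](exchange_big_dep predT) //= [LHS]big_seq [RHS]big_seq; apply: eq_bigr => a.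
rewrite mem_submonoms => am.
rewrite -[LHS]big_filter -[RHS]big_filter.
rewrite [RHS](perm_big [seq msetD a b | b <- submonoms m & (a `+` b `<=` m)%mset]).
  rewrite big_map; apply: eq_bigr => b _; rewrite /G msetBDA; congr (_ * (g _ * _)).
  by apply/msetP => i; rewrite !msetE2 addKn.
apply: uniq_perm; rewrite ?filter_uniq ?submonoms_uniq //.
  rewrite map_inj_in_uniq ?filter_uniq ?submonoms_uniq // => b b' _ _ e.
  by apply/msetP => i; have /msetP/(_ i) := e; rewrite !msetE2 => /addnI.
move=> p; rewrite mem_filter mem_submonoms; apply/andP/mapP => [[ap pm]|[b]].
  exists (msetB p a); last by rewrite msetBDKC.
  rewrite mem_filter msetBDKC // pm mem_submonoms.
  exact: msubset_trans (msubsetDl _ _) pm.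
rewrite mem_filter => /andP[abm _] ->; split => //.
by apply/msubsetP => i; rewrite !msetE2 leq_addr.
Qed.

Lemma series_mul1 : left_id series1 series_mul.
Proof.
move=> f; apply/funext => m; rewrite series_mulE (bigD1_seq mset0) ?submonoms_uniq //=.
  rewrite big1 ?addr0 => [|p /negbTE p0]; last by rewrite /series1 p0 mul0r.
  by rewrite /series1 eqxx mul1r msetB0.
by rewrite mem_submonoms msub0set.
Qed.

Lemma series_mulDl : left_distributive series_mul +%R.
Proof.
move=> f g h; apply/funext => m; rewrite [RHS]/GRing.add /= !series_mulE -big_split.
by apply: eq_bigr => p _; exact: mulrDl.
Qed.

Lemma series1_neq0 : series1 != 0 :> series.
Proof.
by apply/eqP => /(congr1 (fun f : series => f mset0)) /eqP; rewrite /series1 eqxx oner_eq0.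
Qed.

End SeriesRing.

HB.instance Definition _ := GRing.Zmodule_isComNzRing.Build series
  series_mulA series_mulC series_mul1 series_mulDl series1_neq0.

Lemma series_scalerAl (c : {poly int}) (f g : series) : c *: (f * g) = c *: f * g.
Proof.
apply/funext => m; rewrite [RHS]series_mulE; rewrite [LHS]/GRing.scale /=.
rewrite [(f * g) m]series_mulE [LHS]mulr_sumr; apply: eq_bigr => p _; exact: mulrA.
Qed.

HB.instance Definition _ := GRing.Lmodule_isLalgebra.Build {poly int} series series_scalerAl.

Section Truncation.
Local Open Scope mset_scope.
Local Open Scope classical_set_scope.
Implicit Types (m p : monom) (f g : series).

Lemma lreg_q_sub1 : GRing.lreg ('X%:A - 1 : series).
Proof.
move=> f g e; apply/funext => m; have := congr1 (fun h : series => h m) e.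
have sE (h : series) : ('X%:A - 1) * h = ('X - 1 : {poly int}) *: h.
  by rewrite mulrBl mulr_algl mul1r scalerBl scale1r.
rewrite !sE => /mulfI; apply.
by rewrite -polyC1 polyXsubC_eq0.
Qed.

Definition bounded N m := all (gtn N) (enum_mset m).

Definition trunc N f : series := fun m => if bounded N m then f m else 0.

Lemma trunc_is_zmod_morphism N : zmod_morphism (trunc N).
Proof.
move=> f g; apply/funext => m; rewrite [RHS]/GRing.add /= /GRing.opp /= /trunc.
by case: ifP => // _; rewrite subr0.
Qed.

HB.instance Definition _ N :=
  GRing.isZmodMorphism.Build series series (trunc N) (trunc_is_zmod_morphism N).

Lemma bounded0 N : bounded N mset0.
Proof. by apply/allP => i; rewrite in_mset0. Qed.

Lemma bounded_split N m p : (p `<=` m)%mset ->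
  bounded N m = bounded N p && bounded N (m `\` p)%mset.
Proof.
move=> pm; rewrite -[in LHS](msetBDKC pm); apply/allP/andP => [h|[/allP h1 /allP h2] i].
  by split; apply/allP => i ip; apply: h; rewrite in_msetD ip ?orbT.
by rewrite in_msetD => /orP[/h1|/h2].
Qed.

Lemma trunc_is_monoid_morphism N : monoid_morphism (trunc N).
Proof.
split=> [|f g]; apply/funext => m; rewrite /trunc.
  case: ifPn => // bm; rewrite /GRing.one /= /series1; case: eqP => // m0.
  by rewrite m0 bounded0 in bm.
rewrite [RHS]series_mulE [(f * g) m]series_mulE.
rewrite [RHS]big_seq [X in if _ then X else _]big_seq; case: ifP => bm.
  by apply: eq_bigr => p; rewrite mem_submonoms => /bounded_split b; move: bm; rewrite b => /andP[-> ->].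
rewrite big1 // => p; rewrite mem_submonoms => /bounded_split b; move: bm; rewrite b.
by case: bounded; case: bounded; rewrite ?mulr0 ?mul0r.
Qed.

HB.instance Definition _ N :=
  GRing.isMonoidMorphism.Build series series (trunc N) (trunc_is_monoid_morphism N).

Lemma trunc_scale N c f : trunc N (c *: f) = c *: trunc N f.
Proof.
by apply/funext => m; rewrite /trunc /GRing.scale /=; case: ifP => // _; rewrite [RHS]mulr0.
Qed.

Definition mono p : series := fun m => (m == p)%:R.

Lemma mono_mul p f m : (mono p * f) m = if (p `<=` m)%mset then f (m `\` p)%mset else 0.
Proof.
rewrite [LHS]series_mulE /mono; case: ifPn => pm.
  rewrite (bigD1_seq p) ?submonoms_uniq ?mem_submonoms //= eqxx mul1r.
  by rewrite big1 ?addr0 // => a /negbTE->; rewrite mul0r.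
rewrite big_seq big1 // => a; rewrite mem_submonoms; case: eqP => [->|_]; rewrite ?mul0r //.
by rewrite (negbTE pm).
Qed.

Lemma mono0 : mono mset0 = 1. Proof. by []. Qed.

Lemma monoD p p' : mono (p `+` p')%mset = mono p * mono p'.
Proof.
apply/funext => m; rewrite mono_mul /mono; case: ifPn => pm.
  congr ((nat_of_bool _)%:R); apply/eqP/eqP => [->|<-]; last by rewrite msetBDKC.
  by apply/msetP => i; rewrite !msetE2 addKn.
by case: eqP pm => // ->; case/msubsetP => i; rewrite !msetE2 leq_addr.
Qed.

Lemma mono_prod (s : seq nat) : mono (monom_of_seq s) = \prod_(i <- s) mono (monom_of_seq [:: i]).
Proof.
elim: s => [|i s IH]; rewrite ?big_nil ?big_cons -?IH -?monoD -?mono0 /monom_of_seq; congr mono.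
  by apply/msetP => j; rewrite mset_seqE mset0E.
by apply/msetP => j; rewrite msetE2 !mset_seqE /= addn0.
Qed.

Lemma trunc_series_sum (I : choiceType) (D : set I) (w : I -> {poly int}) (s : I -> seq nat)
    N (r : seq I) : uniq r -> (forall i, i \in r <-> D i /\ all (gtn N) (s i)) ->
  trunc N (series_sum D w (fun i => monom_of_seq (s i))) =
  \sum_(i <- r) w i *: \prod_(a <- s i) mono (monom_of_seq [:: a]).
Proof.
move=> r_uniq rE.
have sumE (F : I -> series) m : (\sum_(i <- r) F i) m = \sum_(i <- r) F i m.
  by elim: r {r_uniq rE} => [|i r IH]; rewrite ?big_nil // !big_cons -IH.
apply/funext => m; rewrite sumE /trunc.
have bE i : monom_of_seq (s i) = m -> bounded N m = all (gtn N) (s i).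
  by move=> <-; apply: perm_all; apply: perm_eq_seq_mset.
transitivity (\sum_(i <- r | monom_of_seq (s i) == m) w i); last first.
  rewrite big_mkcond; apply: eq_bigr => i _; rewrite -mono_prod [RHS]/GRing.scale /= /mono eq_sym.
  by case: eqP => _; rewrite /GRing.scale /= ?mulr1 ?mulr0.
case: ifPn => bm; last first.
  rewrite big_seq_cond big1 // => i /andP[/rE[_ bi] /eqP im].
  by rewrite (bE i im) bi in bm.
rewrite -big_filter fsbig_seq ?filter_uniq // /series_sum; congr (\sum_(i \in _) _).
apply/seteqP; split=> i /=; rewrite mem_filter.
  by case=> Di im; rewrite im eqxx; apply/rE; rewrite -(bE i im).
by case/andP => /eqP im /rE[].
Qed.

Lemma trunc_elem_sym N k :
  trunc N (elem_sym k) = elem_poly [seq mono (monom_of_seq [:: i]) | i <- iota 0 N] k.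
Proof.
rewrite elem_poly_strict.
rewrite (@trunc_series_sum _ _ _ _ N (pmap insub (strict_seqs N 0 k))); first last.
- move=> t; rewrite mem_pmap_sub /= mem_strict_seqs size_tuple eqxx /=.
  by split=> [/andP[]|[-> ->]].
- by apply: pmap_sub_uniq; apply: strict_seqs_uniq.
transitivity (\sum_(s <- map val (pmap (insub : _ -> option (k.-tuple nat)) (strict_seqs N 0 k)))
    \prod_(i <- s) mono (monom_of_seq [:: i])).
  by rewrite big_map; apply: eq_bigr => t _; rewrite scale1r.
rewrite (pmap_filter (insubK _)) big_filter big_seq_cond [RHS]big_seq_cond.
apply: eq_bigl => s; rewrite andbT mem_strict_seqs.
by case: insubP => [t -> _|/negbTE->]; rewrite ?andbT.
Qed.

End Truncation.

Section ForestExpansion.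
Variables (n : nat) (E : rel 'I_n).
Hypotheses (symE : symmetric E) (irrE : irreflexive E)
  (nuiE : natural_unit_interval E).
Local Open Scope classical_set_scope.
Implicit Types (F : seq (tree_triple n)) (mu : seq nat).

Local Notation vars N := [seq mono (monom_of_seq [:: i]) | i <- iota 0 N].
Local Notation q := ('X%:A : series).

Lemma scale_in_alg (c : {poly int}) (f : series) : c *: f = in_alg series c * f.
Proof. by rewrite /= mulr_algl. Qed.

Lemma asc_on_setT kap : asc_on E finset.setT kap = asc E kap.
Proof.
transitivity (\sum_(v : 'I_n) \sum_(u : 'I_n) [&& (u < v)%N, E u v & (kap u < kap v)%N])%N.
  apply: eq_big => [v|v _]; first by rewrite inE.
  by rewrite -sum1_card big_mkcond; apply: eq_bigr => u _; rewrite !inE.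
rewrite exchange_big pair_bigA /asc -sum1_card [RHS]big_mkcond; apply: eq_bigr => p _.
by rewrite unfold_in /=; case: [&& _, _ & _].
Qed.

Lemma trunc_chromatic N : trunc N (chromatic_qsf E) = csf E q (vars N) finset.setT.
Proof.
rewrite csf_colourings (@trunc_series_sum _ _ _ _ N (colourings E N 0 finset.setT)).
- apply: eq_bigr => kap _; rewrite scale_in_alg rmorphXn /= asc_on_setT; congr (_ * _).
  by rewrite big_map big_enum; apply: eq_bigl => v; rewrite finset.in_setT.
- exact: colourings_uniq.
move=> kap; apply: (iff_trans (mem_colourings _ _ _ _ _)); split=> [[_ kN kp]|[kp kN]].
  split=> [u v|]; first exact: kp (finset.in_setT _) (finset.in_setT _).
  by apply/allP => _ /mapP[v _ ->]; have /andP[] := kN v (finset.in_setT _).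
split=> [v|v _|u v _ _]; [by rewrite finset.in_setT| |exact: kp].
by rewrite add0n; apply: (allP kN); apply: map_f; rewrite mem_enum.
Qed.

Local Notation weight F := (ft_sign F * 'X^(ft_weight E F)).
Local Notation all_forests := (forests E n [set: 'I_n]%SET).

Lemma trunc_forest_term N F :
  trunc N (weight F *: elem_sym_part (ft_type F)) =
  forest_wt E q (elem_poly (vars N)) F.
Proof.
rewrite trunc_scale scale_in_alg /forest_wt /ft_sign /ft_weight graph_invE.
rewrite rmorphM !rmorphXn rmorphN1 /=; congr (_ * _).
rewrite -[elem_sym_part _]/(\prod_(k <- ft_type F) elem_sym k).
rewrite rmorph_prod (perm_big (flatten [seq tt_comp t | t <- F])) /=; last by rewrite perm_sort.
by apply: eq_bigr => k _; rewrite trunc_elem_sym.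
Qed.

Lemma chromatic_forests :
  chromatic_qsf E = \sum_(F <- all_forests) weight F *: elem_sym_part (ft_type F).
Proof.
set f := RHS; apply/funext => m.
pose N := (\max_(i <- enum_mset m) i).+1.
have bm : bounded N m.
  by apply/allP => i im; rewrite /= ltnS leq_bigmax_seq.
suff /(congr1 (fun h : series => h m)) : trunc N (chromatic_qsf E) = trunc N f.
  by rewrite /trunc bm.
rewrite trunc_chromatic raddf_sum -(@sum_forests n E symE irrE nuiE _ _ _ n); last 2 first.
- exact: lreg_q_sub1.
- by rewrite cardsT card_ord.
by apply: eq_bigr => F _; rewrite -trunc_forest_term.
Qed.

Lemma FTE : FT E = [set` all_forests].
Proof.
have cT : (#|[set: 'I_n]%SET| <= n)%N by rewrite cardsT card_ord.
apply/seteqP; split=> F /= => [/is_forest_tripleE /(mem_forests _ _ cT)|] //.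
by move=> /(mem_forests _ _ cT) /is_forest_tripleE.
Qed.

Lemma ft_type_partition F : FT E F -> is_partition (ft_type F).
Proof.
case=> tri _ _; rewrite /is_partition /ft_type sort_sorted => [|a b]; last exact: leq_total.
rewrite /= (perm_all _ (permEl (perm_sort _ _))); apply/allP => a.
by case/flatten_mapP => t /tri[_ /allP comp _ _] /comp.
Qed.

Lemma FT_muE mu : FT_mu E mu = [set` [seq F <- all_forests | ft_type F == mu]].
Proof.
rewrite /FT_mu FTE; apply/seteqP; split=> F /=; rewrite mem_filter.
  by case=> -> ->; rewrite eqxx.
by case/andP => /eqP-> ->.
Qed.

Lemma chromatic_forests_by_type :
  chromatic_qsf E =
    \sum_(mu \in [set mu : seq nat | is_partition mu])
      (\sum_(F \in FT_mu E mu) weight F) *: elem_sym_part mu.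
Proof.
have termE mu : (\sum_(F \in FT_mu E mu) weight F) *: elem_sym_part mu =
    \sum_(F <- all_forests | ft_type F == mu) weight F *: elem_sym_part (ft_type F).
  rewrite FT_muE -fsbig_seq ?filter_uniq ?forests_uniq // big_filter scaler_suml.
  by apply: eq_bigr => F /eqP->.
pose types := undup [seq ft_type F | F <- all_forests].
have typesE mu : mu \in types -> is_partition mu.
  rewrite mem_undup => /mapP[F FF ->]; apply: ft_type_partition.
  by rewrite FTE.
rewrite chromatic_forests; under eq_fsbigr do rewrite termE.
rewrite -(fsbig_widen [set` types]) => [|//|mu [_ /= nmu]]; last first.
  rewrite big_seq_cond big1 // => F /andP[FF /eqP mF]; case: nmu.
  by rewrite mem_undup -mF map_f.
rewrite -fsbig_seq ?undup_uniq // (exchange_big_dep predT) //= [LHS]big_seq [RHS]big_seq.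
apply: eq_bigr => F FF; rewrite big_mkcond (bigD1_seq (ft_type F)) ?undup_uniq //=.
  by rewrite eqxx big1 ?addr0 // => mu; rewrite eq_sym => /negbTE->.
by rewrite mem_undup map_f.
Qed.

End ForestExpansion.

Local Open Scope classical_set_scope.

Theorem theorem3p4 (n : nat) (E : rel 'I_n) (symE : symmetric E)
    (irrE : irreflexive E) (nuiE : natural_unit_interval E) :
  chromatic_qsf E =
    \sum_(F \in FT E)
      (ft_sign F * 'X^(ft_weight E F)) *: elem_sym_part (ft_type F)
  /\
  chromatic_qsf E =
    \sum_(mu \in [set mu : seq nat | is_partition mu])
      (\sum_(F \in FT_mu E mu) (ft_sign F * 'X^(ft_weight E F)))
        *: elem_sym_part mu.
Proof.
split; last exact: chromatic_forests_by_type.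
by rewrite FTE // -fsbig_seq ?forests_uniq // chromatic_forests.
Qed.
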